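(* Let $K$ be a global field, $\mathfrak{A}$ a quaternion algebra over $K$, and $X$ an A-curve with field of functions $K$. For an $X$-order of maximal rank $\mathfrak{D}$ in $\mathfrak{A}$, the following conditions are equivalent: (1) $\mathfrak{D}=\mathcal{O}_X+I\mathfrak{D}_0$ for an Eichler order $\mathfrak{D}_0$ and an integral ideal $I$ such that $I_\wp=\mathcal{O}_\wp$ for every $\wp\in X$ for which $\mathfrak{A}_\wp$ is a division algebra. (2) $\mathfrak{D}$ is the intersection of a finite family of maximal orders. (3) $\mathfrak{D}$ is the intersection of three (not necessarily distinct) maximal orders.
   Context: A-curve $X$ with field of functions $K$: if $K$ is a number field, $X=\mathrm{Spec}(\mathcal{O}_{K,S})$ for a finite set $S$ of places containing the archimedean ones; if $K$ is a function field, $X$ is an affine or projective smooth curve over a finite field with function field $K$. Thus $X$ is identified with the set of places of $K$ outside a finite set $S$. For $\wp\in X$, $K_\wp$ is the completion, $\mathcal{O}_\wp$ its ring of integers, $\mathfrak{A}_\wp=\mathfrak{A}\otimes_K K_\wp$. An $X$-lattice in a finite-dimensional $K$-space $V$ is a family $\Lambda=(\Lambda_\wp)_{\wp\in X}$ of $\mathcal{O}_\wp$-lattices $\Lambda_\wp\subset V_\wp$ of full rank which, for some (any) $K$-basis of $V$, equals the lattice spanned by the basis for almost all $\wp$ (equivalently, a locally free sheaf on $X$ with generic fiber $V$). An $X$-order of maximal rank in $\mathfrak{A}$ is an $X$-lattice in $\mathfrak{A}$ such that every completion $\mathfrak{D}_\wp$ is a subring of $\mathfrak{A}_\wp$ containing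 $1$; it is maximal if it is maximal under inclusion. Inclusions, sums, products and intersections are taken place by place. An integral ideal $I$ is an $X$-lattice in $K$ with $I_\wp\subseteq\mathcal{O}_\wp$ for all $\wp\in X$; $\mathcal{O}_X+I\mathfrak{D}_0$ has completions $\mathcal{O}_\wp+I_\wp\mathfrak{D}_{0\wp}$. An Eichler order is the intersection of two maximal orders. *)

(* Defs.v *)
From HB Require Import structures.
From mathcomp Require Import all_boot all_order all_algebra all_field.
From mathcomp Require Import generic_quotient ring_quotient fraction.
From mathcomp Require Import boolp classical_sets functions cardinality.
From mathcomp Require Import zify ring.

Set Implicit Arguments.
Unset Strict Implicit.
Unset Printing Implicit Defensive.

Import Order.TTheory GRing.Theory Num.Theory.
Local Open Scope ring_scope.
Local Open Scope classical_set_scope.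

Definition number_field (K : fieldType) : Prop :=
  exists (L : fieldExtType rat) (f : {rmorphism K -> L}), bijective f.

Definition function_field (K : fieldType) : Prop :=
  exists (F : finFieldType) (L : fieldExtType {fraction {poly F}})
         (f : {rmorphism K -> L}), bijective f.

Definition global_field (K : fieldType) : Prop :=
  number_field K \/ function_field K.

(* A non-archimedean place, given by its unique normalized valuation (every
   non-archimedean place of a global field is discrete).  The valuation takes
   the junk value 0 at 0, so that two places are equal iff their valuations
   agree as functions; the intended value is +oo, and [vge] below uses it. *)
Record place (K : fieldType) := Place {
  place_val :> K -> int;
  place0 : place_val 0 = 0;
  placeM : forall x y, x != 0 -> y != 0 ->
    place_val (x * y) = place_val x + place_val y;
  placeD : forall x y, x != 0 -> y != 0 -> x + y != 0 ->
    Num.min (place_val x) (place_val y) <= place_val (x + y);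
  place_uniformizer : exists2 x, x != 0 & place_val x = 1 }.

Section PlaceTheory.
Variables (K : fieldType) (v : place K).

Definition vge (n : int) (x : K) : bool := (x == 0) || (n <= v x).

Definition valuation_ring : set K := [set x | vge 0 x].

Definition cauchy (u : nat -> K) : Prop :=
  forall n : int, exists N : nat, forall i j : nat,
    (N <= i)%N -> (N <= j)%N -> vge n (u i - u j).

Definition converges (u : nat -> K) (l : K) : Prop :=
  forall n : int, exists N : nat, forall i : nat, (N <= i)%N -> vge n (u i - l).

Lemma vge0 n : vge n 0. Proof. by rewrite /vge eqxx. Qed.

Lemma place1 : v 1 = 0.
Proof.
have n1 : (1 : K) != 0 by exact: oner_neq0.
by have := placeM v n1 n1; rewrite mulr1; lia.
Qed.

Lemma placeV x : v x^-1 = - v x.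
Proof.
have [->|x0] := eqVneq x 0; first by rewrite invr0 place0 oppr0.
have := placeM v x0 (invr_neq0 x0); rewrite divff// place1; lia.
Qed.

Lemma placeN x : v (- x) = v x.
Proof.
have [->|x0] := eqVneq x 0; first by rewrite oppr0.
have N10 : (- 1 : K) != 0 by rewrite oppr_eq0 oner_eq0.
have h : v (-1) = 0 by have := placeM v N10 N10; rewrite mulrNN mulr1 place1; lia.
by have := placeM v N10 x0; rewrite mulN1r h add0r.
Qed.

Lemma vgeN n x : vge n (- x) = vge n x.
Proof. by rewrite /vge oppr_eq0 placeN. Qed.

Lemma vgeW m n x : m <= n -> vge n x -> vge m x.
Proof. by rewrite /vge => mn /orP[->//|h]; rewrite (le_trans mn h) orbT. Qed.

Lemma vgeD n x y : vge n x -> vge n y -> vge n (x + y).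
Proof.
rewrite /vge; have [->|x0] := eqVneq x 0; first by rewrite add0r.
have [->|y0] := eqVneq y 0; first by rewrite addr0 (negPf x0).
have [//|xy0] := eqVneq (x + y) 0; rewrite /= => nx ny.
by apply: le_trans (placeD v x0 y0 xy0); rewrite le_min nx.
Qed.

Lemma vgeB n x y : vge n x -> vge n y -> vge n (x - y).
Proof. by move=> ? ?; rewrite vgeD ?vgeN. Qed.

Lemma vgeM m n x y : vge m x -> vge n y -> vge (m + n) (x * y).
Proof.
rewrite /vge mulf_eq0.
have [//|x0] := eqVneq x 0; have [//|y0] /= := eqVneq y 0 => h1 h2.
by rewrite (placeM v x0 y0) lerD.
Qed.

Lemma place_eq x d n : x != 0 -> v x < n -> vge n d ->
  x + d != 0 /\ v (x + d) = v x.
Proof.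
move=> x0 xn; rewrite /vge; have [->|d0] := eqVneq d 0; first by rewrite addr0.
rewrite /= => nd; have s0 : x + d != 0.
  apply/eqP => /eqP; rewrite addr_eq0 => /eqP xd.
  by move: xn; rewrite xd placeN; lia.
split=> //; have Nd0 : - d != 0 by rewrite oppr_eq0.
have := placeD v x0 d0 s0; have := placeD v s0 Nd0.
by rewrite addrK placeN => /(_ x0); lia.
Qed.

Lemma cauchy_bounded u : cauchy u ->
  exists m N, forall i, (N <= i)%N -> vge m (u i).
Proof.
move=> /(_ 0)[N h]; exists (Num.min 0 (v (u N))), N => i Ni.
rewrite -(subrK (u N) (u i)) vgeD//; first by apply: vgeW (h _ _ Ni (leqnn N)); lia.
by rewrite /vge ge_min lexx !orbT.
Qed.

Lemma cauchyB u w : cauchy u -> cauchy w -> cauchy (fun i => u i - w i).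
Proof.
move=> cu cw n; have [N1 h1] := cu n; have [N2 h2] := cw n.
exists (maxn N1 N2) => i j; rewrite !geq_max => /andP[i1 i2] /andP[j1 j2].
have -> : u i - w i - (u j - w j) = u i - u j - (w i - w j) by ring.
by rewrite vgeB ?h1 ?h2.
Qed.

Lemma cauchyM u w : cauchy u -> cauchy w -> cauchy (fun i => u i * w i).
Proof.
move=> cu cw n.
have [m [M hM]] := cauchy_bounded cu; have [p [P hP]] := cauchy_bounded cw.
have [N1 h1] := cu (n - p); have [N2 h2] := cw (n - m).
exists (maxn (maxn M P) (maxn N1 N2)) => i j; rewrite !geq_max.
move=> /andP[/andP[iM iP] /andP[i1 i2]] /andP[/andP[jM jP] /andP[j1 j2]].
have -> : u i * w i - u j * w j = u i * (w i - w j) + (u i - u j) * w j.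
  by ring.
apply: vgeD.
  have := vgeM (hM i iM) (h2 i j i2 j2); by rewrite addrC subrK.
have := vgeM (h1 i j i1 j1) (hP j jP); by rewrite subrK.
Qed.

Lemma cauchy_cst c : cauchy (fun=> c).
Proof. by move=> n; exists 0%N => *; rewrite subrr vge0. Qed.

Lemma converges_cauchy u l : converges u l -> cauchy u.
Proof.
move=> h n; have [N hN] := h n; exists N => i j Ni Nj.
rewrite -(subrK l (u i)) -addrA -[l - u j]opprB; exact: vgeB (hN _ Ni) (hN _ Nj).
Qed.

Lemma cauchy_nonnull u : cauchy u -> ~ converges u 0 ->
  exists m N, forall i, (N <= i)%N -> u i != 0 /\ v (u i) = m.
Proof.
move=> cu /existsNP[n /forallNP hn]; have [N hN] := cu n.
have /existsNP[i0 /not_implyP[Ni0 /negP]] := hn N.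
rewrite subr0 /vge negb_or -ltNge => /andP[ui0 vi0].
exists (v (u i0)), N => i Ni; have := place_eq ui0 vi0 (hN i i0 Ni Ni0).
by rewrite addrC subrK.
Qed.

Lemma cauchyV u m N : cauchy u ->
  (forall i, (N <= i)%N -> u i != 0 /\ v (u i) = m) -> cauchy (fun i => (u i)^-1).
Proof.
move=> cu hu n; have [P hP] := cu (n + m + m).
exists (maxn N P) => i j; rewrite !geq_max => /andP[iN iP] /andP[jN jP].
have [ui vi] := hu i iN; have [uj vj] := hu j jN.
have -> : (u i)^-1 - (u j)^-1 = (u j - u i) * ((u i)^-1 * (u j)^-1).
  rewrite mulrBl mulrCA divff// mulr1 mulrA divff// mul1r //.
have vV : vge (- m - m) ((u i)^-1 * (u j)^-1).
  by apply: vgeM; rewrite /vge placeV ?vi ?vj lexx orbT.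
by have := vgeM (hP j i jP iP) vV; rewrite [X in vge X _](_ : _ = n)//; lia.
Qed.

End PlaceTheory.

(* Complete field with a discrete valuation extending that of v, in which K is
   dense; it is unique up to a unique isomorphism. *)
Record completion (K : fieldType) (v : place K) := Completion {
  cfield :> fieldType;
  cembed : {rmorphism K -> cfield};
  cplace : place cfield;
  cplaceE : forall x, cplace (cembed x) = v x;
  cdense : forall (a : cfield) (n : int), exists x, vge cplace n (a - cembed x);
  ccomplete : forall u : nat -> cfield,
    cauchy cplace u -> exists l, converges cplace u l }.

Module CauchyCompletion.
Section Construction.
Variables (K : fieldType) (v : place K).

Definition cauchyp : {pred nat -> K} := fun u => `[< cauchy v u >].

Lemma cauchyp_subring : subring_closed cauchyp.
Proof.
split=> [|u w /asboolP hu /asboolP hw|u w /asboolP hu /asboolP hw]; apply/asboolP.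
- exact: cauchy_cst.
- exact: cauchyB.
- exact: cauchyM.
Qed.
HB.instance Definition _ := GRing.isSubringClosed.Build _ cauchyp cauchyp_subring.

Record cseq := CSeq { cval :> nat -> K; cvalP : cval \in cauchyp }.
HB.instance Definition _ := [isSub for cval].
HB.instance Definition _ := [Choice of cseq by <:].
HB.instance Definition _ := [SubChoice_isSubComNzRing of cseq by <:].

Definition nullp : {pred cseq} := fun u => `[< converges v (cval u) 0 >].

Lemma nullp_ideal : idealr_closed nullp.
Proof.
split.
- by apply/asboolP => n; exists 0%N => i _; rewrite subr0 vge0.
- apply/asboolP => /(_ 1) [N /(_ N (leqnn N))].
  by rewrite subr0 /vge /= oner_eq0 place1.
- move=> a u w /asboolP hu /asboolP hw; apply/asboolP => n.
  have [m [M hM]] := cauchy_bounded (asboolW (cvalP a)).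
  have [N hN] := hu (n - m); have [P hP] := hw n.
  exists (maxn M (maxn N P)) => i; rewrite !geq_max => /and3P[iM iN iP].
  rewrite subr0; apply: (@vgeD _ v n (cval a i * cval u i) (cval w i)).
    have := hN i iN; rewrite subr0 => /(vgeM (hM i iM)).
    by rewrite addrC subrK.
  by have := hP i iP; rewrite subr0.
Qed.
HB.instance Definition _ := isIdealr.Build _ nullp nullp_ideal.

Definition quot := {ideal_quot nullp}.
HB.instance Definition _ := GRing.ComNzRing.on quot.

Local Open Scope quotient_scope.

Definition cls (u : cseq) : quot := \pi_quot u.

Lemma clsK x : cls (repr x) = x. Proof. exact: reprK. Qed.

Lemma cls0 : cls 0 = 0. Proof. exact: (rmorph0 (\pi_quot)). Qed.
Lemma cls1 : cls 1 = 1. Proof. exact: (rmorph1 (\pi_quot)). Qed.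
Lemma clsD u w : cls (u + w) = cls u + cls w.
Proof. exact: (rmorphD (\pi_quot)). Qed.
Lemma clsB u w : cls (u - w) = cls u - cls w.
Proof. exact: (rmorphB (\pi_quot)). Qed.
Lemma clsM u w : cls (u * w) = cls u * cls w.
Proof. exact: (rmorphM (\pi_quot)). Qed.

Lemma cls_eq u w : (cls u == cls w) = (u - w \in nullp).
Proof. by rewrite /cls -Quotient.idealrBE. Qed.

Lemma cls_eq0 u : (cls u == 0) = (u \in nullp).
Proof. by rewrite -cls0 cls_eq subr0. Qed.

Lemma cls_neq0 u : cls u != 0 ->
  exists m N, forall i, (N <= i)%N -> cval u i != 0 /\ v (cval u i) = m.
Proof.
rewrite cls_eq0 => /negP h; apply: cauchy_nonnull (asboolW (cvalP u)) _ => h'.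
by apply: h; apply/asboolP.
Qed.

Lemma exists_inv (x : quot) : exists y, (x != 0 -> y * x = 1) /\ (x = 0 -> y = 0).
Proof.
have [->|x0] := eqVneq x 0; first by exists 0.
have := x0; rewrite -{1}(clsK x) => /cls_neq0[m [N hN]].
pose u i := (cval (repr x) i)^-1.
have cu : u \in cauchyp by apply/asboolP/(cauchyV (asboolW (cvalP _)) hN).
exists (cls (CSeq cu)); split=> [_|xe]; last by rewrite xe eqxx in x0.
rewrite -[in LHS](clsK x) -clsM -cls1; apply/eqP; rewrite cls_eq.
apply/asboolP => n; exists N => i /hN[ui _].
suff -> : cval (CSeq cu * repr x - 1) i = 0 by rewrite subrr vge0.
by change (u i * cval (repr x) i - 1 = 0); rewrite mulVf ?subrr.
Qed.

Definition inv (x : quot) : quot := projT1 (cid (exists_inv x)).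

Lemma mulVx x : x != 0 -> inv x * x = 1.
Proof. by rewrite /inv; case: cid => y [] /= h _ /h. Qed.

Lemma inv0 : inv 0 = 0.
Proof. by rewrite /inv; case: cid => y [] /= _; apply. Qed.

HB.instance Definition _ := GRing.ComNzRing_isField.Build quot mulVx inv0.

Lemma exists_val (x : quot) : exists m : int, (x = 0 -> m = 0) /\
  (x != 0 -> exists N, forall i, (N <= i)%N ->
     cval (repr x) i != 0 /\ v (cval (repr x) i) = m).
Proof.
have [->|x0] := eqVneq x 0; first by exists 0; split.
have := x0; rewrite -{1}(clsK x) => /cls_neq0[m [N hN]].
by exists m; split=> [xe|_]; [rewrite xe eqxx in x0 | exists N].
Qed.

Definition val (x : quot) : int := projT1 (cid (exists_val x)).

Lemma val0 : val 0 = 0.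
Proof. by rewrite /val; case: cid => m [] /= h _; apply: h. Qed.

Lemma valE u m : cls u != 0 ->
  (exists N, forall i, (N <= i)%N -> v (cval u i) = m) -> val (cls u) = m.
Proof.
move=> u0 [N hN]; rewrite /val; case: cid => p [] /= _ /(_ u0)[M hM].
have /eqP := clsK (cls u); rewrite cls_eq => /asboolP/(_ (p + 1))[P hP].
pose i := maxn N (maxn M P).
have [iN iM iP] : [/\ (N <= i)%N, (M <= i)%N & (P <= i)%N].
  by rewrite /i !leq_max !leqnn ?orbT.
rewrite -(hN i iN); have [ri vi] := hM i iM.
have := hP i iP; rewrite subr0 -vgeN => h.
have vip : v (cval (repr (cls u)) i) < p + 1 by rewrite vi; lia.
have [_ e] := place_eq ri vip h.
by rewrite -vi -e; congr (v _); rewrite opprB addrC subrK.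
Qed.

Lemma cls_val u : cls u != 0 ->
  exists N, forall i, (N <= i)%N -> cval u i != 0 /\ v (cval u i) = val (cls u).
Proof.
move=> u0; have [m [N hN]] := cls_neq0 u0; exists N => i Ni.
have [ui vi] := hN i Ni; split=> //; rewrite vi; apply/esym/valE => //.
by exists N => j /hN[].
Qed.

Lemma valM x y : x != 0 -> y != 0 -> val (x * y) = val x + val y.
Proof.
rewrite -(clsK x) -(clsK y) => x0 y0.
have [N hN] := cls_val x0; have [M hM] := cls_val y0.
rewrite -clsM; apply: valE; first by rewrite clsM mulf_neq0.
exists (maxn N M) => i; rewrite geq_max => /andP[/hN[xi vx] /hM[yi vy]].
by rewrite -vx -vy; apply: placeM.
Qed.

Lemma valD x y : x != 0 -> y != 0 -> x + y != 0 ->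
  Num.min (val x) (val y) <= val (x + y).
Proof.
rewrite -(clsK x) -(clsK y) -clsD => x0 y0 xy0.
have [N hN] := cls_val x0; have [M hM] := cls_val y0; have [P hP] := cls_val xy0.
pose i := maxn N (maxn M P).
have [iN iM iP] : [/\ (N <= i)%N, (M <= i)%N & (P <= i)%N].
  by rewrite /i !leq_max !leqnn ?orbT.
have [xi <-] := hN i iN; have [yi <-] := hM i iM; have [xyi <-] := hP i iP.
exact: placeD.
Qed.

Lemma cst_cauchyp c : (fun=> c) \in cauchyp.
Proof. by apply/asboolP; exact: cauchy_cst. Qed.

Definition embed (c : K) : quot := cls (CSeq (cst_cauchyp c)).

Lemma embed_zmod : zmod_morphism embed.
Proof. by move=> x y; rewrite /embed -clsB; congr cls; apply: val_inj. Qed.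
Lemma embed_monoid : monoid_morphism embed.
Proof.
split=> [|x y]; first by rewrite -cls1; congr cls; apply: val_inj.
by rewrite /embed -clsM; congr cls; apply: val_inj.
Qed.
HB.instance Definition _ := GRing.isZmodMorphism.Build K quot embed embed_zmod.
HB.instance Definition _ := GRing.isMonoidMorphism.Build K quot embed embed_monoid.

Lemma val_embed c : val (embed c) = v c.
Proof.
have [->|c0] := eqVneq c 0; first by rewrite rmorph0 val0 place0.
have e0 : embed c != 0 by rewrite fmorph_eq0.
by apply: (valE e0); exists 0%N.
Qed.

Lemma val_uniformizer : exists2 x, x != 0 & val x = 1.
Proof.
have [x x0 vx] := place_uniformizer v.
by exists (embed x); rewrite ?fmorph_eq0 ?val_embed.
Qed.

Definition cplace : place quot := Place val0 valM valD val_uniformizer.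

Lemma dense (a : quot) (n : int) : exists x, vge cplace n (a - embed x).
Proof.
have [N hN] := asboolW (cvalP (repr a)) n.
exists (cval (repr a) N); rewrite -{1}(clsK a) -clsB /vge.
have [//|h] := eqVneq (cls _) 0; have [M hM] := cls_val h.
have [] := hM (maxn N M) (leq_maxr _ _); rewrite /= => h0 <-.
have := hN (maxn N M) N (leq_maxl _ _) (leqnn _).
by rewrite /vge (negPf h0).
Qed.

Lemma complete (u : nat -> quot) :
  cauchy cplace u -> exists l, converges cplace u l.
Proof.
move=> cu; have /choice[x hx] k := dense (u k) (Posz k).
have ccx : cauchy cplace (fun k => embed (x k)).
  move=> n; have [N hN] := cu n; exists (maxn N `|n|%N) => i j.
  rewrite !geq_max => /andP[iN ni] /andP[jN nj].
  have -> : embed (x i) - embed (x j) =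
      (u i - u j) - (u i - embed (x i)) + (u j - embed (x j)) by ring.
  apply: vgeD; first apply: vgeB; first exact: hN.
    by apply: vgeW (hx i); lia.
  by apply: vgeW (hx j); lia.
have cx : x \in cauchyp.
  apply/asboolP => n; have [N hN] := ccx n; exists N => i j iN jN.
  have := hN i j iN jN.
  by rewrite /vge -rmorphB fmorph_eq0 /= val_embed.
exists (cls (CSeq cx)) => n; have [N hN] := asboolW cx n.
exists (maxn N `|n|%N) => i; rewrite geq_max => /andP[iN ni].
have -> : u i - cls (CSeq cx) = (u i - embed (x i)) + (embed (x i) - cls (CSeq cx)).
  by ring.
apply: vgeD; first by apply: vgeW (hx i); lia.
rewrite /embed -clsB /vge; have [//|h] := eqVneq (cls _) 0; have [M hM] := cls_val h.
have [] := hM (maxn N M) (leq_maxr _ _); rewrite /= => h0 <-.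
by have := hN i (maxn N M) iN (leq_maxl _ _); rewrite /vge (negPf h0).
Qed.

Definition completed : completion v :=
  @Completion K v (quot : fieldType) (embed : {rmorphism K -> quot})
    cplace val_embed dense complete.

End Construction.
End CauchyCompletion.

(* Sealed: a completion is unique up to a unique isomorphism, so only its
   defining properties are meant to be used. *)
Lemma completion_of (K : fieldType) (v : place K) : completion v.
Proof. exact: CauchyCompletion.completed. Qed.

(* A \otimes_K L along iota : K -> L, in the coordinates given by a basis of A:
   the multiplication is the L-bilinear extension of that of A. *)
Definition scalar_ext (K L : fieldType) (iota : {rmorphism K -> L})
  (A : falgType K) : Type := 'rV[L]_(\dim {:A}).

Section ScalarExtension.
Variables (K L : fieldType) (iota : {rmorphism K -> L}) (A : falgType K).
Local Notation AL := (scalar_ext iota A).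
Local Notation basisA := (vbasis {:A}).

HB.instance Definition _ := Vector.copy AL 'rV[L]_(\dim {:A}).

Definition base_change (a : A) : AL := \row_i iota (coord basisA i a).

Definition scalar_ext_mul (x y : AL) : AL :=
  \sum_i \sum_j (x 0 i * y 0 j) *: base_change (basisA`_i * basisA`_j).

Local Notation mul := scalar_ext_mul.

Local Notation e i := (basisA`_i).

Lemma base_changeD a b : base_change (a + b) = base_change a + base_change b.
Proof. by apply/rowP => i; rewrite !mxE linearD rmorphD. Qed.

Lemma base_changeZ k a : base_change (k *: a) = iota k *: base_change a.
Proof. by apply/rowP => i; rewrite !mxE linearZ rmorphM. Qed.

Lemma base_change0 : base_change 0 = 0.
Proof. by apply/rowP => i; rewrite !mxE linear0 rmorph0. Qed.

Lemma base_change_sum n (f : 'I_n -> A) :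
  base_change (\sum_i f i) = \sum_i base_change (f i).
Proof. exact: (big_morph _ base_changeD base_change0). Qed.

Let eE a : a = \sum_i coord basisA i a *: e i.
Proof. exact: coord_vbasis (memvf a). Qed.

Lemma base_change_inj : injective base_change.
Proof.
move=> a b /rowP h; rewrite (eE a) (eE b); apply: eq_bigr => i _.
by have := h i; rewrite !mxE => /fmorph_inj ->.
Qed.

Lemma scalar_extE (x : AL) : x = \sum_i x 0 i *: base_change (e i).
Proof.
rewrite {1}(row_sum_delta x); apply: eq_bigr => i _; congr (_ *: _).
apply/rowP => j; rewrite !mxE coord_free ?(basis_free (vbasisP _))//.
by rewrite rmorph_nat eq_sym.
Qed.

Let mulDl : left_distributive mul +%R.
Proof.
move=> x y z; rewrite /mul -big_split; apply: eq_bigr => i _.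
rewrite -big_split; apply: eq_bigr => j _.
by rewrite !mxE mulrDl scalerDl.
Qed.

Let mulDr : right_distributive mul +%R.
Proof.
move=> x y z; rewrite /mul -big_split; apply: eq_bigr => i _.
rewrite -big_split; apply: eq_bigr => j _.
by rewrite !mxE mulrDr scalerDl.
Qed.

Let mulZl k x y : k *: mul x y = mul (k *: x) y.
Proof.
rewrite /mul scaler_sumr; apply: eq_bigr => i _.
rewrite scaler_sumr; apply: eq_bigr => j _.
by rewrite scalerA !mxE mulrA.
Qed.

Let mulZr k x y : k *: mul x y = mul x (k *: y).
Proof.
rewrite /mul scaler_sumr; apply: eq_bigr => i _.
rewrite scaler_sumr; apply: eq_bigr => j _.
by rewrite scalerA !mxE mulrCA.
Qed.

Let mul_suml n (f : 'I_n -> AL) y :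
  mul (\sum_i f i) y = \sum_i mul (f i) y.
Proof.
apply: (big_morph (mul^~ y)) => [a b|]; first exact: mulDl.
by have := mulZl 0 0 y; rewrite !scale0r => <-.
Qed.

Let mul_sumr n (f : 'I_n -> AL) x :
  mul x (\sum_i f i) = \sum_i mul x (f i).
Proof.
apply: (big_morph (mul x)) => [a b|]; first exact: mulDr.
by have := mulZr 0 x 0; rewrite !scale0r => <-.
Qed.

Let base_changeM' a b : base_change (a * b) = mul (base_change a) (base_change b).
Proof.
rewrite {1}(eE a) {1}(eE b) mulr_suml base_change_sum; apply: eq_bigr => i _.
rewrite mulr_sumr base_change_sum; apply: eq_bigr => j _.
by rewrite -scalerAl -scalerAr !base_changeZ scalerA !mxE.
Qed.

Let mulA : associative mul.
Proof.
move: mul_suml mul_sumr mulZl mulZr base_changeM'.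
generalize mul => m suml sumr Zl Zr cM x y z.
rewrite (scalar_extE x) !suml; apply: eq_bigr => i _.
rewrite (scalar_extE y) sumr !suml sumr; apply: eq_bigr => j _.
rewrite (scalar_extE z) !sumr; apply: eq_bigr => k _.
by rewrite -!(Zl, Zr) -!cM !scalerA mulrA; congr (_ *: _); ring.
Qed.

Let mul1x : left_id (base_change 1) mul.
Proof.
move=> x; rewrite {1}(scalar_extE x) mul_sumr [RHS]scalar_extE; apply: eq_bigr => i _.
by rewrite -mulZr -base_changeM' mul1r.
Qed.

Let mulx1 : right_id (base_change 1) mul.
Proof.
move=> x; rewrite {1}(scalar_extE x) mul_suml [RHS]scalar_extE; apply: eq_bigr => i _.
by rewrite -mulZl -base_changeM' mulr1.
Qed.

Let one_neq0 : base_change 1 != 0.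
Proof.
by rewrite -base_change0; apply/eqP => /base_change_inj/eqP; rewrite oner_eq0.
Qed.

HB.instance Definition _ := GRing.Zmodule_isNzRing.Build AL
  mulA mul1x mulx1 mulDl mulDr one_neq0.
HB.instance Definition _ := GRing.Lmodule_isLalgebra.Build L AL mulZl.
HB.instance Definition _ := GRing.Lalgebra_isAlgebra.Build L AL mulZr.
HB.instance Definition _ := Algebra_isFalgebra.Build L AL.

Lemma base_changeM a b : base_change (a * b) = base_change a * base_change b.
Proof. exact: base_changeM'. Qed.

Lemma base_change1 : base_change 1 = 1. Proof. by []. Qed.

End ScalarExtension.

Definition quaternion_algebra (K : fieldType) (A : falgType K) : Prop :=
  [/\ \dim (fullv : {vspace A}) = 4%N,
      'Z(fullv : {vspace A})%VS = 1%VS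
    & forall U : {vspace A}, (fullv * U <= U)%VS -> (U * fullv <= U)%VS ->
        U = 0%VS \/ U = fullv].

Definition division_algebra (K : fieldType) (A : falgType K) : Prop :=
  forall x : A, x != 0 -> x \is a GRing.unit.

(* The A-curve with function field K attached to a finite set S of
   non-archimedean places of K, as a set of places; the archimedean places play
   no role.  Over a function field, S = set0 gives the projective curve. *)
Definition Acurve (K : fieldType) (S : set (place K)) : Type := set_type (~` S).

Section Lattices.
Variables (K : fieldType) (S : set (place K)).
Local Notation X := (Acurve S).

Definition Kp (p : X) : completion (val p) := completion_of (val p).
Definition Op (p : X) : set (Kp p) := valuation_ring (cplace (Kp p)).
Arguments Op : clear implicits.

Definition Ospan (p : X) (W : lmodType (Kp p)) (s : seq W) : set W :=
  [set w | exists2 c : 'I_(size s) -> Kp p,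
     forall i, Op p (c i) & w = \sum_i c i *: s`_i].

Definition full_lattice (p : X) (W : vectType (Kp p)) (M : set W) : Prop :=
  exists2 s : seq W, <<s>>%VS = fullv & M = Ospan s.

(* X-lattices in a K-space V; W p plays the role of the localization of V at p,
   and loc p that of the canonical map V -> V_p. *)
Definition X_lattice (V : vectType K) (W : forall p : X, vectType (Kp p))
    (loc : forall p, V -> W p) (M : forall p, set (W p)) : Prop :=
  (forall p, full_lattice (M p)) /\
  exists2 b : seq V, basis_of fullv b &
    finite_set [set p | M p <> Ospan (map (loc p) b)].

Definition K_family := forall p : X, set (Kp p).

Definition integral_ideal (I : K_family) : Prop :=
  @X_lattice K^o (fun p => (Kp p)^o) (fun p => cembed (Kp p)) I /\
  forall p, I p `<=` Op p.

Variable A : falgType K.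

Definition Ap (p : X) : falgType (Kp p) := scalar_ext (cembed (Kp p)) A.

Definition A_family := forall p : X, set (Ap p).

Definition X_order (D : A_family) : Prop :=
  X_lattice (fun p => base_change (cembed (Kp p)) (A := A)) D /\
  forall p, D p 1 /\ forall x y, D p x -> D p y -> D p (x * y).

Definition maximal_order (D : A_family) : Prop :=
  X_order D /\
  forall D', X_order D' -> (forall p, D p `<=` D' p) -> forall p, D p = D' p.

Definition Eichler_order (D : A_family) : Prop :=
  exists M1 M2, [/\ maximal_order M1, maximal_order M2 &
    forall p, D p = M1 p `&` M2 p].

Definition ideal_mul (I : K_family) (D : A_family) : A_family :=
  fun p => [set z | exists n (a : 'I_n -> Kp p) (d : 'I_n -> Ap p),
    [/\ forall i, I p (a i), forall i, D p (d i) & z = \sum_i a i *: d i]].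
Arguments ideal_mul : clear implicits.

Definition OX_plus (I : K_family) (D : A_family) : A_family :=
  fun p => [set z | exists a y,
    [/\ Op p a, ideal_mul I D p y & z = a%:A + y]].
Arguments OX_plus : clear implicits.

End Lattices.

Arguments Op {K S} p _.
Arguments ideal_mul {K S A} I D p _.
Arguments OX_plus {K S A} I D p _.

(* Main.v *)
Require Import Defs.
From HB Require Import structures.
From mathcomp Require Import all_boot all_order all_algebra all_field.
From mathcomp Require Import generic_quotient ring_quotient fraction.
From mathcomp Require Import boolp classical_sets functions cardinality.
From mathcomp Require Import zify ring.

Set Implicit Arguments.
Unset Strict Implicit.
Unset Printing Implicit Defensive.

Import Order.TTheory GRing.Theory Num.Theory.
Local Open Scope ring_scope.
Local Open Scope classical_set_scope.

(* An order family is maximal iff it is maximal at every place, so everything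
   but a finiteness statement is local.

   If A_p is a division algebra, the elements of integral reduced norm form
   its unique maximal order.  Otherwise A_p = M_2(K_p), the maximal orders are
   the vertices of the Bruhat-Tits tree, and among finitely many of them one
   takes two, M_1 and M_2, at the maximal distance l.  In coordinates with
   M_1 = End(O + O) and M_2 = End(O + pi^l O), every other vertex of the family
   branches off the path from M_1 to M_2 at a distance k with 2k <= l and cuts
   out of M_1 `&` M_2 the matrices whose diagonal entries agree mod pi^k.  The
   intersection is therefore O + pi^k E, for the largest k, with E the Eichler
   order of the path shortened by k at both ends.  Conversely O + pi^k E is the
   intersection of the two ends of the path of E prolonged by k at both ends
   with a third vertex at distance k from the path.

   Globally one needs that two lattices agree at almost all places, that is,
   that a nonzero x of K is a unit at almost all places: a place where x is not
   a unit lies over one of finitely many places of Q or F_q(t), and at most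
   [K : k] places lie over a place of the base field k, because elements that
   isolate each of them are linearly independent over k. *)

(** * Lattices over a discrete valuation ring *)

(** The definition of a quaternion algebra (dimension four, center K, no proper two-sided ideal)
    offers no generators and does not visibly pass to completions. Everything is therefore carried
    by one linear form, the reduced trace: each element of A is quadratic over K, its linear
    coefficient turns out to be additive, and the resulting [trace_form] extends to A_p by
    linearity. Over K_p only this form and the dimension matter: a nonzero nonunit yields matrix
    units, and in the absence of one the form gives the reduced norm and its integrality. Nothing
    divides by 2, so characteristic 2 is not a separate case; additivity does need an element of K
    other than 0 and 1, which a uniformizer provides. The tree is not built as a graph. A vertex is
    a set of 2x2 matrices cut out by valuations, and being at distance at most m enters as the
    inclusion of pi^m M_j in M_i, so statements about paths become comparisons of matrix entries. *)

Section Valuations.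
Variables (L : fieldType) (v : place L).

Lemma vge_val n x : v x = n -> vge v n x.
Proof. by move=> <-; rewrite /vge lexx orbT. Qed.

Lemma vgeE n x : x != 0 -> vge v n x = (n <= v x).
Proof. by rewrite /vge => /negPf->. Qed.

Lemma vgePn n x : ~~ vge v n x -> x != 0 /\ v x < n.
Proof. by rewrite /vge negb_or -ltNge => /andP. Qed.

Lemma vge1 : vge v 0 1. Proof. by apply: vge_val; rewrite place1. Qed.

Lemma vgeMl n x y : x != 0 -> vge v n (x * y) = vge v (n - v x) y.
Proof.
move=> x0; have [->|y0] := eqVneq y 0; first by rewrite mulr0 !vge0.
by rewrite !vgeE ?mulf_neq0// placeM//; lia.
Qed.

Lemma vgeM0 n x y : vge v 0 x -> vge v n y -> vge v n (x * y).
Proof. by move=> hx hy; have := vgeM hx hy; rewrite add0r. Qed.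

Lemma vge_eq0 x : (forall n, vge v n x) -> x = 0.
Proof.
move=> h; apply/eqP; apply: contraT => x0; have := h (v x + 1).
by rewrite vgeE//; lia.
Qed.

Lemma vge_sum (I : Type) (r : seq I) (P : pred I) (F : I -> L) n :
  (forall i, P i -> vge v n (F i)) -> vge v n (\sum_(i <- r | P i) F i).
Proof. by move=> h; elim/big_ind: _ => //; [exact: vge0|exact: vgeD]. Qed.

Lemma placeX x m : x != 0 -> v (x ^+ m) = m%:Z * v x.
Proof.
move=> x0; elim: m => [|m IH]; first by rewrite expr0 place1 mul0r.
by rewrite exprS placeM// ?expf_neq0// IH; lia.
Qed.

Lemma exists_placeval r : exists2 x, x != 0 & v x = r.
Proof.
have [x x0 vx] := place_uniformizer v; case: r => m.
  by exists (x ^+ m); rewrite ?expf_neq0// placeX// vx mulr1.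
by exists ((x ^+ m.+1)^-1); rewrite ?invr_neq0 ?expf_neq0// placeV placeX// vx mulr1 NegzE.
Qed.

(* An arbitrary element of valuation r; in particular ppow 0 need not be 1. *)
Definition ppow r : L := projT1 (cid2 (exists_placeval r)).

Lemma ppow_neq0 r : ppow r != 0.
Proof. by rewrite /ppow; case: cid2. Qed.

Lemma place_ppow r : v (ppow r) = r.
Proof. by rewrite /ppow; case: cid2. Qed.

Lemma vge_ppow r : vge v r (ppow r).
Proof. by apply: vge_val; rewrite place_ppow. Qed.

Lemma vge_ppowM n r x : vge v n (ppow r * x) = vge v (n - r) x.
Proof. by rewrite vgeMl ?ppow_neq0// place_ppow. Qed.

Lemma ppow_dvd n x : vge v n x -> exists2 y, vge v 0 y & x = ppow n * y.
Proof.
move=> h; exists ((ppow n)^-1 * x); last by rewrite mulVKf ?ppow_neq0.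
by rewrite vgeMl ?invr_neq0 ?ppow_neq0// placeV place_ppow opprK add0r.
Qed.

Lemma vge_fin (T : finType) (c : T -> L) : exists n, forall i, vge v n (c i).
Proof.
exists (- \sum_i `|v (c i)|) => i; rewrite /vge; apply/orP; right.
rewrite (bigD1 i)//=; set s := (X in _ + X).
have : 0 <= s :> int by apply: sumr_ge0.
by lia.
Qed.

Lemma int_min (P : int -> Prop) (m : int) : (exists n, P n) -> (forall n, P n -> m <= n) ->
  exists n, P n /\ forall k, P k -> n <= k.
Proof.
move=> [n0 Pn0] hm.
have ex : exists i : nat, `[< P (m + i%:Z) >].
  exists `|n0 - m|%N; apply/asboolP.
  by have := hm _ Pn0 => h0; have -> : m + Posz `|n0 - m| = n0 by lia.
case: (ex_minnP ex) => i /asboolP Pi hi; exists (m + i%:Z); split=> // k Pk.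
have := hm _ Pk => mk; have := hi `|k - m|%N.
have -> : m + Posz `|k - m| = k by lia.
by move=> /(_ (asboolT Pk)); lia.
Qed.

End Valuations.

Section Lattice.
Variables (L : fieldType) (v : place L).

Definition vspan (W : lmodType L) (s : seq W) : set W :=
  [set w | exists2 c : 'I_(size s) -> L,
     forall i, vge v 0 (c i) & w = \sum_i c i *: s`_i].

Definition lattice (W : vectType L) (M : set W) : Prop :=
  exists2 s : seq W, <<s>>%VS = fullv & M = vspan s.

Definition vsubmod (W : lmodType L) (M : set W) : Prop :=
  M 0 /\ forall c x y, vge v 0 c -> M x -> M y -> M (c *: x + y).

Definition vabsorb (W : lmodType L) (M : set W) : Prop :=
  forall w, exists2 c, c != 0 & M (c *: w).

(** Together with [vabsorb], a test for being a lattice that names no generators. Bounding one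
    functional at a time suits algebras with a trace form, where every functional is a trace against
    a fixed element. *)
Definition vbounded (W : lmodType L) (M : set W) : Prop :=
  forall l : {scalar W}, exists n, forall w, M w -> vge v n (l w).

Section Submod.
Variables (W : lmodType L) (M : set W).
Hypothesis sM : vsubmod M.

Lemma vsubmod0 : M 0. Proof. by case: sM. Qed.

Lemma vsubmodZ c x : vge v 0 c -> M x -> M (c *: x).
Proof. by case: sM => M0 h hc Mx; have := h c x 0 hc Mx M0; rewrite addr0. Qed.

Lemma vsubmodD x y : M x -> M y -> M (x + y).
Proof. by case: sM => M0 h Mx; have := h 1 x y (vge1 v) Mx; rewrite scale1r. Qed.

Lemma vsubmodB x y : M x -> M y -> M (x - y).
Proof.
move=> Mx My; apply: vsubmodD => //; rewrite -scaleN1r; apply: vsubmodZ => //.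
by rewrite vgeN vge1.
Qed.

Lemma vsubmod_sum (I : Type) (r : seq I) (P : pred I) (F : I -> W) :
  (forall i, P i -> M (F i)) -> M (\sum_(i <- r | P i) F i).
Proof. by move=> h; elim/big_ind: _ => //; [exact: vsubmod0|exact: vsubmodD]. Qed.

Lemma vspan_sub s : (forall x, x \in s -> M x) -> vspan s `<=` M.
Proof.
move=> h w [c hc ->]; apply: vsubmod_sum => i _; apply: vsubmodZ => //.
by apply: h; rewrite mem_nth.
Qed.

End Submod.

Lemma vspan_submod (W : lmodType L) (s : seq W) : vsubmod (vspan s).
Proof.
split; first by exists (fun=> 0) => [i|]; rewrite ?vge0// big1// => i _; rewrite scale0r.
move=> c x y hc [a ha ->] [b hb ->]; exists (fun i => c * a i + b i).
  by move=> i; rewrite vgeD// vgeM0.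
by rewrite scaler_sumr -big_split; apply: eq_bigr => i _; rewrite scalerDl scalerA.
Qed.

Lemma mem_vspan (W : lmodType L) (s : seq W) x : x \in s -> vspan s x.
Proof.
move=> xs; have i : (index x s < size s)%N by rewrite index_mem.
exists (fun j => if j == Ordinal i then 1 else 0).
  by move=> j; case: ifP => _; rewrite ?vge0 ?vge1.
rewrite (bigD1 (Ordinal i))//= eqxx scale1r nth_index// big1 ?addr0// => j /negPf->.
by rewrite scale0r.
Qed.

Lemma lattice_submod (W : vectType L) (M : set W) : lattice M -> vsubmod M.
Proof. by case=> s _ ->; exact: vspan_submod. Qed.

Lemma lattice_absorb (W : vectType L) (M : set W) : lattice M -> vabsorb M.
Proof.
case=> s fs -> w; have : w \in <<in_tuple s>>%VS by rewrite fs memvf.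
move=> /coord_span ->.
have [n hn] := vge_fin v (fun i => coord (in_tuple s) i w).
exists (ppow v (- n)); first exact: ppow_neq0.
exists (fun i => ppow v (- n) * coord (in_tuple s) i w).
  by move=> i; rewrite vge_ppowM opprK add0r.
by rewrite scaler_sumr; apply: eq_bigr => i _; rewrite scalerA.
Qed.

Lemma lattice_bounded (W : vectType L) (M : set W) : lattice M -> vbounded M.
Proof.
case=> s fs -> l; have [n hn] := vge_fin v (fun i : 'I_(size s) => l s`_i).
exists n => w [c hc ->]; rewrite linear_sum; apply: vge_sum => i _.
by rewrite linearZ; apply: vgeM0.
Qed.

(** Induction on the number of coordinates that may be nonzero. Boundedness gives an element whose
    last such coordinate has least valuation; its multiples clear that coordinate, and what remains
    lies in the kernel. The bound on the number of generators later turns a lattice in the plane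
    into a square matrix. *)
Lemma bounded_submod_vspan (W : vectType L) n (e : 'I_n -> {scalar W}) k (M : set W) :
  vsubmod M -> (forall w, (forall i, e i w = 0) -> w = 0) -> vbounded M ->
  (forall w, M w -> forall i : 'I_n, (k <= i)%N -> e i w = 0) -> (k <= n)%N ->
  exists2 s : seq W, (size s <= k)%N & M = vspan s.
Proof.
move=> + e0; elim: k M => [|k IH] M sM bM zM kn.
  exists [::] => //; apply/seteqP; split=> w.
    by move=> Mw; rewrite (e0 w (fun i => zM w Mw i isT)); exact: (vspan_submod _).1.
  by move=> [c _ ->]; rewrite big_ord0; exact: sM.1.
pose ek := e (Ordinal kn).
have [z|/existsNP[w0 /not_implyP[Mw0 /eqP w00]]] := pselect (forall w, M w -> ek w = 0).
  have [|s sk ->] := IH M sM bM _ (ltnW kn); last by exists s => //; exact: leqW.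
  move=> w Mw i; rewrite leq_eqVlt => /predU1P[ki|]; last exact: zM.
  by have := z w Mw; rewrite /ek (_ : Ordinal kn = i)//; apply: val_inj.
have [m hm] := bM ek.
have [||r [[w1 [Mw1 w10 vw1]] hr]] :=
    @int_min (fun r => exists w, [/\ M w, ek w != 0 & v (ek w) = r]) m.
- by exists (v (ek w0)), w0.
- by move=> r [w [Mw w_0 <-]]; rewrite -vgeE// hm.
pose M' := [set w | M w /\ ek w = 0].
have sM' : vsubmod M'.
  split=> [|c x y hc [Mx ex] [My ey]]; first by split; [exact: sM.1|rewrite linear0].
  by split; [exact: sM.2|rewrite linearP /= ex ey mulr0 addr0].
have [||s sk M's] := IH M' sM' _ _ (ltnW kn).
- by move=> l; have [b hb] := bM l; exists b => w [/hb].
- move=> w [Mw ew] i; rewrite leq_eqVlt => /predU1P[ki|]; last exact: zM.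
  by rewrite (_ : i = Ordinal kn)//; apply: val_inj.
exists (w1 :: s); first by rewrite /= ltnS.
apply/seteqP; split=> [w Mw|]; last first.
  apply: vspan_sub => // x; rewrite inE => /predU1P[->//|xs].
  by have [] : M' x by rewrite M's; exact: mem_vspan.
have hc : vge v 0 (ek w / ek w1).
  have [->|w_0] := eqVneq (ek w) 0; first by rewrite mul0r vge0.
  rewrite mulrC vgeMl ?invr_neq0// placeV sub0r opprK vgeE// vw1.
  by apply: hr; exists w.
have : M' (w - (ek w / ek w1) *: w1).
  split; first by apply: vsubmodB => //; exact: vsubmodZ.
  by rewrite linearB linearZ /= divfK ?subrr.
rewrite M's => -[d hd /eqP]; rewrite subr_eq => /eqP ->.
apply: vsubmodD; first exact: vspan_submod.
  apply: vsubmod_sum => [|i _]; first exact: vspan_submod.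
  apply: vsubmodZ => //; first exact: vspan_submod.
  by apply: mem_vspan; rewrite inE mem_nth ?orbT.
apply: vsubmodZ => //; first exact: vspan_submod.
by apply: mem_vspan; rewrite mem_head.
Qed.

Lemma bounded_submod_lattice (W : vectType L) (M : set W) :
  vsubmod M -> vabsorb M -> vbounded M ->
  exists s : seq W, [/\ (size s <= \dim {:W})%N, <<s>>%VS = fullv & M = vspan s].
Proof.
move=> sM aM bM.
have [||s ss Ms] := @bounded_submod_vspan W _ (coord (vbasis {:W})) _ M sM _ bM _ (leqnn _).
- by move=> w h; rewrite (coord_vbasis (memvf w)) big1// => i _; rewrite h scale0r.
- by move=> w Mw i; rewrite leqNgt ltn_ord.
exists s; split=> //; apply/vspaceP => w; rewrite memvf.
have [c c0] := aM w; rewrite Ms => -[d _ /(congr1 (fun x => c^-1 *: x))].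
rewrite scalerA mulVf// scale1r => ->; apply/rpredZ/rpred_sum => i _.
by apply/rpredZ/memv_span; rewrite mem_nth.
Qed.

Lemma latticeP (W : vectType L) (M : set W) :
  vsubmod M -> vabsorb M -> vbounded M -> lattice M.
Proof. by move=> sM aM bM; have [s [_ fs ->]] := bounded_submod_lattice sM aM bM; exists s. Qed.

Definition lorder (B : falgType L) (M : set B) : Prop :=
  lattice M /\ (M 1 /\ forall x y, M x -> M y -> M (x * y)).

Definition lmaximal (B : falgType L) (M : set B) : Prop :=
  lorder M /\ forall N, lorder N -> M `<=` N -> M = N.

End Lattice.

(** * The reduced trace of a quaternion algebra *)

Lemma scalar_exists (L : fieldType) (W : lmodType L) (f : W -> L) :
  (forall c x y, f (c *: x + y) = c * f x + f y) ->
  exists l : {scalar W}, forall x, l x = f x.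
Proof.
move=> h.
pose l : {scalar W} := HB.pack f (GRing.isLinear.Build L W L *%R f h).
by exists l.
Qed.

Lemma eq_scalar (L : fieldType) (W : vectType L) (x y : W) :
  (forall l : {scalar W}, l x = l y) -> x = y.
Proof.
move=> h; rewrite (coord_vbasis (memvf x)) (coord_vbasis (memvf y)).
by apply: eq_bigr => i _; rewrite h.
Qed.

(* Coordinate functionals turn linear identities into identities of scalars. *)
Ltac vring := apply: eq_scalar => ?;
  rewrite ?(linearD, linearB, linearN, linearZ, linear0) /=; ring.

Lemma mem1vP (L : fieldType) (B : falgType L) (x : B) :
  reflect (exists c, x = c%:A) (x \in 1%VS).
Proof. by apply: (iffP (vlineP _ _)) => -[c ->]; exists c. Qed.

Lemma scalarA_inj (L : fieldType) (B : falgType L) (a b : L) :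
  a%:A = b%:A :> B -> a = b.
Proof.
by move=> /eqP; rewrite -subr_eq0 -scalerBl scaler_eq0 oner_eq0 orbF subr_eq0 => /eqP.
Qed.

(** The third identity polarizes the second and also identifies the constant: t x * t y - t (x * y)
    is the polar form of the norm. Being bilinear, it survives extension of scalars. *)
Definition trace_form (L : fieldType) (B : falgType L) (t : {scalar B}) : Prop :=
  [/\ t 1 = 2%:R, (forall x, exists n, x * x = t x *: x - n%:A),
      (forall x y, x * y + y * x = t x *: y + t y *: x + (t (x * y) - t x * t y)%:A)
    & forall x, (forall y, t (x * y) = 0) -> x = 0].

(** * Every element of a quaternion algebra is quadratic over the center *)

Section Quaternion.
Variables (K : fieldType) (A : falgType K).
Hypothesis qA : quaternion_algebra A.

Let dimA : \dim {:A} = 4%N. Proof. by case: qA. Qed.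
Let cenA : 'Z({:A})%VS = 1%VS. Proof. by case: qA. Qed.

Lemma noncommutative : exists x y : A, x * y <> y * x.
Proof.
apply: contrapT => h; have : (fullv <= 'Z({:A}))%VS.
  apply/subvP => x _; rewrite memv_cap memvf /=; apply/centvP.
  by move=> y _; apply: contrapT => e; apply: h; exists x, y.
by rewrite cenA => /dimvS; rewrite dimA dimv1.
Qed.

Lemma ideal_generated (x : A) : x != 0 -> (fullv * <[x]> * fullv)%VS = fullv.
Proof.
move=> x0; have [_ _ h] := qA.
have [||z|//] := h (fullv * <[x]> * fullv)%VS.
- by rewrite !prodvA; do 2!apply: prodvSl; apply: subvf.
- by rewrite -!prodvA; do 2!apply: prodvSr; apply: subvf.
have : 1 * x * 1 \in (fullv * <[x]> * fullv)%VS by rewrite !memv_mul ?memvf ?memv_line.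
by rewrite z memv0 mul1r mulr1 (negPf x0).
Qed.

(** If a kills I, so does A a A, because A a A I lies in A a I; but A a A contains 1 by
    [ideal_generated] when a is nonzero. *)
Lemma left_ideal_faithful (I : {vspace A}) (a : A) :
  (fullv * I <= I)%VS -> (forall u, u \in I -> a * u = 0) -> a = 0 \/ I = 0%VS.
Proof.
move=> sI aI; have [->|a0] := eqVneq a 0; first by left.
right; apply/eqP; rewrite -subv0 -[X in (X <= _)%VS]prod1v.
apply: (@subv_trans _ _ ((fullv * <[a]> * fullv) * I)%VS).
  by rewrite ideal_generated// prodvSl// subvf.
rewrite -prodvA; apply: (@subv_trans _ _ ((fullv * <[a]>) * I)%VS); first exact: prodvSr.
rewrite -prodvA (_ : (<[a]> * I)%VS = 0%VS) ?prodv0//.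
apply/eqP; rewrite -subv0; apply/prodvP => u w /vlineP[c ->] wI.
by rewrite -scalerAl aI// scaler0 mem0v.
Qed.

(** Were I a line through u, right multiplication by u would send A into a line and have a nonzero
    kernel; an a with a u = 0 kills I, against faithfulness. *)
Lemma left_ideal_dim (I : {vspace A}) :
  (fullv * I <= I)%VS -> I != 0%VS -> (1 < \dim I)%N.
Proof.
move=> sI I0; rewrite ltnNge; apply/negP => d1.
pose u := vpick I; have uI : u \in I := memv_pick I.
have u0 : u != 0 by rewrite vpick0.
have Iu : I = <[u]>%VS.
  by apply/esym/eqP; rewrite eqEdim -memvE uI /= dim_vline u0.
have := limg_ker_dim (amulr u) fullv; rewrite capfv dimA.
have : (limg (amulr u) <= I)%VS.
  apply/subvP => _ /memv_imgP[y _ ->]; rewrite lfunE /=.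
  by apply: (subvP sI); rewrite memv_mul ?memvf.
move=> /dimvS/leq_trans/(_ d1) d2 d3.
have k0 : lker (amulr u) != 0%VS by apply/negP => /eqP k; rewrite k dimv0 in d3; lia.
have := memv_pick (lker (amulr u)); rewrite memv_ker lfunE /= => /eqP au.
have [|z|/eqP] := left_ideal_faithful sI (a := vpick (lker (amulr u))).
- by rewrite Iu => w /vlineP[c ->]; rewrite -scalerAr au scaler0.
- by move: k0; rewrite -vpick0 z eqxx.
- by rewrite (negPf I0).
Qed.

(** A z and the left annihilator of z are nonzero left ideals whose dimensions add up to 4, hence
    both are planes. A acts faithfully on the plane A z, and Cayley-Hamilton for the action of x is
    the required equation. *)
Lemma quadratic_nondivision (z : A) : z != 0 -> z \isn't a GRing.unit ->
  forall x : A, exists a b, x * x = a *: x + b%:A.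
Proof.
move=> z0 zu x; pose I := limg (amulr z); pose J := lker (amulr z).
have sI : (fullv * I <= I)%VS.
  apply/prodvP => u _ _ /memv_imgP[y _ ->]; rewrite lfunE /= mulrA.
  by apply/memv_imgP; exists (u * y); rewrite ?memvf// lfunE.
have sJ : (fullv * J <= J)%VS.
  apply/prodvP => u w _; rewrite !memv_ker !lfunE /= => /eqP h.
  by rewrite -mulrA h mulr0.
have I0 : I != 0%VS.
  apply: contraNneq z0 => h; rewrite -memv0 -h; apply/memv_imgP.
  by exists 1; rewrite ?memvf// lfunE /= mul1r.
have dIJ : (\dim J + \dim I = 4)%N by have := limg_ker_dim (amulr z) fullv; rewrite capfv dimA.
have J0 : J != 0%VS.
  apply: contraNneq zu => j0.
  have /memv_imgP[y _ /esym] : 1 \in I.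
    have : I == fullv by rewrite eqEdim subvf /= dimA -dIJ j0 dimv0.
    by move=> /eqP->; rewrite memvf.
  rewrite lfunE /= => yz; apply/unitrP; exists y; split=> //.
  apply/eqP; rewrite -subr_eq0 -memv0 -j0 memv_ker lfunE /=.
  by rewrite mulrBl mul1r -mulrA yz mulr1 subrr.
have dI2 : \dim I = 2%N by have := left_ideal_dim sI I0; have := left_ideal_dim sJ J0; lia.
have b2 (w : A) : w \in I -> exists a b, w = a *: (vbasis I)`_0 + b *: (vbasis I)`_1.
  move=> wI; rewrite (coord_vbasis wI).
  have sum2 n (c : 'I_n -> K) (F : nat -> A) : n = 2%N ->
      exists a b, \sum_i c i *: F i = a *: F 0%N + b *: F 1%N.
    move=> n2; move: c; rewrite n2 => c; exists (c ord0), (c (lift ord0 ord0)).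
    by rewrite big_ord_recl big_ord1.
  exact: (sum2 _ _ (fun i => (vbasis I)`_i)).
set u1 := (vbasis I)`_0 in b2; set u2 := (vbasis I)`_1 in b2.
have memI i : (i < 2)%N -> (vbasis I)`_i \in I.
  by move=> i2; apply: vbasis_mem; rewrite mem_nth// size_tuple dI2.
have xI w : w \in I -> x * w \in I.
  by move=> wI; apply: (subvP sI); rewrite memv_mul ?memvf.
have [a1 [c1 e1]] := b2 _ (xI _ (memI 0%N isT)).
have [a2 [c2 e2]] := b2 _ (xI _ (memI 1%N isT)).
rewrite -/u1 in e1; rewrite -/u2 in e2.
(* Trace and opposite of the determinant of left multiplication by x, in the basis [u1], [u2] of
   I. *)
exists (a1 + c2), (- (a1 * c2 - c1 * a2)).
apply/eqP; rewrite -subr_eq0; apply/eqP.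
have [|//|h] := left_ideal_faithful sI (a := x * x - ((a1 + c2) *: x + (- (a1 * c2 - c1 * a2))%:A)).
  have k1 : x * (x * u1) = a1 *: (x * u1) + c1 *: (x * u2).
    by rewrite {1}e1 mulrDr -!scalerAr.
  have k2 : x * (x * u2) = a2 *: (x * u1) + c2 *: (x * u2).
    by rewrite {1}e2 mulrDr -!scalerAr.
  move=> w /b2[a [b ->]]; rewrite mulrBl mulrDl mulr_algl -scalerAl -mulrA.
  rewrite !mulrDr -!scalerAr k1 k2 e1 e2; vring.
by rewrite h dimv0 in dI2.
Qed.

(** If 1, x, x^2 were independent, the centralizer C of x would have dimension 3. For y outside C,
    the spaces C and C y then meet inside dimension 4: w = u y with u, w nonzero in C puts y = u^-1
    w in C after all. *)
Lemma quadratic_division : (forall z : A, z != 0 -> z \is a GRing.unit) ->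
  forall x : A, exists a b, x * x = a *: x + b%:A.
Proof.
move=> div x; pose C := 'C[x]%VS.
have memC y : (y \in C) = (x * y == y * x).
  by apply/cent1vP/eqP.
have [x1|x1] := boolP (x \in 1%VS).
  by have /mem1vP[c ->] := x1; exists c, 0; rewrite scale0r addr0 -scalerAl mul1r.
have [|xx] := boolP (x * x \in <<[:: 1%R; x]>>%VS).
  rewrite span_cons span_seq1 => /memv_addP[_ /vlineP[b ->] [_ /vlineP[a ->] ->]].
  by exists a, b; rewrite addrC.
have C3 : (3 <= \dim C)%N.
  have f3 : free [:: x * x; x; 1].
    have e : <<[:: x; 1%R]>>%VS = <<[:: 1%R; x]>>%VS.
      by rewrite !span_cons !span_nil !addv0 addvC.
    rewrite free_cons e xx free_cons span_seq1 x1 /= free_cons span_nil memv0.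
    by rewrite oner_eq0 nil_free.
  have -> : 3%N = \dim <<[:: (x * x)%R; x; 1%R]>>%VS by have := f3; rewrite /free /= => /eqP.
  apply/dimvS/span_subvP => y; rewrite !inE memC => /or3P[]/eqP->.
  - by rewrite mulrA.
  - by rewrite eqxx.
  - by rewrite mulr1 mul1r.
have Cf : C != fullv.
  apply: contraNneq x1 => h; rewrite -cenA memv_cap memvf; apply/centvP => y _.
  by apply/eqP; rewrite -memC h memvf.
have C4 : (\dim C < 4)%N.
  by rewrite ltnNge -dimA; apply: contraNN Cf => h; rewrite eqEdim subvf h.
have [y yC] : exists y, y \notin C.
  apply: contrapT => h; move/negP: Cf; apply; apply/eqP/vspaceP => y; rewrite memvf.
  by apply: contrapT => /negP yC; apply: h; exists y.
have y0 : y != 0 by apply: contraNneq yC => ->; rewrite mem0v.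
have k0 : lker (amulr y) = 0%VS.
  apply/eqP; rewrite -subv0; apply/subvP => w; rewrite memv_ker lfunE /= memv0 => /eqP h.
  by rewrite -[w](mulrK (div _ y0)) h mul0r.
have dCy : \dim (amulr y @: C)%VS = \dim C by rewrite limg_dim_eq// k0 capv0.
have := dimv_sum_cap C (amulr y @: C)%VS; have := dimvS (subvf (C + amulr y @: C)%VS).
rewrite dCy dimA => d1 d2.
have : (C :&: amulr y @: C)%VS != 0%VS by rewrite -dimv_eq0; lia.
rewrite -vpick0; move: (memv_pick (C :&: amulr y @: C)%VS).
move: (vpick _) => w; rewrite memv_cap => /andP[wC /memv_imgP[u uC]].
rewrite lfunE /= => wuy w0; have u0 : u != 0.
  by apply: contraNneq w0 => u0; rewrite wuy u0 mul0r.
case/negP: yC; rewrite memC; have uu := div _ u0.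
move: wC uC; rewrite !memC wuy => /eqP h1 /eqP h2; apply/eqP/(mulrI uu).
by rewrite mulrA -h2 -mulrA h1 mulrA.
Qed.

Lemma quadratic (x : A) : exists a b, x * x = a *: x + b%:A.
Proof.
have [h|/existsNP[z /not_implyP[z0 /negP zu]]] :=
  pselect (forall z : A, z != 0 -> z \is a GRing.unit); first exact: quadratic_division.
exact: quadratic_nondivision z0 zu x.
Qed.

End Quaternion.

(** * Additivity, product identity and nondegeneracy of the trace *)

Section Trace.
Variables (K : fieldType) (A : falgType K) (r : K).
Hypotheses (qA : quaternion_algebra A) (r0 : r != 0) (r1 : r != 1).

(** A quadratic equation determines the trace of a nonscalar only, so the value on scalars is
    prescribed; additivity will require 2 c there. *)
Lemma trace_exists : exists t : A -> K,
  (forall c, t c%:A = 2%:R * c) /\ forall x, exists n, x * x = t x *: x - n%:A.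
Proof.
have /choice[t ht] : forall x : A, exists tx : K,
    (forall c, x = c%:A -> tx = 2%:R * c) /\ exists n, x * x = tx *: x - n%:A.
  move=> x; have [/mem1vP[c ->]|x1] := boolP (x \in 1%VS).
    exists (2%:R * c); split=> [d /scalarA_inj ->//|]; exists (c * c).
    by rewrite -scalerAl mul1r; vring.
  have [a [b xx]] := quadratic qA x; exists a; split.
    by move=> c xc; case/negP: x1; apply/mem1vP; exists c.
  by exists (- b); rewrite xx scaleNr opprK.
by exists t; split=> [c|x]; [apply: (ht _).1|apply: (ht _).2].
Qed.

Section Properties.
Variables t : A -> K.
Hypothesis tC : forall c, t c%:A = 2%:R * c.
Hypothesis tQ : forall x, exists n, x * x = t x *: x - n%:A.

Lemma trace_unique x a b : x \notin 1%VS -> x * x = a *: x - b%:A -> t x = a.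
Proof.
move=> x1 xx; have [n xx'] := tQ x; apply: (contraNeq _ x1) => ta.
rewrite -subr_eq0 in ta; apply/mem1vP; exists ((n - b) / (t x - a)).
apply: (scalerI ta); rewrite scalerA mulrC divfK//.
by rewrite !scalerBl; move: xx; rewrite xx' => /eqP; rewrite subr_eq => /eqP ->; vring.
Qed.

(** Inside the algebra generated by one element the equation of a x + c comes from that of x by
    substitution, and [trace_unique] reads off its linear coefficient. *)
Lemma trace_affine a c x : t (a *: x + c%:A) = a * t x + 2%:R * c.
Proof.
have [/mem1vP[d ->]|x1] := boolP (x \in 1%VS).
  by rewrite scalerA -scalerDl !tC; ring.
have [->|a0] := eqVneq a 0; first by rewrite scale0r add0r tC; ring.
have [n xx] := tQ x; apply: (@trace_unique _ _ (a * a * n + c * (a * t x + c))).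
  apply: contra x1 => /mem1vP[d e]; apply/mem1vP; exists ((d - c) / a).
  apply: (scalerI a0); rewrite scalerA mulrC divfK// scalerBl -e; vring.
rewrite mulrDl !mulrDr -!scalerAl -!scalerAr !mul1r xx mulr1; vring.
Qed.

Lemma traceC x : t (x + 1) = t x + 2%:R.
Proof. by have := trace_affine 1 1 x; rewrite !scale1r mul1r mulr1. Qed.

(** For each nonzero a, expanding (x + a y)^2 writes a (x y + y x) in terms of x, y and 1. When
    these are independent, comparing a = 1 with a = r gives two linear equations, which force
    additivity since r (r - 1) is nonzero; a = 1 alone would give nothing. *)
Lemma traceD x y : t (x + y) = t x + t y.
Proof.
have [/mem1vP[c ->]|x1] := boolP (x \in 1%VS).
  by rewrite addrC -{1}[y]scale1r trace_affine mul1r tC addrC.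
have [|f] := boolP (y \in (<[x]> + 1)%VS).
  move=> /memv_addP[_ /vlineP[a ->] [_ /mem1vP[c ->] ->]].
  rewrite trace_affine addrA -[X in X + _ *: _ + _]scale1r -scalerDl trace_affine; ring.
have key a : a != 0 -> exists c,
    a *: (x * y + y * x) =
    (t (x + a *: y) - t x) *: x + (a * (t (x + a *: y)) - a * a * t y) *: y + c%:A.
  move=> a0; have [n1 e1] := tQ x; have [n2 e2] := tQ y.
  have [n e] := tQ (x + a *: y); exists (n1 + a * a * n2 - n).
  have -> : a *: (x * y + y * x) =
      (x + a *: y) * (x + a *: y) - x * x - (a * a) *: (y * y).
    by rewrite mulrDl !mulrDr -!scalerAl -!scalerAr; vring.
  rewrite e e1 e2; vring.
have indep a b c : a *: x + b *: y + c%:A = 0 -> a = 0 /\ b = 0.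
  move=> h; have b0 : b = 0.
    apply: (contraNeq _ f) => b0.
    have -> : y = (- a / b) *: x + (- c / b)%:A.
      apply: (scalerI b0); rewrite scalerDr !scalerA !(mulrC b) !divfK//.
      by apply/eqP; rewrite -subr_eq0 -h; apply/eqP; vring.
    by apply: memv_add; rewrite memvZ ?memv_line.
  split=> //; apply: (contraNeq _ x1) => a0; apply/mem1vP; exists (- c / a).
  apply: (scalerI a0); rewrite scalerA (mulrC a) divfK//.
  by apply/eqP; rewrite -subr_eq0 -h b0; apply/eqP; vring.
have [c1] := key 1 (oner_neq0 _); have [c2] := key r r0.
set s := x * y + y * x; rewrite !scale1r => e2 e1.
have [] := @indep (r * (t (x + y) - t x) - (t (x + r *: y) - t x))
  (r * (1 * t (x + y) - 1 * 1 * t y) - (r * t (x + r *: y) - r * r * t y)) (r * c1 - c2).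
  transitivity (r *: s - r *: s); last by rewrite subrr.
  by rewrite {1}e1 e2; vring.
move=> h1 h2; apply/eqP; rewrite -subr_eq0.
have rr : r * (r - 1) != 0 by rewrite mulf_neq0// subr_eq0.
have -> : t (x + y) - (t x + t y) =
  (r * (r * (t (x + y) - t x) - (t (x + r *: y) - t x)) -
  (r * (1 * t (x + y) - 1 * 1 * t y) - (r * t (x + r *: y) - r * r * t y))) / (r * (r - 1)).
  by apply: (mulIf rr); rewrite divfK//; ring.
by rewrite h1 h2 mulr0 subrr mul0r.
Qed.

Lemma traceZ a x : t (a *: x) = a * t x.
Proof. by have := trace_affine a 0 x; rewrite scale0r addr0 mulr0 addr0. Qed.

(** Polarizing the quadratic equation gives the identity up to an unknown constant g. Substituting
    it for the inner y x in (x y)^2 = x (y x) y shows that x y has trace t x * t y + g, which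
    identifies g. *)
Lemma trace_mulD_nonscalar x y : x * y \notin 1%VS ->
  x * y + y * x = t x *: y + t y *: x + (t (x * y) - t x * t y)%:A.
Proof.
move=> xy1; have [n1 e1] := tQ x; have [n2 e2] := tQ y; have [n e] := tQ (x + y).
pose g := n1 + n2 - n.
have e3 : x * y + y * x = t x *: y + t y *: x + g%:A.
  have -> : x * y + y * x = (x + y) * (x + y) - x * x - y * y.
    by rewrite mulrDl !mulrDr; vring.
  by rewrite e e1 e2 traceD /g; vring.
have e4 : y * x = t x *: y + t y *: x + g%:A - x * y by rewrite -e3 addrC addKr.
have key : (x * y) * (x * y) = (t x * t y + g) *: (x * y) - (n1 * n2)%:A.
  have -> : (x * y) * (x * y) = x * (y * x) * y by rewrite !mulrA.
  rewrite e4 mulrBr !mulrDr mulrBl !mulrDl -!scalerAr -!scalerAl mulr1.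
  have -> : x * y * y = t y *: (x * y) - n2 *: x.
    by rewrite -mulrA e2 mulrBr -!scalerAr mulr1.
  have -> : x * x * y = t x *: (x * y) - n1 *: y.
    by rewrite e1 mulrBl -!scalerAl mul1r.
  have -> : x * (x * y) * y = (x * x) * (y * y) by rewrite !mulrA.
  by rewrite e1 e2 mulrBl !mulrBr -!scalerAl -!scalerAr !mulr1 mul1r; vring.
have txy := trace_unique xy1 key.
by rewrite e3 txy; congr (_ + _%:A); ring.
Qed.

Lemma trace_mulD x y : x * y + y * x = t x *: y + t y *: x + (t (x * y) - t x * t y)%:A.
Proof.
have [xy1|] := boolP (x * y \in 1%VS); last exact: trace_mulD_nonscalar.
have [/mem1vP[c yc]|y1] := boolP (y \in 1%VS).
  by rewrite yc -scalerAl -scalerAr mul1r mulr1 tC traceZ; vring.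
(* Adding 1 to x makes the product nonscalar, and the identity for x + 1 differs from the one for x
   by 2 y on both sides. *)
have : (x + 1) * y \notin 1%VS.
  by rewrite mulrDl mul1r; apply: contra y1 => h; rewrite -[y](addKr (x * y)) memvD// memvN.
move=> /trace_mulD_nonscalar; rewrite mulrDl mulrDr mul1r mulr1 traceC traceD => h.
have -> : x * y + y * x = x * y + y + (y * x + y) - 2%:R *: y by vring.
by rewrite h; vring.
Qed.

Lemma trace_mulC x y : t (x * y) = t (y * x).
Proof.
have := trace_mulD y x; rewrite addrC trace_mulD [t x *: y + _]addrC => /addrI/(@scalarA_inj _ A).
by rewrite (mulrC (t x)) => /addIr.
Qed.

(** The kernel of t would contain A x A, which is all of A if x is nonzero. Then 2 = t 1 = 0, and
    [trace_mulD] gives a b = - b a = b a for all a and b, against noncommutativity. *)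
Lemma trace_nondegenerate x : (forall y, t (x * y) = 0) -> x = 0.
Proof.
move=> h; apply: contrapT => /eqP x0.
have [|l hl] := @scalar_exists _ _ t; first by move=> c y z; rewrite traceD traceZ.
pose N := lker (linfun (l : A -> K^o)).
have memN y : (y \in N) = (t y == 0) by rewrite memv_ker lfunE /= hl.
have sx : (fullv * <[x]> <= N)%VS.
  apply/prodvP => u _ _ /vlineP[c ->].
  by rewrite memN -scalerAr traceZ trace_mulC h mulr0.
have sU : (fullv * <[x]> * fullv <= N)%VS.
  apply/prodvP => u w uU _; rewrite memN trace_mulC -memN.
  have : w * u \in (fullv * (fullv * <[x]>))%VS by rewrite memv_mul ?memvf.
  by rewrite prodvA; apply/subvP/(subv_trans _ sx)/prodvSl/subvf.
have t0 y : t y = 0.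
  by apply/eqP; rewrite -memN (subvP sU)// ideal_generated ?memvf.
have two : 2%:R = 0 :> K by have := tC 1; rewrite mulr1 t0.
have [a [b ab]] := noncommutative qA; apply: ab.
have /eqP := trace_mulD a b; rewrite !t0 mulr0 subrr !scale0r !addr0.
rewrite addr_eq0 => /eqP ->; rewrite -scaleN1r.
have -> : -1 = 1 :> K; last by rewrite scale1r.
by apply/eqP; rewrite -subr_eq0 -opprD -mulr2n two oppr0.
Qed.

End Properties.

Lemma trace_form_exists : exists t : {scalar A}, trace_form t.
Proof.
have [t [tC tQ]] := trace_exists.
have [|l hl] := @scalar_exists _ _ t.
  by move=> c x y; rewrite (traceD tC tQ) (traceZ tC tQ).
exists l; split=> [|x|x y|x h].
- by rewrite hl -[1]scale1r tC mulr1.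
- by rewrite hl.
- by rewrite !hl (trace_mulD tC tQ).
- by apply: (trace_nondegenerate tC tQ) => y; rewrite -hl.
Qed.

End Trace.

(** * Extension of scalars for the trace form *)

Section TraceExtension.
Variables (K L : fieldType) (iota : {rmorphism K -> L}) (A : falgType K).
Local Notation AL := (scalar_ext iota A : falgType L).
Local Notation e i := ((vbasis {:A})`_i).
Local Notation bc := (base_change iota (A := A)).

Lemma scalar_ext_ind (P : AL -> Prop) :
  (forall c x y, P x -> P y -> P (c *: x + y)) -> (forall a, P (bc a)) ->
  forall x, P x.
Proof.
move=> hD hb x; rewrite (scalar_extE x); elim/big_rec: _ => [|i y _ Py].
  by rewrite -(base_change0 iota).
exact: hD.
Qed.

Variable t : {scalar A}.
Hypothesis ht : trace_form t.

Let gram : 'M[K]_(\dim {:A}) := \matrix_(i, j) t (e i * e j).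

(** Nondegeneracy in the form that survives a change of field, since [iota] preserves invertible
    matrices. A row killed by the Gram matrix is the coordinate row of an element orthogonal to
    A. *)
Lemma gram_unit : gram \in unitmx.
Proof.
rewrite -row_free_unit -kermx_eq0; apply/eqP/row_matrixP => k; rewrite row0.
have : row k (kermx gram) *m gram = 0 by rewrite -row_mul mulmx_ker row0.
move: (row k _) => u ug; pose a := \sum_i u 0 i *: e i.
have a0 : a = 0.
  case: ht => _ _ _; apply => y; rewrite (coord_vbasis (memvf y)).
  rewrite mulr_sumr linear_sum big1// => j _; rewrite -scalerAr linearZ /=.
  have := congr1 (fun m : 'rV_ _ => m 0 j) ug; rewrite !mxE => h.
  rewrite /a mulr_suml linear_sum (eq_bigr (fun i => u 0 i * gram i j)) ?h ?mulr0//.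
  by move=> i _; rewrite -scalerAl linearZ mxE.
apply/rowP => i; rewrite mxE -[LHS](coord_sum_free _ _ (basis_free (vbasisP {:A}))).
by rewrite -/a a0 linear0.
Qed.

(** The bilinear identity is reduced to base-changed elements one variable at a time. The quadratic
    equation is not linear in x, so its induction takes the cross term of (c x + y)^2 from the
    bilinear identity. *)
Lemma trace_form_ext : exists t' : {scalar AL}, trace_form t'.
Proof.
have [|t' t'E] := @scalar_exists L AL (fun x => \sum_i (x : 'rV_ _) 0 i * iota (t (e i))).
  move=> c x y; rewrite mulr_sumr -big_split; apply: eq_bigr => i _.
  by rewrite !mxE mulrDl mulrA.
have tb a : t' (bc a) = iota (t a).
  rewrite t'E {2}(coord_vbasis (memvf a)) linear_sum rmorph_sum; apply: eq_bigr => i _.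
  by rewrite mxE linearZ rmorphM.
have [t1 tQ tM tN] := ht.
have tM' : forall x y : AL, x * y + y * x = t' x *: y + t' y *: x + (t' (x * y) - t' x * t' y)%:A.
  move=> x y; elim/scalar_ext_ind: x => [c x1 x2 h1 h2|a].
    rewrite mulrDl mulrDr -scalerAl -scalerAr !linearP /=.
    have -> : c *: (x1 * y) + x2 * y + (c *: (y * x1) + y * x2) =
       c *: (x1 * y + y * x1) + (x2 * y + y * x2) by vring.
    by rewrite h1 h2; vring.
  elim/scalar_ext_ind: y => [c x1 x2 h1 h2|b].
    rewrite mulrDl mulrDr -scalerAl -scalerAr !linearP /=.
    have -> : c *: (bc a * x1) + bc a * x2 + (c *: (x1 * bc a) + x2 * bc a) =
       c *: (bc a * x1 + x1 * bc a) + (bc a * x2 + x2 * bc a) by vring.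
    by rewrite h1 h2; vring.
  rewrite -!base_changeM !tb -base_changeD tM !base_changeD !base_changeZ base_change1.
  by rewrite rmorphB rmorphM.
exists t'; split=> //.
- by rewrite -[1](base_change1 iota A) tb t1 rmorph_nat.
- elim/scalar_ext_ind => [c x y [n1 e1] [n2 e2]|a].
    exists (c * c * n1 + n2 - c * (t' (x * y) - t' x * t' y)).
    have -> : (c *: x + y) * (c *: x + y) = (c * c) *: (x * x) + c *: (x * y + y * x) + y * y.
      by rewrite mulrDl !mulrDr -!scalerAl -!scalerAr; vring.
    by rewrite tM' e1 e2 linearP /=; vring.
  have [n an] := tQ a; exists (iota n).
  rewrite -base_changeM an -[X in bc X]/(_ *: _ + - (n *: 1)) -scaleNr.
  by rewrite base_changeD !base_changeZ base_change1 tb rmorphN scaleNr.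
- move=> x h; have xg : (x : 'rV_ _) *m map_mx iota gram = 0.
    apply/rowP => j; rewrite !mxE -[RHS](h (bc (e j))) [in RHS](scalar_extE x).
    rewrite mulr_suml linear_sum; apply: eq_bigr => i _.
    by rewrite -scalerAl linearZ -base_changeM tb !mxE.
  have gu : map_mx iota gram \in unitmx by rewrite map_unitmx gram_unit.
  by rewrite -[LHS](mulmxK gu) xg mul0mx.
Qed.

End TraceExtension.

(** * Division algebras over a complete field *)

Section Norm.
Variables (L : fieldType) (B : falgType L) (t : {scalar B}).
Hypothesis ht : trace_form t.

Definition trnorm x : L := projT1 (cid (let: And4 _ h _ _ := ht in h x)).
Local Notation n := trnorm.
Definition trconj x : B := (t x)%:A - x.

Lemma trnormE x : x * x = t x *: x - (n x)%:A.
Proof. by rewrite /trnorm; case: cid. Qed.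

Let t1 : t 1 = 2%:R. Proof. by case: ht. Qed.

Lemma trace_mul2 x y : x * y + y * x = t x *: y + t y *: x + (t (x * y) - t x * t y)%:A.
Proof. by case: ht. Qed.

Lemma trace_nondeg x : (forall y, t (x * y) = 0) -> x = 0.
Proof. by case: ht => _ _ _; apply. Qed.

Lemma tr_mulC x y : t (x * y) = t (y * x).
Proof.
have := trace_mul2 y x; rewrite addrC trace_mul2 [t x *: y + _]addrC => /addrI/(@scalarA_inj _ B).
by rewrite (mulrC (t x)) => /addIr.
Qed.

Lemma mul_trconj x : x * trconj x = (n x)%:A.
Proof. by rewrite mulrBr mulr_algr trnormE; vring. Qed.

Lemma trconj_mul x : trconj x * x = (n x)%:A.
Proof. by rewrite mulrBl mulr_algl trnormE; vring. Qed.

Lemma trconjM x y : trconj (x * y) = trconj y * trconj x.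
Proof.
rewrite /trconj mulrBl mulrBr !mulr_algl mulrBr mulr_algr.
have -> : y * x = t x *: y + t y *: x + (t (x * y) - t x * t y)%:A - x * y.
  by rewrite -trace_mul2 addrC addKr.
by vring.
Qed.

Lemma trnormM x y : n (x * y) = n x * n y.
Proof.
apply: (@scalarA_inj _ B); rewrite -mul_trconj trconjM mulrA -(mulrA x) mul_trconj.
by rewrite mulr_algr -scalerAl mul_trconj scalerA mulrC.
Qed.

Lemma trnorm1D x : n (x + 1) = n x + t x + 1.
Proof.
apply: (@scalarA_inj _ B); rewrite -mul_trconj /trconj linearD /= t1.
by rewrite mulrBr mulr_algr mulrDl !mulrDr trnormE !mul1r mulr1; vring.
Qed.

Lemma trnormZ c x : n (c *: x) = c * c * n x.
Proof.
apply: (@scalarA_inj _ B); rewrite -mul_trconj /trconj linearZ /=.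
by rewrite mulrBr mulr_algr -scalerAl -scalerAr trnormE; vring.
Qed.

Lemma trnorm1 : n 1 = 1.
Proof.
apply: (@scalarA_inj _ B); rewrite -mul_trconj /trconj t1 mul1r; vring.
Qed.

Lemma trnorm_unit x : n x != 0 -> x \is a GRing.unit.
Proof.
move=> nx; apply/unitrP; exists ((n x)^-1 *: trconj x).
by rewrite -scalerAl -scalerAr mul_trconj trconj_mul scalerA mulVf ?scale1r.
Qed.

(** By nondegeneracy, sending y to the functional it represents is injective between spaces of equal
    dimension, hence onto. *)
Lemma trace_dual (l : {scalar B}) : exists y, forall x, l x = t (x * y).
Proof.
pose T y : 'rV[L]_(\dim {:B}) := \row_i t ((vbasis {:B})`_i * y).
have lT c x y : T (c *: x + y) = c *: T x + T y.
  by apply/rowP => i; rewrite !mxE mulrDr -scalerAr linearP.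
pose f : {linear B -> 'rV[L]_(\dim {:B})} := HB.pack T (GRing.isLinear.Build L B _ *:%R T lT).
have dT : limg (linfun f) = fullv.
  apply/eqP; rewrite eqEdim subvf limg_dim_eq.
    by rewrite [X in (X <= _)%N]dimvf /dim /= mul1n.
  rewrite capfv; apply/eqP; rewrite -subv0; apply/subvP => y.
  rewrite memv_ker lfunE /= memv0 => /eqP h; apply/eqP/trace_nondeg => x.
  rewrite tr_mulC (coord_vbasis (memvf x)) mulr_suml linear_sum big1// => i _.
  have := congr1 (fun m : 'rV_ _ => m 0 i) h; rewrite !mxE => e.
  by rewrite -scalerAl linearZ /= e mulr0.
have : \row_i l (vbasis {:B})`_i \in limg (linfun f) by rewrite dT memvf.
move=> /memv_imgP[y _ h]; exists y => x.
rewrite (coord_vbasis (memvf x)) mulr_suml !linear_sum; apply: eq_bigr => i _.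
have := congr1 (fun m : 'rV_ _ => m 0 i) h; rewrite lfunE !mxE => e.
by rewrite -scalerAl !linearZ e.
Qed.

End Norm.

Section Hensel.
Variables (L : fieldType) (v : place L).
Hypothesis complete : forall u : nat -> L, cauchy v u -> exists l, converges v u l.

(* The root is the limit of the iterates of y |-> y^2 + c. *)
Lemma hensel_quadratic c : vge v 1 c -> exists y, y * y - y + c = 0.
Proof.
move=> hc; pose u := fix u i := if i is j.+1 then u j * u j + c else 0.
have u1 i : vge v 1 (u i).
  elim: i => [|i IH]; first exact: vge0.
  by apply: vgeD => //; apply: vgeM0 => //; apply: vgeW IH.
have step i : vge v i%:Z (u i.+1 - u i).
  elim: i => [|i IH]; first by rewrite /= mul0r add0r subr0; exact: vgeW hc.
  have -> : u i.+2 - u i.+1 = (u i.+1 - u i) * (u i.+1 + u i) by move=> /=; ring.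
  have := vgeM IH (vgeD (u1 i.+1) (u1 i)); apply: vgeW; lia.
have diff i d : vge v i%:Z (u (i + d)%N - u i).
  elim: d => [|d IH]; first by rewrite addn0 subrr vge0.
  rewrite addnS -(subrKA (u (i + d)%N)); apply: vgeD => //.
  by apply: vgeW (step _); lia.
have cu : cauchy v u.
  move=> m; exists `|m|%N => i j hi hj.
  rewrite -(subrKA (u `|m|%N)) -[u _ - u j]opprB; apply: vgeB.
    by rewrite -(subnKC hi); apply: vgeW (diff _ _); lia.
  by rewrite -(subnKC hj); apply: vgeW (diff _ _); lia.
have [y hy] := complete cu; exists y.
have y1 : vge v 1 y.
  have [N hN] := hy 1; have := hN N (leqnn N); rewrite -vgeN opprB => h.
  by rewrite -(subrK (u N) y) vgeD.
apply: (@vge_eq0 _ v) => m; have [N hN] := hy m.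
have -> : y * y - y + c = (u N.+1 - y) - (u N - y) * (u N + y) by move=> /=; ring.
apply: vgeB; first by apply: hN.
rewrite mulrC; apply: vgeM0; last exact: hN.
by apply: (vgeW _ (vgeD (u1 N) y1)).
Qed.

End Hensel.

Section Division.
Variables (L : fieldType) (v : place L) (B : falgType L) (t : {scalar B}).
Hypothesis complete : forall u : nat -> L, cauchy v u -> exists l, converges v u l.
Hypotheses (ht : trace_form t) (div : division_algebra B).
Local Notation n := (trnorm ht).

Definition norm_integral : set B := [set x | vge v 0 (n x)].

(** With t x not integral, [hensel_quadratic] gives a root in L of the quadratic polynomial of x,
    which then factors. Without zero divisors x must be a scalar s, with s^2 integral, and so t x =
    2 s is integral after all. *)
Lemma trace_integral x : norm_integral x -> vge v 0 (t x).
Proof.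
rewrite /norm_integral /= => nx; apply: contraT => /vgePn[t0 tx].
have [|y hy] := @hensel_quadratic _ v complete (n x / (t x * t x)).
  rewrite mulrC vgeMl ?invr_neq0 ?mulf_neq0// placeV placeM//.
  by apply: vgeW nx; lia.
pose a := t x * y.
have ha : a * a - t x * a + n x = 0.
  have -> : a * a - t x * a + n x = t x * t x * (y * y - y + n x / (t x * t x)).
    by rewrite mulrDr (mulrC (n x)) mulVKf ?mulf_neq0// /a; ring.
  by rewrite hy mulr0.
have h : (x - a%:A) * (x - (t x - a)%:A) = 0.
  rewrite mulrBl !mulrBr !mulr_algl !mulr_algr (trnormE ht).
  have -> : n x = t x * a - a * a by apply/eqP; rewrite -subr_eq0 -ha; apply/eqP; ring.
  by vring.
have [s xs] : exists s, x = s%:A.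
  have [/eqP|/div u] := eqVneq (x - a%:A) 0; first by rewrite subr_eq0 => /eqP ->; exists a.
  exists (t x - a); apply/eqP; rewrite -subr_eq0; apply/eqP/(mulrI u).
  by rewrite h mulr0.
have ns : n x = s * s by rewrite xs trnormZ trnorm1 mulr1.
have s0 : vge v 0 s.
  have [->|s0] := eqVneq s 0; first exact: vge0.
  by move: nx; rewrite ns !vgeE ?mulf_neq0// placeM//; lia.
suff : vge v 0 (t x) by rewrite vgeE//; lia.
rewrite xs linearZ /=; case: ht => -> _ _ _.
by apply: vgeM0 => //; apply: vgeD; exact: vge1.
Qed.

Lemma norm_integralM x y : norm_integral x -> norm_integral y -> norm_integral (x * y).
Proof. by move=> hx hy; rewrite /norm_integral /= trnormM vgeM0. Qed.

(** Factor out the summand w with norm of smaller valuation: n (z + w) = n (z w^-1 + 1) * n w, and n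
    (u + 1) = n u + t u + 1 is integral because the trace of u is. *)
Lemma norm_integralD x y : norm_integral x -> norm_integral y -> norm_integral (x + y).
Proof.
have key z w : w != 0 -> norm_integral w -> norm_integral (z * w^-1) -> norm_integral (z + w).
  move=> w0 hw hz; have -> : z + w = (z * w^-1 + 1) * w by rewrite mulrDl mul1r divrK// div.
  apply: norm_integralM => //; rewrite /norm_integral /= trnorm1D.
  by rewrite !vgeD ?vge1 ?trace_integral.
have nV z : z != 0 -> n z != 0 /\ n z^-1 = (n z)^-1.
  move=> /div uz; have := trnormM ht z z^-1; rewrite divrr// trnorm1 => e.
  have nz : n z != 0.
    by apply: contra_eqN e => /eqP ->; rewrite mul0r oner_neq0.
  by split=> //; apply: (mulfI nz); rewrite -e divff.
have [->|x0] := eqVneq x 0; first by rewrite add0r.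
have [->|y0] := eqVneq y 0; first by rewrite addr0.
have [nx0 nxV] := nV x x0; have [ny0 nyV] := nV y y0 => hx hy.
have [xy|/ltW xy] := leP (v (n y)) (v (n x)).
  apply: key => //; rewrite /norm_integral /= trnormM nyV vgeE ?mulf_neq0 ?invr_neq0//.
  by rewrite placeM ?invr_neq0// placeV; lia.
rewrite addrC; apply: key => //; rewrite /norm_integral /= trnormM nxV vgeE ?mulf_neq0 ?invr_neq0//.
by rewrite placeM ?invr_neq0// placeV; lia.
Qed.

Lemma norm_integral_order : lorder v norm_integral.
Proof.
have sN : vsubmod v norm_integral.
  split=> [|c x y hc hx hy]; first by rewrite /norm_integral /= -(scale0r 0) trnormZ !mul0r vge0.
  by apply: norm_integralD => //; rewrite /norm_integral /= trnormZ !vgeM0.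
have ab : vabsorb norm_integral.
  move=> x; exists (ppow v `|v (n x)|); first exact: ppow_neq0.
  rewrite /norm_integral /= trnormZ -mulrA !vge_ppowM; apply: (@vgeW _ v _ (v (n x))); first lia.
  exact: vge_val.
split; last first.
  by split=> [|x y]; [rewrite /norm_integral /= trnorm1 vge1|exact: norm_integralM].
apply: latticeP => // l.
(* A multiple c y is norm-integral, hence so is x (c y), whose trace is integral; by [trace_dual]
   this bounds every functional. *)
have hl y : exists m, forall x, norm_integral x -> vge v m (t (x * y)).
  have [c c0 hc] := ab y; exists (- v c) => x hx.
  have := trace_integral (norm_integralM hx hc).
  by rewrite -scalerAr linearZ /= vgeMl ?sub0r.
have [y hy] := trace_dual ht l; have [m hm] := hl y.
by exists m => x /hm; rewrite -hy.
Qed.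

(** The norm is bounded on M, since n y = t y * y - y^2 lies in M up to a fixed factor; but a
    nonintegral n x would have unbounded powers n (x^k). *)
Lemma order_norm_integral M : lorder v M -> M `<=` norm_integral.
Proof.
move=> [lM [M1 MM]] x Mx.
have sM := lattice_submod lM.
have t1 : t 1 = 2%:R by case: ht.
have hb : exists m, forall y, M y -> vge v m (n y).
  have [l l1] : exists l : {scalar B}, l 1 != 0.
    apply: contrapT => h; have /eqP := oner_neq0 B; apply; apply: eq_scalar => l.
    by rewrite linear0; apply: contrapT => /eqP e; apply: h; exists l.
  have [m1 h1] := lattice_bounded lM t; have [m2 h2] := lattice_bounded lM l.
  (* Chosen so that k <= 0 and k <= m1: multiplying by an element of valuation -k makes t y integral
     and keeps y^2 in M. *)
  pose k : int := - (`|m1|%:Z).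
  exists (k + m2 - v (l 1)) => y My.
  have : M (ppow v (- k) *: (n y)%:A).
    have -> : ppow v (- k) *: (n y)%:A = (ppow v (- k) * t y) *: y - ppow v (- k) *: (y * y).
      by rewrite (trnormE ht); vring.
    apply: (vsubmodB sM); apply: (vsubmodZ sM) => //; last exact: MM.
      by rewrite vge_ppowM; apply: vgeW (h1 y My); rewrite /k; lia.
    by apply: vgeW (vge_ppow v _); rewrite /k; lia.
  move/h2; rewrite !linearZ /= vge_ppowM mulrC vgeMl//; by rewrite opprK [m2 + k]addrC.
have Mp k : M (x ^+ k) by elim: k => [|k IH]; rewrite ?expr0// exprS; apply: MM.
have nX k : n (x ^+ k) = n x ^+ k.
  by elim: k => [|k IH]; rewrite ?expr0 ?trnorm1// !exprS trnormM IH.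
have [m hm] := hb; rewrite /norm_integral /=; apply: contraT => /vgePn[n0 nx].
have := hm _ (Mp `|m|.+1); rewrite nX vgeE ?expf_neq0// placeX//; nia.
Qed.

Lemma division_maximal M : lmaximal v M -> M = norm_integral.
Proof.
by move=> [oM mM]; apply: mM; [exact: norm_integral_order|exact: order_norm_integral].
Qed.

End Division.

(** * Matrix units in a split quaternion algebra *)

Lemma sum_ord2 (V : zmodType) (F : 'I_2 -> V) : \sum_i F i = F 0 + F 1.
Proof. by rewrite big_ord_recl big_ord1; congr (_ + F _); apply: val_inj. Qed.

Section Matrix2.
Variable L : fieldType.

Definition mx2 (a b c d : L) : 'M[L]_2 :=
  \matrix_(i, j) if i == 0 then (if j == 0 then a else b) else (if j == 0 then c else d).

Lemma mx2E (a b c d : L) : ((mx2 a b c d 0 0 = a) * (mx2 a b c d 0 1 = b))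
  * ((mx2 a b c d 1 0 = c) * (mx2 a b c d 1 1 = d)).
Proof. by rewrite !mxE. Qed.

Lemma ord2P (P : 'I_2 -> Prop) : P 0 -> P 1 -> forall i, P i.
Proof.
move=> P0 P1 [[|[|//]] i2]; first by rewrite (_ : Ordinal i2 = 0)//; apply: val_inj.
by rewrite (_ : Ordinal i2 = 1)//; apply: val_inj.
Qed.

Lemma mx2_eta (m : 'M[L]_2) : m = mx2 (m 0 0) (m 0 1) (m 1 0) (m 1 1).
Proof. by apply/matrixP; apply: ord2P; apply: ord2P; rewrite mx2E. Qed.

Lemma mx2M a b c d a' b' c' d' : mx2 a b c d *m mx2 a' b' c' d' =
  mx2 (a * a' + b * c') (a * b' + b * d') (c * a' + d * c') (c * b' + d * d').
Proof. by apply/matrixP; apply: ord2P; apply: ord2P; rewrite mx2E mxE sum_ord2 !mx2E. Qed.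

Lemma mx2D a b c d a' b' c' d' : mx2 a b c d + mx2 a' b' c' d' =
  mx2 (a + a') (b + b') (c + c') (d + d').
Proof. by apply/matrixP; apply: ord2P; apply: ord2P; rewrite mx2E mxE !mx2E. Qed.

Lemma mx2Z k a b c d : k *: mx2 a b c d = mx2 (k * a) (k * b) (k * c) (k * d).
Proof. by apply/matrixP; apply: ord2P; apply: ord2P; rewrite mx2E mxE !mx2E. Qed.

Lemma mx2_scalar a : a%:M = mx2 a 0 0 a.
Proof. by apply/matrixP; apply: ord2P; apply: ord2P; rewrite mx2E mxE. Qed.

Lemma delta_mx2_sandwich (a : 'M[L]_2) (i j : 'I_2) :
  delta_mx 0 i *m a *m delta_mx j 0 = a i j *: delta_mx 0 0 :> 'M[L]_2.
Proof.
have dE k l : delta_mx k l = mx2 ((0 == k) && (0 == l))%:R ((0 == k) && (1 == l))%:R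
    ((1 == k) && (0 == l))%:R ((1 == k) && (1 == l))%:R :> 'M[L]_2.
  by rewrite [LHS]mx2_eta !mxE.
rewrite !dE {1}(mx2_eta a) !mx2M mx2Z.
by move: i j; apply: ord2P; apply: ord2P => /=; congr mx2; ring.
Qed.

End Matrix2.

Definition frame (L : fieldType) (B : falgType L) (th : {linear B -> 'M[L]_2}) : Prop :=
  [/\ bijective th, th 1 = 1%:M & forall x y, th (x * y) = th x *m th y].

Section Split.
Variables (L : fieldType) (B : falgType L) (t : {scalar B}).
Hypotheses (ht : trace_form t) (dimB : \dim {:B} = 4%N).

(** The conjugate of e is 1 - e, which kills e; hence the conjugate of e z, a multiple of 1 - e on
    the right, kills e too. *)
Lemma corner e z : e * e = e -> t e = 1 -> e * z * e = t (e * z) *: e.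
Proof.
move=> ee te; have : trconj t (e * z) * e = 0.
  have h : trconj t e * e = 0 by rewrite /trconj te scale1r mulrBl mul1r ee subrr.
  by rewrite (trconjM ht) -mulrA h mulr0.
by rewrite /trconj mulrBl mulr_algl => /eqP; rewrite subr_eq0 => /eqP <-.
Qed.

(** A nonunit has norm 0, and so has x y, whence (x y)^2 = t (x y) * (x y). Nondegeneracy supplies a
    y with nonzero trace to divide by. *)
Lemma split_idempotent (x : B) : x != 0 -> x \isn't a GRing.unit ->
  exists e : B, e * e = e /\ t e = 1.
Proof.
move=> x0 xu; have nx : trnorm ht x = 0.
  by apply/eqP; apply: contraNT xu => /trnorm_unit.
have [y ty] : exists y, t (x * y) != 0.
  apply: contrapT => h; move/eqP: x0; apply; apply: (trace_nondeg ht) => y.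
  by apply: contrapT => /eqP ty; apply: h; exists y.
pose e := (t (x * y))^-1 *: (x * y); exists e.
have te : t e = 1 by rewrite linearZ /= mulVf.
split=> //; rewrite (trnormE ht) te scale1r trnormZ trnormM nx.
by rewrite mul0r mulr0 scale0r subr0.
Qed.

(** Peirce decomposition: with both off-diagonal corners zero, B would be spanned by e and 1 - e,
    against dimension 4. The roles of the two idempotents are exchanged if only the lower corner is
    nonzero. *)
Lemma split_offdiag (x : B) : x != 0 -> x \isn't a GRing.unit ->
  exists e f : B, [/\ e * e = e, t e = 1, f != 0, e * f = f & f * e = 0].
Proof.
move=> x0 xu; have [e [ee te]] := split_idempotent x0 xu.
have t1 : t 1 = 2%:R by case: ht.
have [e' eE] : exists e', e' = 1 - e by exists (1 - e).
have ee' : e' * e' = e'.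
  by rewrite eE mulrBl mul1r mulrBr mulr1 ee subrr subr0.
have te' : t e' = 1 by rewrite eE linearB /= t1 te; ring.
have e0 : e * e' = 0 by rewrite eE mulrBr mulr1 ee subrr.
have e'0 : e' * e = 0 by rewrite eE mulrBl mul1r ee subrr.
have [[z z0]|/forallNP h1] := pselect (exists z, e * z * e' != 0).
  by exists e, (e * z * e'); split; rewrite // ?mulrA ?ee// -!mulrA e'0 !mulr0.
have [[z z0]|/forallNP h2] := pselect (exists z, e' * z * e != 0).
  by exists e', (e' * z * e); split; rewrite // ?mulrA ?ee'// -!mulrA e0 !mulr0.
have : (fullv <= <<[:: e; e']>>)%VS.
  apply/subvP => z _; rewrite span_cons span_seq1.
  have -> : z = t (e * z) *: e + t (e' * z) *: e'.
    rewrite -!corner//.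
    have /eqP : (e + e') * z * (e + e') = z by rewrite eE addrC subrK mul1r mulr1.
    rewrite mulrDl mulrDr !mulrDl.
    have /negP := h1 z; rewrite negbK => /eqP ->.
    have /negP := h2 z; rewrite negbK => /eqP ->.
    by rewrite addr0 add0r => /eqP.
  by rewrite memv_add ?memvZ ?memv_line.
by move/dimvS; rewrite dimB => /leq_trans/(_ (dim_span _)).
Qed.

Lemma split_frame : ~ division_algebra B -> exists th : {linear B -> 'M[L]_2}, frame th.
Proof.
move=> /existsNP[x /not_implyP[x0 /negP xu]].
have [e [f [ee te f0 ef fe]]] := split_offdiag x0 xu.
have t1 : t 1 = 2%:R by case: ht.
have [e' eE] : exists e', e' = 1 - e by exists (1 - e).
have ee' : e' * e' = e'.
  by rewrite eE mulrBl mul1r mulrBr mulr1 ee subrr subr0.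
have te' : t e' = 1 by rewrite eE linearB /= t1 te; ring.
have e0 : e * e' = 0 by rewrite eE mulrBr mulr1 ee subrr.
have e'0 : e' * e = 0 by rewrite eE mulrBl mul1r ee subrr.
have fe' : f * e' = f by rewrite eE mulrBr mulr1 fe subr0.
have e'f : e' * f = 0 by rewrite eE mulrBl mul1r ef subrr.
have [y ty] : exists y, t (f * y) = 1.
  have [y ty] : exists y, t (f * y) != 0.
    apply: contrapT => h; move/eqP: f0; apply; apply: (trace_nondeg ht) => y.
    by apply: contrapT => /eqP ty; apply: h; exists y.
  by exists ((t (f * y))^-1 *: y); rewrite -scalerAr linearZ /= mulVf.
have [g gE] : exists g, g = e' * y * e by exists (e' * y * e).
have e'g : e' * g = g by rewrite gE !mulrA ee'.
have ge : g * e = g by rewrite gE -!mulrA ee.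
have eg : e * g = 0 by rewrite gE !mulrA e0 !mul0r.
have ge' : g * e' = 0 by rewrite gE -!mulrA e0 !mulr0.
have ff : f * f = 0 by rewrite -{1}fe' -mulrA e'f mulr0.
have gg : g * g = 0 by rewrite -{1}ge -mulrA eg mulr0.
have tfg : t (f * g) = 1.
  by rewrite gE !mulrA fe' (tr_mulC ht) !mulrA ef.
have fg : f * g = e.
  have := corner (f * g) ee te.
  by rewrite !mulrA ef -mulrA ge tfg scale1r.
have gf : g * f = e'.
  have := corner (g * f) ee' te'.
  by rewrite !mulrA e'g -mulrA fe' (tr_mulC ht) tfg scale1r.
have tf : t f = 0 by rewrite -ef (tr_mulC ht) fe linear0.
have tg : t g = 0 by rewrite -ge (tr_mulC ht) eg linear0.
(* e, f, g, e' are the matrix units. The trace pairs e and e' with themselves but f with g, hence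
   the coefficient of f is read off by g and conversely. *)
pose th z := mx2 (t (e * z)) (t (g * z)) (t (f * z)) (t (e' * z)).
pose ph (m : 'M[L]_2) := m 0 0 *: e + m 0 1 *: f + m 1 0 *: g + m 1 1 *: e'.
have thl c z w : th (c *: z + w) = c *: th z + th w.
  by rewrite /th mx2Z mx2D !mulrDr -!scalerAr !linearP.
pose thL : {linear B -> 'M[L]_2} := HB.pack th (GRing.isLinear.Build L B _ *:%R th thl).
have phK : cancel ph th.
  move=> m; rewrite [RHS]mx2_eta /th /ph !mulrDr -!scalerAr.
  rewrite ee ef eg e0 ge gf gg ge' fe ff fg fe' e'0 e'f e'g ee'.
  by rewrite !scaler0 !addr0 !add0r !linearD !linearZ /= te te' tf tg !mulr0 !mulr1 ?addr0 ?add0r.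
have phl c m m' : ph (c *: m + m') = c *: ph m + ph m' by rewrite /ph !mxE; vring.
pose phL : {linear 'M[L]_2 -> B} := HB.pack ph (GRing.isLinear.Build L _ B *:%R ph phl).
have full : limg (linfun phL) = fullv.
  apply/eqP; rewrite eqEdim subvf limg_dim_eq ?dimB ?dimvf//.
  rewrite capfv; apply/eqP; rewrite -subv0; apply/subvP => m.
  by rewrite memv_ker lfunE /= memv0 => /eqP h; rewrite -(phK m) h -[th 0]/(thL 0) linear0.
have thK : cancel th ph.
  move=> z; have /memv_imgP[m _ ->] : z \in limg (linfun phL) by rewrite full memvf.
  by rewrite lfunE /= phK.
have phM m m' : ph (m *m m') = ph m * ph m'.
  rewrite /ph !mxE !sum_ord2 !mulrDl !mulrDr -!scalerAl -!scalerAr.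
  rewrite ee ef eg e0 ge gf gg ge' fe ff fg fe' e'0 e'f e'g ee'.
  by vring.
exists thL; split=> [||z w].
- by exists ph.
- by rewrite /= /th !mulr1 te te' tf tg -mx2_scalar.
- by rewrite /= -{1}(thK z) -{1}(thK w) -phM phK.
Qed.

End Split.

(** * Normal forms of 2x2 matrices *)

Lemma invmxM (F : fieldType) n (a b : 'M[F]_n) : a \in unitmx -> b \in unitmx ->
  invmx (a *m b) = invmx b *m invmx a.
Proof.
move=> ua ub; have uab : a *m b \in unitmx by rewrite unitmx_mul ua.
have e : a *m b *m (invmx b *m invmx a) = 1%:M by rewrite mulmxA mulmxK// mulmxV.
by rewrite -[RHS](mulKmx uab) e mulmx1.
Qed.

Section IntegralMatrices.
Variables (L : fieldType) (v : place L).

Definition mxint m n (a : 'M[L]_(m, n)) : Prop := forall i j, vge v 0 (a i j).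

Lemma mxintM m n p (a : 'M[L]_(m, n)) (b : 'M[L]_(n, p)) :
  mxint a -> mxint b -> mxint (a *m b).
Proof. by move=> ha hb i j; rewrite mxE; apply: vge_sum => k _; apply: vgeM0. Qed.

Lemma mxint_mx2 a b c d : vge v 0 a -> vge v 0 b -> vge v 0 c -> vge v 0 d ->
  mxint (mx2 a b c d).
Proof. by move=> *; apply: ord2P; apply: ord2P; rewrite mx2E. Qed.

Lemma mxint1 n : mxint (1%:M : 'M[L]_n).
Proof. by move=> i j; rewrite mxE; case: eqP => _; rewrite ?vge0 ?vge1. Qed.

(** The group GL_2 of the valuation ring, the base changes that do not move a lattice. *)
Definition glint (q : 'M[L]_2) : Prop := [/\ q \in unitmx, mxint q & mxint (invmx q)].

Lemma glint_pair (q q' : 'M[L]_2) : q *m q' = 1%:M -> mxint q -> mxint q' -> glint q.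
Proof.
move=> qq hq hq'; have [uq uq'] := mulmx1_unit qq; split=> //.
by have <- : q' = invmx q by rewrite -[q'](mulKmx uq) qq mulmx1.
Qed.

Lemma glintM (p q : 'M[L]_2) : glint p -> glint q -> glint (p *m q).
Proof.
move=> [up hp hp'] [uq hq hq']; apply: (@glint_pair _ (invmx q *m invmx p)).
- by rewrite mulmxA mulmxK// mulmxV.
- exact: mxintM.
- exact: mxintM.
Qed.

Lemma glint_lower x : vge v 0 x -> glint (mx2 1 0 x 1).
Proof.
move=> hx; apply: (@glint_pair _ (mx2 1 0 (- x) 1)).
- by rewrite mx2M mx2_scalar; congr mx2; ring.
- by apply: mxint_mx2; rewrite ?vge0 ?vge1.
- by apply: mxint_mx2; rewrite ?vge0 ?vge1 ?vgeN.
Qed.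

Lemma glint_upper x : vge v 0 x -> glint (mx2 1 x 0 1).
Proof.
move=> hx; apply: (@glint_pair _ (mx2 1 (- x) 0 1)).
- by rewrite mx2M mx2_scalar; congr mx2; ring.
- by apply: mxint_mx2; rewrite ?vge0 ?vge1.
- by apply: mxint_mx2; rewrite ?vge0 ?vge1 ?vgeN.
Qed.

Lemma glint_swap : glint (mx2 0 1 1 0).
Proof.
have h : mxint (mx2 0 1 1 0) by apply: mxint_mx2; rewrite ?vge0 ?vge1.
by apply: (glint_pair _ h h); rewrite mx2M mx2_scalar; congr mx2; ring.
Qed.

Lemma glint1 : glint 1%:M.
Proof. by apply: (@glint_pair _ 1%:M); rewrite ?mulmx1//; exact: mxint1. Qed.

Lemma glint_diag u : u != 0 -> v u = 0 -> glint (mx2 1 0 0 u).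
Proof.
move=> u0 vu; apply: (@glint_pair _ (mx2 1 0 0 u^-1)).
- by rewrite mx2M mx2_scalar; congr mx2; rewrite ?divff//; ring.
- by apply: mxint_mx2; rewrite ?vge0 ?vge1 ?vge_val.
- by apply: mxint_mx2; rewrite ?vge0 ?vge1 ?vge_val// placeV vu oppr0.
Qed.

Lemma mx2_unit (a b c d : L) : mx2 a b c d \in unitmx = (a * d - b * c != 0).
Proof.
rewrite unitmxE unitfE; congr (_ != _); rewrite (expand_det_row _ 0) sum_ord2.
rewrite /cofactor !det_mx11 !mxE /= !expr0 !expr1; ring.
Qed.

(** Integral column operations keep the lattice spanned by the columns and clear the first row using
    its entry of smaller valuation. Up to homothety a lattice of the plane is thus a ball x + pi^r
    O. *)
Lemma hermite_form (g : 'M[L]_2) : g \in unitmx ->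
  exists c x r q, [/\ c != 0, glint q & g = c *: mx2 1 0 x (ppow v r) *m q].
Proof.
have main a b c d : mx2 a b c d \in unitmx -> a != 0 -> vge v 0 (b / a) ->
    exists k x r q, [/\ k != 0, glint q & mx2 a b c d = k *: mx2 1 0 x (ppow v r) *m q].
  (* [d'] is the determinant over a^2: the corner left after clearing the first row, once the factor
     a is taken out. *)
  rewrite mx2_unit => D a0 ba; pose d' := (d - c * b / a) / a.
  have d'0 : d' != 0.
    rewrite mulf_neq0 ?invr_neq0//; apply: contraNneq D => e.
    have -> : a * d - b * c = a * (d - c * b / a) by field.
    by rewrite e mulr0.
  exists a, (c / a), (v d'), (mx2 1 0 0 (d' / ppow v (v d')) *m mx2 1 (b / a) 0 1).
  split=> //.
    apply: glintM; last exact: glint_upper.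
    apply: glint_diag; first by rewrite mulf_neq0 ?invr_neq0 ?ppow_neq0.
    by rewrite placeM ?invr_neq0 ?ppow_neq0// placeV place_ppow subrr.
  rewrite mx2Z mulmxA !mx2M; have p0 := ppow_neq0 v (v d').
  by congr mx2; rewrite /d' in p0 *; field; rewrite ?a0 ?p0.
rewrite (mx2_eta g); move: (g 0 0) (g 0 1) (g 1 0) (g 1 1) => a b c d ug.
have [ba|ba] := boolP ((a != 0) && vge v 0 (b / a)).
  by case/andP: ba => a0 ba; apply: main.
have b0 : b != 0.
  apply: contraNneq ba => b0; rewrite b0 mul0r vge0 andbT.
  by apply: contraTneq ug => a0; rewrite mx2_unit a0 b0 !mul0r subrr eqxx.
have ab : vge v 0 (a / b).
  have [->|a0] := eqVneq a 0; first by rewrite mul0r vge0.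
  move: ba; rewrite a0 /= !vgeE ?mulf_neq0 ?invr_neq0// !placeM ?invr_neq0// !placeV; lia.
have [] := main b a d c _ b0 ab.
  by move: ug; rewrite !mx2_unit; apply: contraNN; rewrite subr_eq0 => /eqP e; rewrite subr_eq0 e.
move=> k [x [r [q [k0 hq e]]]]; exists k, x, r, (q *m mx2 0 1 1 0); split=> //.
  exact: glintM glint_swap.
by rewrite mulmxA -e mx2M; congr mx2; ring.
Qed.

(** An entry of least valuation, moved to the corner by swaps and taken out as c, clears its row and
    column and leaves an element of valuation l >= 0. This l will be the distance between two
    vertices. *)
Lemma smith_form (g : 'M[L]_2) : g \in unitmx ->
  exists c (l : nat) p q, [/\ c != 0, glint p, glint q & g = c *: (p *m mx2 1 0 0 (ppow v l) *m q)].
Proof.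
have main a b c d : mx2 a b c d \in unitmx -> a != 0 -> vge v 0 (b / a) ->
    vge v 0 (c / a) -> vge v 0 (d / a) ->
    exists k (l : nat) p q, [/\ k != 0, glint p, glint q &
      mx2 a b c d = k *: (p *m mx2 1 0 0 (ppow v l) *m q)].
  rewrite mx2_unit => D a0 ba ca da; pose d' := (d - c * b / a) / a.
  have d'0 : d' != 0.
    rewrite mulf_neq0 ?invr_neq0//; apply: contraNneq D => e.
    have -> : a * d - b * c = a * (d - c * b / a) by field.
    by rewrite e mulr0.
  have vd' : vge v 0 d'.
    have -> : d' = d / a - c / a * (b / a) by rewrite /d'; field.
    by apply: vgeB => //; apply: vgeM0.
  have vd0 : `|v d'|%N = v d' :> int by move: vd'; rewrite vgeE//; lia.
  exists a, `|v d'|%N, (mx2 1 0 (c / a) 1), (mx2 1 0 0 (d' / ppow v (v d')) *m mx2 1 (b / a) 0 1).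
  split=> //; first exact: glint_lower.
    apply: glintM; last exact: glint_upper.
    apply: glint_diag; first by rewrite mulf_neq0 ?invr_neq0 ?ppow_neq0.
    by rewrite placeM ?invr_neq0 ?ppow_neq0// placeV place_ppow subrr.
  rewrite vd0 mulmxA !mx2M mx2Z; have p0 := ppow_neq0 v (v d').
  by congr mx2; rewrite /d' in p0 *; field; rewrite ?a0 ?p0.
move=> ug; have [i0 [j0 g0]] : exists i j, g i j != 0.
  apply: contrapT => h; move: ug; rewrite unitmxE unitfE (_ : g = 0) ?det0 ?eqxx//.
  by apply/matrixP => i j; rewrite mxE; apply: contrapT => /eqP e; apply: h; exists i, j.
have [m hm] := vge_fin v (fun ij : 'I_2 * 'I_2 => g ij.1 ij.2).
have [||r [[i [j [gij vij]]] hr]] :=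
    @int_min (fun r => exists i j, g i j != 0 /\ v (g i j) = r) m.
- by exists (v (g i0 j0)), i0, j0.
- by move=> r [i [j [h <-]]]; rewrite -vgeE//; exact: (hm (i, j)).
have hq i' j' : vge v 0 (g i' j' / g i j).
  rewrite mulrC vgeMl ?invr_neq0// placeV sub0r opprK vij.
  have [->|h] := eqVneq (g i' j') 0; first exact: vge0.
  by rewrite vgeE//; apply: hr; exists i', j'.
pose sw (k : 'I_2) : 'M[L]_2 := if k == 0 then 1%:M else mx2 0 1 1 0.
have gsw k : glint (sw k) by rewrite /sw; case: eqP => _; [exact: glint1|exact: glint_swap].
have swK k : sw k *m sw k = 1%:M.
  rewrite /sw; case: eqP => _; first by rewrite mulmx1.
  by rewrite mx2M mx2_scalar; congr mx2; ring.
have : exists k (l : nat) p q, [/\ k != 0, glint p, glint q &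
      sw i *m g *m sw j = k *: (p *m mx2 1 0 0 (ppow v l) *m q)].
  have : sw i *m g *m sw j \in unitmx.
    by rewrite !unitmx_mul ug; case: (gsw i) => ->; case: (gsw j) => ->.
  have e : sw i *m g *m sw j =
     mx2 (g i j) (g i (1 - j)) (g (1 - i) j) (g (1 - i) (1 - j)).
    rewrite {1}(mx2_eta g) /sw.
    have e10 : (1 - 0 : 'I_2) = 1 by apply: val_inj.
    have e11 : (1 - 1 : 'I_2) = 0 by apply: val_inj.
    move: (i) (j); apply: ord2P; apply: ord2P => /=; rewrite ?mul1mx ?mulmx1 ?mx2M ?e10 ?e11;
      congr mx2; ring.
  by rewrite e => h; apply: main.
move=> [k [l [p [q [k0 hp hq' e]]]]]; exists k, l, (sw i *m p), (q *m sw j); split=> //.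
- exact: glintM.
- exact: glintM.
have -> : g = sw i *m (sw i *m g *m sw j) *m sw j.
  by rewrite !mulmxA swK mul1mx -mulmxA swK mulmx1.
by rewrite e -scalemxAr -scalemxAl !mulmxA.
Qed.

End IntegralMatrices.

(** * Maximal orders as stabilizers of lattices *)

Section FrameOrders.
Variables (L : fieldType) (v : place L) (B : falgType L).
Implicit Types th : {linear B -> 'M[L]_2}.

(** The stabilizer of the lattice spanned by the columns of g, written in the basis of these
    columns. *)
Definition frame_order th (g : 'M[L]_2) : set B :=
  [set z | mxint v (invmx g *m th z *m g)].

Lemma frame_inv th : frame th -> exists ph : 'M[L]_2 -> B, cancel ph th /\ cancel th ph.
Proof. by case=> -[ph h1 h2] _ _; exists ph. Qed.

Lemma frame_conj th (h : 'M[L]_2) : frame th -> h \in unitmx ->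
  exists th' : {linear B -> 'M[L]_2},
    frame th' /\ forall z, th' z = invmx h *m th z *m h.
Proof.
move=> fth uh; have [ph [phK thK]] := frame_inv fth; have [_ th1 thM] := fth.
pose f z := invmx h *m th z *m h.
have lf c x y : f (c *: x + y) = c *: f x + f y.
  by rewrite /f linearP mulmxDr mulmxDl -scalemxAr -scalemxAl.
pose th' : {linear B -> 'M[L]_2} := HB.pack f (GRing.isLinear.Build L B _ *:%R f lf).
exists th'; split=> //; split=> [||x y] /=; rewrite ?/f.
- exists (fun m => ph (h *m m *m invmx h)) => m /=; rewrite /f ?phK !mulmxA.
    by rewrite mulmxV// mul1mx mulmxK// thK.
  by rewrite mulVmx// mul1mx mulmxKV.
- by rewrite th1 mulmx1 mulVmx.
- by rewrite thM !mulmxA mulmxK.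
Qed.

Lemma frame_order_conj th th' (h g : 'M[L]_2) : h \in unitmx -> g \in unitmx ->
  (forall z, th' z = invmx h *m th z *m h) ->
  frame_order th' g = frame_order th (h *m g).
Proof.
move=> uh ug e; apply/seteqP; split=> z; rewrite /frame_order /= e invmxM// ?mulmxA//.
Qed.

Lemma frame_orderZ th (g : 'M[L]_2) c : c != 0 -> g \in unitmx ->
  frame_order th (c *: g) = frame_order th g.
Proof.
move=> c0 ug; suff e z : invmx (c *: g) *m th z *m (c *: g) = invmx g *m th z *m g.
  by apply/seteqP; split=> z; rewrite /frame_order /= e.
by rewrite invmxZ ?unitmxZ ?unitfE// -!scalemxAl -scalemxAr scalerA mulVf// scale1r.
Qed.

Lemma frame_orderM th (g q : 'M[L]_2) : g \in unitmx -> glint v q ->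
  frame_order th (g *m q) = frame_order th g.
Proof.
move=> ug [uq hq hq']; apply/seteqP; split=> z; rewrite /frame_order /= invmxM// => h.
  have -> : invmx g *m th z *m g = q *m (invmx q *m invmx g *m th z *m (g *m q)) *m invmx q.
    by rewrite !mulmxA mulmxV// mul1mx mulmxK.
  by apply: mxintM => //; apply: mxintM.
have -> : invmx q *m invmx g *m th z *m (g *m q) = invmx q *m (invmx g *m th z *m g) *m q.
  by rewrite !mulmxA.
by apply: mxintM => //; apply: mxintM.
Qed.

Lemma frame_order1 th : frame_order th 1%:M = [set z | mxint v (th z)].
Proof. by apply/seteqP; split=> z; rewrite /frame_order /= invmx1 mul1mx mulmx1. Qed.

(** A larger order contains the matrix units, which move any entry of one of its elements to the top
    left corner. The powers of that entry stay bounded, so it is integral. *)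
Lemma frame_order_maximal1 th : frame th -> lmaximal v [set z | mxint v (th z)].
Proof.
move=> fth; have [ph [phK thK]] := frame_inv fth; have [_ th1 thM] := fth.
set M := [set z | _]; have sM : vsubmod v M.
  split=> [i j|c x y hc hx hy i j]; first by rewrite linear0 mxE vge0.
  by rewrite linearP !mxE vgeD ?vgeM0.
split.
  split; last first.
    split=> [|x y hx hy]; first by rewrite /M /= th1; exact: mxint1.
    by rewrite /M /= thM; exact: mxintM.
  apply: latticeP => // [w|l].
    have [m hm] := vge_fin v (fun ij : 'I_2 * 'I_2 => th w ij.1 ij.2).
    exists (ppow v (- m)); first exact: ppow_neq0.
    by move=> i j; rewrite linearZ mxE vge_ppowM opprK add0r; exact: (hm (i, j)).
  have [m hm] := vge_fin v (fun ij : 'I_2 * 'I_2 => l (ph (delta_mx ij.1 ij.2))).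
  exists m => z hz.
  have -> : z = \sum_i \sum_j th z i j *: ph (delta_mx i j).
    apply: (can_inj thK); rewrite {1}[th z]matrix_sum_delta linear_sum.
    apply: eq_bigr => i _; rewrite linear_sum; apply: eq_bigr => j _.
    by rewrite linearZ phK.
  rewrite linear_sum; apply: vge_sum => i _; rewrite linear_sum; apply: vge_sum => j _.
  by rewrite linearZ /=; apply: vgeM0 => //; exact: (hm (i, j)).
move=> N [lN [N1 NM]] MN; apply/seteqP; split=> // z Nz i j.
have inN i' j' : N (ph (delta_mx i' j')).
  by apply: MN => i'' j''; rewrite phK mxE; case: (_ && _); rewrite ?vge1 ?vge0.
pose u := ph (delta_mx 0 i) * z * ph (delta_mx j 0).
have Nu : N u by apply: (NM _ _ _ (inN _ _)); apply: NM => //; exact: inN.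
have thu : th u = th z i j *: delta_mx 0 0.
  by rewrite !thM !phK delta_mx2_sandwich.
have Np k : N (u ^+ k) by elim: k => [|k IH]; rewrite ?expr0// exprS; apply: NM.
have thp k : th (u ^+ k) 0 0 = th z i j ^+ k.
  suff -> : th (u ^+ k) = if k == 0%N then 1%:M else th z i j ^+ k *: delta_mx 0 0.
    by case: k => [|k]; rewrite !mxE// mulr1.
  elim: k => [|k IH]; first by rewrite expr0 th1.
  rewrite exprS thM thu IH; case: k {IH} => [|k]; first by rewrite mulmx1 expr1.
  by rewrite /= -scalemxAl -scalemxAr mul_delta_mx scalerA -exprS.
have [|l hl] := @scalar_exists _ _ (fun z => th z 0 0).
  by move=> c x y; rewrite linearP !mxE.
have [m hm] := lattice_bounded lN l.
apply: contraT => /vgePn[c0 vc].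
have := hm _ (Np `|m|.+1); rewrite hl thp vgeE ?expf_neq0// placeX//.
move: (v _) vc => k; nia.
Qed.

Lemma frame_order_maximal th (g : 'M[L]_2) : frame th -> g \in unitmx ->
  lmaximal v (frame_order th g).
Proof.
move=> fth ug; have [th' [fth' e]] := frame_conj fth ug.
rewrite -[g]mulmx1 -(frame_order_conj ug (unitmx1 _ _) e) frame_order1.
exact: frame_order_maximal1.
Qed.

Lemma maximal_frame_order th M : frame th -> lmaximal v M ->
  exists2 g, g \in unitmx & M = frame_order th g.
Proof.
move=> fth [oM mM]; have [lM [M1 MM]] := oM; have sM := lattice_submod lM.
have [_ th1 thM] := fth.
pose d i : 'cV[L]_2 := delta_mx i 0.
(* La = M O^2 is a lattice stable under M, so M stabilizes it. *)
pose La : set 'cV[L]_2 := [set u | exists n1 n2,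
  [/\ M n1, M n2 & u = th n1 *m d 0 + th n2 *m d 1]].
have sLa : vsubmod v La.
  split; first by exists 0, 0; rewrite linear0 !mul0mx addr0; split=> //; exact: vsubmod0 sM.
  move=> c _ _ hc [n1 [n2 [h1 h2 ->]]] [m1 [m2 [k1 k2 ->]]].
  exists (c *: n1 + m1), (c *: n2 + m2); split; [exact: sM.2|exact: sM.2|].
  by rewrite !linearP !mulmxDl -!scalemxAl scalerDr addrACA.
have cE (u : 'cV[L]_2) : u = u 0 0 *: d 0 + u 1 0 *: d 1.
  by rewrite [LHS]matrix_sum_delta sum_ord2 !big_ord1.
have aLa : vabsorb La.
  move=> u; have [m hm] := vge_fin v (fun i => u i 0).
  exists (ppow v (- m)); first exact: ppow_neq0.
  exists ((ppow v (- m) * u 0 0)%:A), ((ppow v (- m) * u 1 0)%:A).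
  have hM i : M (ppow v (- m) * u i 0)%:A.
    by apply: (vsubmodZ sM) => //; rewrite vge_ppowM opprK add0r.
  split=> //; rewrite !linearZ /= th1 -!scalemxAl !mul1mx {1}(cE u) scalerDr.
  by rewrite !scalerA.
have bLa : vbounded v La.
  move=> l; have hd i : exists m, forall z, M z -> vge v m (l (th z *m d i)).
    have [|l' hl'] := @scalar_exists _ _ (fun z => l (th z *m d i)).
      by move=> c x y; rewrite linearP mulmxDl -scalemxAl linearP.
    by have [m hm] := lattice_bounded lM l'; exists m => z /hm; rewrite hl'.
  have [m0 h0] := hd 0; have [m1 h1] := hd 1.
  exists (Num.min m0 m1) => _ [n1 [n2 [k1 k2 ->]]]; rewrite linearD vgeD//.
    by apply: vgeW (h0 _ k1); rewrite ge_min lexx.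
  by apply: vgeW (h1 _ k2); rewrite ge_min lexx orbT.
have [s [ss fs Ls]] := bounded_submod_lattice sLa aLa bLa.
have dim2 : \dim {:'cV[L]_2} = 2%N by rewrite dimvf.
(* At most two generators by [bounded_submod_lattice], and at least two because they span the plane;
   so they form the square matrix [g]. *)
have s2 : size s = 2%N.
  by have := dim_span s; move: ss; rewrite fs dim2; lia.
pose g : 'M[L]_2 := \matrix_(i, j) s`_j i 0.
have inLa u : La u -> exists2 c : 'cV[L]_2, mxint v c & u = g *m c.
  rewrite Ls => -[c hc ->].
  exists (\col_i c (cast_ord (esym s2) i)); first by move=> i j; rewrite mxE.
  apply/colP => i; rewrite summxE mxE (reindex (cast_ord (esym s2))) /=.
    by apply: eq_bigr => j _; rewrite !mxE mulrC.
  by exists (cast_ord s2) => k _; rewrite ?cast_ordKV ?cast_ordK.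
have colmx (f : 'I_2 -> 'cV[L]_2) (P : 'cV[L]_2 -> Prop) :
    (forall j, exists2 c : 'cV[L]_2, P c & f j = g *m c) ->
    exists C : 'M[L]_2, (forall j, P (col j C)) /\ (\matrix_(i, j) f j i 0) = g *m C.
  move=> h; have /choice[c hc] j : exists c : 'cV[L]_2, P c /\ f j = g *m c.
    by have [c] := h j; exists c.
  exists (\matrix_(i, j) c j i 0); split=> [j|].
    have -> : col j (\matrix_(i, j0) c j0 i 0) = c j by apply/colP => i; rewrite !mxE.
    exact: (hc j).1.
  apply/matrixP => i j; rewrite mxE (hc j).2 !mxE; apply: eq_bigr => k _.
  by rewrite !mxE.
have ug : g \in unitmx.
  have [C [_ hC]] : exists C : 'M[L]_2,
      (forall j : 'I_2, True) /\ (\matrix_(i, j) d j i 0) = g *m C.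
    apply: (colmx d (fun=> True)) => j; have [c c0 /inLa[u _ hu]] := aLa (d j).
    by exists (c^-1 *: u) => //; rewrite -scalemxAr -hu scalerA mulVf// scale1r.
  have : g *m C = 1%:M.
    by rewrite -hC; apply/matrixP => i j; rewrite !mxE eqxx andbT.
  by case/mulmx1_unit.
exists g => //; apply: mM; first by have [] := frame_order_maximal fth ug.
move=> z Mz; rewrite /frame_order /=.
have [|C [hC eC]] := colmx (fun j => th z *m s`_j) (@mxint _ v _ _).
  move=> j; have : La s`_j by rewrite Ls; apply/mem_vspan/mem_nth; rewrite s2.
  move=> [n1 [n2 [h1 h2 ->]]]; apply: inLa; exists (z * n1), (z * n2).
  by rewrite !thM mulmxDr !mulmxA; split=> //; exact: MM.
have -> : invmx g *m th z *m g = C.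
  rewrite -mulmxA (_ : th z *m g = g *m C) ?mulKmx// -eC.
  by apply/matrixP => i j; rewrite !mxE; apply: eq_bigr => k _; rewrite mxE.
by move=> i j; have := hC j i 0; rewrite mxE.
Qed.

End FrameOrders.

(** * Vertices of the tree *)

Section Tree.
Variables (L : fieldType) (v : place L).
Local Notation pp := (ppow v).

(* The stabilizer of the lattice spanned by the columns of mx2 1 0 x (pi^r),
   that is, the vertex of the ball x + pi^r O of the projective line. *)
Definition vertex (x : L) (r : int) : set 'M[L]_2 := [set w |
  [/\ vge v 0 (w 0 0 + w 0 1 * x), vge v 0 (w 1 1 - w 0 1 * x), vge v (- r) (w 0 1)
    & vge v r (w 1 0 + (w 1 1 - w 0 0) * x - w 0 1 * x * x)]].

Lemma vertex0P r (w : 'M[L]_2) : vertex 0 r w <->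
  [/\ vge v 0 (w 0 0), vge v 0 (w 1 1), vge v (- r) (w 0 1) & vge v r (w 1 0)].
Proof. by rewrite /vertex /= !mulr0 !addr0 !subr0. Qed.

Lemma hermite_unit x r : mx2 1 0 x (pp r) \in unitmx.
Proof. by rewrite mx2_unit mul1r mul0r subr0 ppow_neq0. Qed.

Lemma frame_order_vertex (B : falgType L) (th : {linear B -> 'M[L]_2}) x r :
  frame_order v th (mx2 1 0 x (pp r)) = [set z | vertex x r (th z)].
Proof.
have p0 := ppow_neq0 v r.
have e : invmx (mx2 1 0 x (pp r)) = mx2 1 0 (- x / pp r) (pp r)^-1.
  rewrite -[RHS](mulKmx (hermite_unit x r)) mx2M.
  rewrite -[X in _ *m X](_ : 1%:M = _) ?mulmx1//.
  by rewrite mx2_scalar; congr mx2; field.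
have main w : mxint v (invmx (mx2 1 0 x (pp r)) *m w *m mx2 1 0 x (pp r)) <-> vertex x r w.
  rewrite e (mx2_eta w) !mx2M /vertex /= !mx2E.
  move: (w 0 0) (w 0 1) (w 1 0) (w 1 1) => a b c d.
  set m := mx2 _ _ _ _.
  have m0 : m 0 0 = a + b * x by rewrite mx2E; ring.
  have m1 : m 0 1 = pp r * b by rewrite mx2E; ring.
  have m2 : m 1 0 = (pp r)^-1 * (c + (d - a) * x - b * x * x) by rewrite mx2E; field.
  have m3 : m 1 1 = d - b * x by rewrite mx2E; field.
  have pV : v (pp r)^-1 = - r by rewrite placeV place_ppow.
  split=> [h|[h1 h2 h3 h4]].
    split; [by rewrite -m0|by rewrite -m3| |].
      by have := h 0 1; rewrite m1 vge_ppowM sub0r.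
    by have := h 1 0; rewrite m2 vgeMl ?invr_neq0// pV sub0r opprK.
  apply: ord2P; apply: ord2P; rewrite ?m0 ?m1 ?m2 ?m3//.
    by rewrite vge_ppowM sub0r.
  by rewrite vgeMl ?invr_neq0// pV sub0r opprK.
by apply/seteqP; split=> z /main.
Qed.

(* A vertex within distance l of both ends of the path 0, .., l branches off
   at v x, at distance r - v x from the path. *)
Lemma vertex_branch x r (l : nat) :
  (forall w, vertex x r w -> vertex 0 0 (pp l *: w)) ->
  (forall w, vertex x r w -> vertex 0 l (pp l *: w)) ->
  exists k : nat, (2 * k <= l)%N /\ forall w, vertex 0 0 w -> vertex 0 l w ->
    (vertex x r w <-> vge v k (w 0 0 - w 1 1)).
Proof.
move=> h1 h2; have p0 := ppow_neq0 v r; have pl := ppow_neq0 v l; set y := pp r in p0.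
have vy : v y = r by rewrite /y place_ppow.
(* [v12], [v21] and [v11] are three matrix units conjugated by [mx2 1 0 x y]. Fed to the two
   distance hypotheses, their entries give 0 <= r <= l, x integral and x^2 in pi^r O. *)
have v12 : vertex x r (mx2 (- x / y) (1 / y) (- x * x / y) (x / y)).
  rewrite /vertex /= !mx2E; split.
  - by rewrite [X in vge _ _ X](_ : _ = 0) ?vge0//; field.
  - by rewrite [X in vge _ _ X](_ : _ = 0) ?vge0//; field.
  - by apply: vge_val; rewrite div1r placeV vy.
  - by rewrite [X in vge _ _ X](_ : _ = 0) ?vge0//; field.
have v21 : vertex x r (mx2 0 0 y 0).
  rewrite /vertex /= !mx2E !mul0r subrr mul0r !addr0 !subr0 !vge0; split=> //.
  exact: vge_val.
have v11 : vertex x r (mx2 1 0 x 0).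
  rewrite /vertex /= !mx2E !mul0r addr0 subr0 vge0 vge1; split=> //; rewrite ?vge0//.
  by rewrite [X in vge _ _ X](_ : _ = 0) ?vge0//; ring.
have rl : r <= l.
  have /vertex0P[_ _ + _] := h1 _ v12.
  rewrite mx2Z mx2E vge_ppowM div1r vgeE ?invr_neq0// placeV vy; lia.
have r0 : 0 <= r.
  have /vertex0P[_ _ _] := h2 _ v21; rewrite mx2Z mx2E vge_ppowM vgeE// vy; lia.
have x0 : vge v 0 x.
  by have /vertex0P[_ _ _] := h2 _ v11; rewrite mx2Z mx2E vge_ppowM subrr.
have xx : vge v r (x * x).
  have /vertex0P[_ _ _ h] := h2 _ v12; move: h; rewrite mx2Z mx2E vge_ppowM subrr.
  have -> : - x * x / y = y^-1 * - (x * x) by ring.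
  by rewrite [vge v 0 _]vgeMl ?invr_neq0// placeV vy sub0r opprK vgeN.
(* For w in both ends, the terms w 1 0 and w 0 1 * x^2 already lie in pi^r O, so only the diagonal
   difference is constrained. *)
have key w : vertex 0 0 w -> vertex 0 l w ->
    (vertex x r w <-> vge v r (x * (w 0 0 - w 1 1))).
  move=> /vertex0P[a0 d0 b0 _] /vertex0P[_ _ _ cl]; rewrite oppr0 in b0.
  have h : vge v r (w 1 0 - w 0 1 * (x * x)).
    by apply: vgeB; [apply: vgeW cl|apply: vgeM0].
  split=> [[_ _ _ h']|h'].
    have -> : x * (w 0 0 - w 1 1) = (w 1 0 - w 0 1 * (x * x)) -
       (w 1 0 + (w 1 1 - w 0 0) * x - w 0 1 * x * x) by ring.
    exact: vgeB.
  split.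
  - by apply: vgeD => //; apply: vgeM0.
  - by apply: vgeB => //; apply: vgeM0.
  - by apply: vgeW b0; lia.
  - have -> : w 1 0 + (w 1 1 - w 0 0) * x - w 0 1 * x * x =
      (w 1 0 - w 0 1 * (x * x)) - x * (w 0 0 - w 1 1) by ring.
    exact: vgeB.
have [xr|/vgePn[xn0 xr]] := boolP (vge v r x).
  exists 0%N; split=> // w hw0 hwl; rewrite key//.
  have /vertex0P[a0 d0 _ _] := hw0; have ad : vge v 0 (w 0 0 - w 1 1) by apply: vgeB.
  by split=> // _; rewrite mulrC; apply: vgeM0.
have vx : 0 <= v x by rewrite -vgeE.
have vxx : r <= v x + v x by rewrite -placeM// -vgeE// mulf_neq0.
(* 2 (r - v x) <= r <= l, by r <= 2 v x. *)
exists `|r - v x|%N; split; first lia.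
move=> w hw0 hwl; rewrite key// vgeMl//.
by have -> : `|r - v x|%N = r - v x :> int by lia.
Qed.

(** The path from a to b, a <= b, has the Eichler order with integral diagonal, upper entry in pi^-a
    O and lower entry in pi^b O. For a = k and b = l - k, multiplication by pi^k turns these bounds
    into those of 0 and l. The scalar is w 1 1, so y gets a zero corner. *)
Lemma thick_path (k l : nat) (w : 'M[L]_2) : (2 * k <= l)%N ->
  [/\ vertex 0 0 w, vertex 0 l w & vge v k (w 0 0 - w 1 1)] <->
  exists c y, [/\ vge v 0 c, vertex 0 k y, vertex 0 (l%:Z - k%:Z) y & w = c%:M + pp k *: y].
Proof.
move=> kl; have pk := ppow_neq0 v k; split.
  move=> [/vertex0P[a0 d0 b0 _] /vertex0P[_ _ _ cl] ad]; rewrite oppr0 in b0.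
  exists (w 1 1), (mx2 ((pp k)^-1 * (w 0 0 - w 1 1)) ((pp k)^-1 * w 0 1) ((pp k)^-1 * w 1 0) 0).
  have pV n a : vge v n ((pp k)^-1 * a) = vge v (n + k%:Z) a.
    by rewrite vgeMl ?invr_neq0// placeV place_ppow opprK.
  split=> //.
  - apply/vertex0P; rewrite !mx2E !pV add0r vge0 addNr; split=> //.
    by apply: vgeW cl; lia.
  - apply/vertex0P; rewrite !mx2E !pV add0r vge0 subrK; split=> //.
    by apply: vgeW b0; lia.
  - rewrite {1}(mx2_eta w) mx2_scalar mx2Z mx2D; congr mx2; rewrite ?mulVKf//; ring.
move=> [c [y [hc /vertex0P[a0 d0 b0 c0] /vertex0P[_ _ b1 c1] ->]]].
have pM n a : vge v n (pp k * a) = vge v (n - k%:Z) a by rewrite vge_ppowM.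
rewrite (mx2_eta y) mx2_scalar mx2Z mx2D.
have hk a : vge v 0 a -> vge v 0 (c + pp k * a).
  by move=> ha; apply: vgeD => //; rewrite pM; apply: vgeW ha; lia.
split.
- apply/vertex0P; rewrite !mx2E !add0r !pM oppr0 sub0r; split; rewrite ?hk//.
  by apply: vgeW c0; lia.
- apply/vertex0P; rewrite !mx2E !add0r !pM; split; rewrite ?hk//.
  by apply: vgeW b0; lia.
- rewrite !mx2E opprD addrACA subrr add0r -mulrBr pM subrr; exact: vgeB.
Qed.

(** The ball 1 + pi^k O branches off at the vertex 0, at distance k. The ends -k and l + k put both
    off-diagonal entries in pi^k O, so its last condition reduces to w 0 0 = w 1 1 mod pi^k. *)
Lemma three_vertices (k l : nat) (w : 'M[L]_2) :
  (exists c y, [/\ vge v 0 c, vertex 0 0 y, vertex 0 l y & w = c%:M + pp k *: y]) <->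
  [/\ vertex 0 (- k%:Z) w, vertex 0 (l%:Z + k%:Z) w & vertex 1 k w].
Proof.
have pk := ppow_neq0 v k; split.
  move=> [c [y [hc /vertex0P[a0 d0 b0 _] /vertex0P[_ _ _ cl] ->]]]; rewrite oppr0 in b0.
  have pM n a : vge v n (pp k * a) = vge v (n - k%:Z) a by rewrite vge_ppowM.
  rewrite (mx2_eta y) mx2_scalar mx2Z mx2D.
  have hk a : vge v 0 a -> vge v 0 (c + pp k * a).
    by move=> ha; apply: vgeD => //; rewrite pM; apply: vgeW ha; lia.
  split.
  - apply/vertex0P; rewrite !mx2E !add0r !pM opprK subrr; split; rewrite ?hk//.
    by apply: vgeW cl; lia.
  - apply/vertex0P; rewrite !mx2E !add0r !pM addrK; split; rewrite ?hk//.
    by apply: vgeW b0; lia.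
  - rewrite /vertex /= !mx2E !add0r !mulr1; split.
    + by apply: vgeD; rewrite ?hk// pM; apply: vgeW b0; lia.
    + by apply: vgeB; rewrite ?hk// pM; apply: vgeW b0; lia.
    + by rewrite pM; apply: vgeW b0; lia.
    + have -> : pp k * y 1 0 + (c + pp k * y 1 1 - (c + pp k * y 0 0)) - pp k * y 0 1 =
        pp k * (y 1 0 + (y 1 1 - y 0 0) - y 0 1) by ring.
      rewrite pM subrr; apply: vgeB => //; apply: vgeD; last exact: vgeB.
      by apply: vgeW cl; lia.
move=> [/vertex0P[a0 d0 b0 _] /vertex0P[_ _ _ cl] [_ _ _ h]]; rewrite opprK in b0.
have pV n a : vge v n ((pp k)^-1 * a) = vge v (n + k%:Z) a.
  by rewrite vgeMl ?invr_neq0// placeV place_ppow opprK.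
exists (w 1 1), (mx2 ((pp k)^-1 * (w 0 0 - w 1 1)) ((pp k)^-1 * w 0 1) ((pp k)^-1 * w 1 0) 0).
have ad : vge v k (w 0 0 - w 1 1).
  have -> : w 0 0 - w 1 1 = w 1 0 - w 0 1 - (w 1 0 + (w 1 1 - w 0 0) * 1 - w 0 1 * 1 * 1) by ring.
  by apply: vgeB => //; apply: vgeB => //; apply: vgeW cl; lia.
split=> //.
- apply/vertex0P; rewrite !mx2E !pV oppr0 !add0r vge0; split=> //.
  by apply: vgeW cl; lia.
- apply/vertex0P; rewrite !mx2E !pV add0r vge0; split=> //.
  by apply: vgeW b0; lia.
- rewrite {1}(mx2_eta w) mx2_scalar mx2Z mx2D; congr mx2; rewrite ?mulVKf//; ring.
Qed.

End Tree.

(** * The local equivalence in a split algebra *)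

Section LocalIntersections.
Variables (L : fieldType) (v : place L) (B : falgType L).
Local Notation pp := (ppow v).

Lemma vertex_maximal (th : {linear B -> 'M[L]_2}) x r : frame th ->
  lmaximal v [set z | vertex v x r (th z)].
Proof.
by move=> fth; rewrite -frame_order_vertex; apply: frame_order_maximal => //; exact: hermite_unit.
Qed.

Lemma maximal_vertex (th : {linear B -> 'M[L]_2}) M : frame th -> lmaximal v M ->
  exists x r, M = [set z | vertex v x r (th z)].
Proof.
move=> fth mM; have [g ug ->] := maximal_frame_order fth mM.
have [c [x [r [q [c0 hq gE]]]]] := hermite_form v ug.
exists x, r; rewrite -frame_order_vertex gE frame_orderM ?frame_orderZ ?hermite_unit//.
by rewrite unitmxZ ?unitfE// hermite_unit.
Qed.

(** The Smith form p diag(1, pi^l) q of the matrix relating the two lattices: g1 p is a common basis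
    adapted to both, and q and the scalar leave the second stabilizer unchanged. *)
Lemma maximal_pair (th : {linear B -> 'M[L]_2}) M1 M2 : frame th ->
  lmaximal v M1 -> lmaximal v M2 ->
  exists (l : nat) (th' : {linear B -> 'M[L]_2}), [/\ frame th',
    M1 = [set z | vertex v 0 0 (th' z)] & M2 = [set z | vertex v 0 l (th' z)]].
Proof.
move=> fth mM1 mM2; have [g1 u1 ->] := maximal_frame_order fth mM1.
have [g2 u2 ->] := maximal_frame_order fth mM2.
have u12 : invmx g1 *m g2 \in unitmx by rewrite unitmx_mul unitmx_inv u1.
have [c [l [p [q [c0 hp hq gE]]]]] := smith_form v u12.
have up : p \in unitmx by case: hp.
have uh : g1 *m p \in unitmx by rewrite unitmx_mul u1.
have [th' [fth' e]] := frame_conj fth uh.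
exists l, th'; split=> //; rewrite -frame_order_vertex.
  (* [pp 0] is only known to be a unit, so it is absorbed as an integral base change. *)
  have hd : glint v (mx2 1 0 0 (pp 0)) by apply: glint_diag; rewrite ?ppow_neq0 ?place_ppow.
  rewrite -[mx2 _ _ _ _]mul1mx frame_orderM ?unitmx1//.
  by rewrite (frame_order_conj v uh (unitmx1 _ _) e) mulmx1 frame_orderM.
rewrite (frame_order_conj v uh (hermite_unit v 0 l) e).
have -> : g2 = c *: (g1 *m p *m mx2 1 0 0 (pp l) *m q).
  by rewrite -[LHS](mulKVmx u1) gE -scalemxAr !mulmxA.
have u : g1 *m p *m mx2 1 0 0 (pp l) \in unitmx by rewrite unitmx_mul uh hermite_unit.
rewrite frame_orderZ ?(frame_orderM _ u hq)//.
by case: hq => uq _ _; rewrite unitmx_mul u.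
Qed.

Lemma frame_decomposition (th : {linear B -> 'M[L]_2}) (k : nat) (P : set 'M[L]_2) z :
  frame th ->
  (exists c y, [/\ vge v 0 c, P y & th z = c%:M + pp k *: y]) <->
  (exists c y, [/\ vge v 0 c, P (th y) & z = c%:A + pp k *: y]).
Proof.
move=> fth; have [ph [phK thK]] := frame_inv fth; have [_ th1 _] := fth.
have e c y : th (c%:A + pp k *: y) = c%:M + pp k *: th y.
  by rewrite linearD !linearZ /= th1 scalemx1.
split=> [[c [y [hc hy zE]]]|[c [y [hc hy ->]]]]; last by exists c, (th y).
by exists c, (ph y); split; rewrite ?phK//; apply: (can_inj thK); rewrite e phK.
Qed.

Lemma intersection_thick_path (th : {linear B -> 'M[L]_2}) n (M : 'I_n.+1 -> set B) :
  frame th -> (forall i, lmaximal v (M i)) ->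
  exists N1 N2 (k : nat), [/\ lmaximal v N1, lmaximal v N2 &
    forall z, (forall i, M i z) <->
      exists c y, [/\ vge v 0 c, N1 y /\ N2 y & z = c%:A + pp k *: y]].
Proof.
move=> fth mM.
have /choice[l hl] : forall ij : 'I_n.+1 * 'I_n.+1, exists l : nat,
    exists th' : {linear B -> 'M[L]_2}, [/\ frame th',
      M ij.1 = [set z | vertex v 0 0 (th' z)] & M ij.2 = [set z | vertex v 0 l (th' z)]].
  by move=> ij; exact: (maximal_pair fth).
have [[i0 j0] _ lmax] := @arg_maxnP _ (ord0, ord0) xpredT l isT.
(* Distance as an inclusion of orders: with l maximal at (i0, j0), it supplies the hypotheses of
   [vertex_branch] for every vertex of the family. *)
have dist (m : nat) i j z : (l (i, j) <= m)%N -> M j z -> M i (pp m *: z).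
  have [th' [_ /= -> ->]] := hl (i, j) => lm.
  rewrite /= linearZ => /vertex0P[a0 d0 b0 c0]; apply/vertex0P; rewrite !mxE !vge_ppowM.
  by split; [apply: vgeW a0|apply: vgeW d0|apply: vgeW b0|apply: vgeW c0]; lia.
have [th' [fth' /= Mi Mj]] := hl (i0, j0); set l0 := l (i0, j0) in lmax Mj.
have [ph [phK thK]] := frame_inv fth'.
have /choice[k hk] : forall m, exists k : nat, (2 * k <= l0)%N /\
    forall z, M i0 z -> M j0 z -> (M m z <-> vge v k (th' z 0 0 - th' z 1 1)).
  move=> m; have [x [r Mm]] := maximal_vertex fth' (mM m).
  have [||k [kl hk]] := @vertex_branch _ v x r l0.
  - move=> w hw; have : M m (ph w) by rewrite Mm /= phK.
    by move=> /(dist l0 i0 m _ (lmax (i0, m) isT)); rewrite Mi /= linearZ phK.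
  - move=> w hw; have : M m (ph w) by rewrite Mm /= phK.
    by move=> /(dist l0 j0 m _ (lmax (j0, m) isT)); rewrite Mj /= linearZ phK.
  by exists k; split=> // z; rewrite Mi Mj Mm; exact: hk.
pose K := \max_i k i; have Kl : (2 * K <= l0)%N.
  have : (K <= l0 %/ 2)%N by apply/bigmax_leqP => i _; have [h _] := hk i; lia.
  lia.
exists [set z | vertex v 0 K (th' z)], [set z | vertex v 0 (l0%:Z - K%:Z) (th' z)], K.
split; [exact: vertex_maximal|exact: vertex_maximal|move=> z].
have := frame_decomposition K [set w | vertex v 0 K w /\ vertex v 0 (l0%:Z - K%:Z) w] z fth'.
move=> /= <-.
have := thick_path v (th' z) Kl => h; split.
  move=> Mz; have [|c [y [hc y1 y2 e]]] := h.1; last by exists c, y.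
  split; [by have := Mz i0; rewrite Mi|by have := Mz j0; rewrite Mj|].
  (* The maximum K is attained at some vertex m, whose condition is the strongest congruence. *)
  have [|m Km] := @bigop.eq_bigmax _ k; first by rewrite card_ord.
  by rewrite /K Km; apply/((hk m).2 _ (Mz i0) (Mz j0)).
move=> [c [y [hc [y1 y2] e]]]; have [] := h.2; first by exists c, y.
move=> v0 vl vK m; have [_ hm] := hk m; apply/hm; rewrite ?Mi ?Mj//.
by apply: vgeW vK; rewrite lez_nat; exact: leq_bigmax.
Qed.

Lemma thick_path_intersection (th : {linear B -> 'M[L]_2}) M1 M2 (k : nat) : frame th ->
  lmaximal v M1 -> lmaximal v M2 ->
  exists N1 N2 N3 : set B, [/\ lmaximal v N1, lmaximal v N2, lmaximal v N3 &
    forall z, (exists c y, [/\ vge v 0 c, M1 y /\ M2 y & z = c%:A + pp k *: y]) <->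
      [/\ N1 z, N2 z & N3 z]].
Proof.
move=> fth mM1 mM2; have [l [th' [fth' -> ->]]] := maximal_pair fth mM1 mM2.
exists [set z | vertex v 0 (- k%:Z) (th' z)], [set z | vertex v 0 (l%:Z + k%:Z) (th' z)],
  [set z | vertex v 1 k (th' z)].
split; [exact: vertex_maximal|exact: vertex_maximal|exact: vertex_maximal|move=> z].
have := frame_decomposition k [set w | vertex v 0 0 w /\ vertex v 0 l w] z fth'.
move=> /= <-; have /= <- := three_vertices v k l (th' z).
by split=> -[c [y]]; [move=> [hc [y1 y2] e]|move=> [hc y1 y2 e]]; exists c, y.
Qed.

End LocalIntersections.

(** * Finiteness of the places where an element is not a unit *)

Lemma infinite_enum (T : Type) (A : set T) : ~ finite_set A ->
  exists F : nat -> T, injective F /\ forall i, A (F i).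
Proof.
move=> /infiniteP/card_leP[f].
pose g (i : nat) : [set: nat] := SigSub (mem_set (I : [set: nat] i)).
exists (fun i => val (f (g i))); split=> [i j /val_inj|i]; last exact: set_valP.
by move=> /('inj_f)-/(_ (mem_set I) (mem_set I)) /(congr1 val).
Qed.

Section Approximation.
Variable L : fieldType.
Implicit Types v w : place L.

Lemma place_ext v w : (forall x, v x = w x) -> v = w.
Proof.
case: v w => [v v0 vM vD vu] [w w0 wM wD wu] /= /funext e; subst w.
by congr Place; exact: Prop_irrelevance.
Qed.

(** Otherwise the ring of v lies in that of w, units of v are units of w, and w is a multiple of v;
    both being normalized, they are equal. *)
Lemma place_neq v w : v <> w -> exists a, [/\ a != 0, 0 <= v a & w a < 0].
Proof.
move=> vw; apply: contrapT => h.
have h0 a : a != 0 -> 0 <= v a -> 0 <= w a.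
  by move=> a0 va; rewrite leNgt; apply/negP => wa; apply: h; exists a.
have hu a : a != 0 -> v a = 0 -> w a = 0.
  move=> a0 va; apply/eqP; rewrite eq_le h0 ?va//= andbT.
  by have := h0 a^-1; rewrite invr_neq0// !placeV va oppr0 oppr_ge0 lexx; apply.
have wE a : a != 0 -> w a = v a * w (ppow v 1).
  move=> a0; have p0 := ppow_neq0 v; have e r : w (ppow v r) = r * w (ppow v 1).
    have en (m : nat) : w (ppow v m) = m%:Z * w (ppow v 1).
      rewrite -placeX//; apply/eqP; rewrite -subr_eq0; apply/eqP.
      have q0 : ppow v m / ppow v 1 ^+ m != 0 by rewrite mulf_neq0 ?invr_neq0 ?expf_neq0.
      have := hu _ q0; rewrite !placeM ?invr_neq0 ?expf_neq0// !placeV placeX// !place_ppow.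
      by apply; lia.
    case: r => [m|m]; first exact: en.
    have := en m.+1; have q0 : ppow v (Negz m) * ppow v m.+1 != 0 by rewrite mulf_neq0.
    have := hu _ q0; rewrite !placeM// !place_ppow NegzE => /(_ _); lia.
  have q0 : a / ppow v (v a) != 0 by rewrite mulf_neq0 ?invr_neq0.
  have := hu _ q0; rewrite !placeM ?invr_neq0// !placeV place_ppow subrr e => /(_ erefl); lia.
have wp : 0 <= w (ppow v 1) by apply: h0; rewrite ?ppow_neq0// place_ppow.
have [y y0 wy] := place_uniformizer w; have := wE y y0; rewrite wy => e.
have w1 : w (ppow v 1) = 1.
  move: (w (ppow v 1)) (v y) wp e => p q p0 e.
  have q1 : 1 <= q by rewrite leNgt; apply/negP => q0; nia.
  by apply/eqP; rewrite eq_le; apply/andP; split; rewrite leNgt; apply/negP => h1; nia.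
apply: vw; apply: place_ext => x; have [->|x0] := eqVneq x 0; first by rewrite !place0.
by rewrite (wE x x0) w1 mulr1.
Qed.

Lemma place_separate v w : v <> w -> exists a, [/\ a != 0, 0 < v a & w a < 0].
Proof.
move=> vw; have [a [a0 va wa]] := place_neq vw.
have [b [b0 wb vb]] := place_neq (fun e => vw (esym e)).
exists (a / b); rewrite mulf_neq0 ?invr_neq0// !placeM ?invr_neq0// !placeV.
by split=> //; lia.
Qed.

(** If the old x fails at the new place, y separating v from it is corrected to y + x^M: there y
    dominates, while for M larger than all [|w i y|] the power dominates at the old places. *)
Lemma place_separate_seq v (w : nat -> place L) m : (forall i, (i < m)%N -> v <> w i) ->
  exists a, [/\ a != 0, 0 < v a & forall i, (i < m)%N -> w i a < 0].
Proof.
elim: m => [_|m IH h].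
  by have [x x0 vx] := place_uniformizer v; exists x; rewrite vx.
have [x [x0 vx wx]] := IH (fun i im => h i (ltnW im)).
have [wmx|wmx] := ltP (w m x) 0.
  exists x; split=> // i; rewrite ltnS leq_eqVlt => /predU1P[->//|]; exact: wx.
have [y [y0 vy wy]] := place_separate (h m (leqnn _)).
have [N hN] : exists N : nat, forall i, (i < m)%N -> (`|w i y| < N)%N.
  elim: (m) => [|k [N hN]]; first by exists 0%N.
  exists (maxn N `|w k y|.+1) => i; rewrite ltnS leq_eqVlt leq_max => /predU1P[->|/hN->//].
  by rewrite ltnSn orbT.
pose M := N.+1; have xM0 : x ^+ M != 0 by rewrite expf_neq0.
have [s0 sm] : y + x ^+ M != 0 /\ w m (y + x ^+ M) = w m y.
  by apply: (@place_eq _ _ _ _ 0) => //; rewrite vgeE// placeX//; lia.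
exists (y + x ^+ M); split=> //.
  have : vge v 1 (y + x ^+ M) by apply: vgeD; rewrite vgeE// placeX//; rewrite /M; lia.
  by rewrite vgeE//; lia.
move=> i; rewrite ltnS leq_eqVlt => /predU1P[->|im]; first by rewrite sm.
have wxi := wx _ im; have lt : w i (x ^+ M) < w i y.
  by rewrite placeX// /M; have := hN _ im; nia.
have [_ e] : x ^+ M + y != 0 /\ w i (x ^+ M + y) = w i (x ^+ M).
  by apply: (@place_eq _ _ _ _ (w i y)) => //; exact: vge_val.
by rewrite addrC e placeX// /M; nia.
Qed.

(** 1 / (1 + x) is close to 1 where x is small and small where x has a pole. *)
Lemma place_isolate v (w : nat -> place L) m : (forall i, (i < m)%N -> v <> w i) ->
  exists a, [/\ a != 0, v a = 0 & forall i, (i < m)%N -> 0 < w i a].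
Proof.
move=> /place_separate_seq[x [x0 vx wx]].
have [s0 vs] : 1 + x != 0 /\ v (1 + x) = v 1.
  by apply: (@place_eq _ _ _ _ 1); rewrite ?oner_neq0 ?place1// vgeE.
exists (1 + x)^-1; split=> [||i /wx wi]; first by rewrite invr_neq0.
  by rewrite placeV vs place1 oppr0.
have [_] : x + 1 != 0 /\ w i (x + 1) = w i x.
  by apply: (@place_eq _ _ _ _ 0) => //; exact: vge1.
by rewrite placeV addrC => ->; lia.
Qed.

Lemma sum_min_neq0 v (I : finType) (F : I -> L) i : F i != 0 ->
  (forall j, j != i -> vge v (v (F i) + 1) (F j)) -> \sum_j F j != 0.
Proof.
move=> Fi h; rewrite (bigD1 i)//=.
have hs : vge v (v (F i) + 1) (\sum_(j | j != i) F j) by exact: vge_sum.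
by have [] := place_eq Fi (_ : v (F i) < v (F i) + 1) hs; first lia.
Qed.

End Approximation.

(** * Places of a finite extension *)

Section FiniteExtension.
Variables (k : fieldType) (L : fieldExtType k).
Implicit Types v w : place L.

(** Lying over one place of k is expressed by equal valuation rings on k, which avoids restricting a
    place and renormalizing it. *)
Lemma finite_places_above (A : set (place L)) :
  (forall v w c, A v -> A w -> vge v 0 (c%:A : L) -> vge w 0 (c%:A : L)) -> finite_set A.
Proof.
move=> hA; apply: contrapT => /infinite_enum[F [Finj AF]].
pose n := \dim {:L}.
have /choice[e he] : forall i : 'I_n.+1, exists a : L,
    [/\ a != 0, F i a = 0 & forall j : 'I_n.+1, j != i -> 0 < F j a].
  move=> i; have [|a [a0 va wa]] := @place_isolate _ (F i) (F \o bump i) n.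
    by move=> j _ /Finj/eqP; rewrite (negPf (neq_bump _ _)).
  exists a; split=> // j; rewrite eq_sym => /unlift_some[j' -> _]; exact: wa.
have [c [c0 [i0 ci0]]] : exists c : 'I_n.+1 -> k, \sum_i c i *: e i = 0 /\ exists i, c i != 0.
  have : ~~ free [tuple e i | i < n.+1].
    apply/negP => /eqP f; have := dimvS (subvf <<[tuple e i | i < n.+1]>>).
    by rewrite f size_tuple ltnn.
  move=> /freeP h; apply: contrapT => h'; apply: h => c c0 i.
  apply: contrapT => /eqP ci; apply: h'; exists c; split; last by exists i.
  by rewrite -[RHS]c0; apply: eq_bigr => j _; rewrite -tnth_nth tnth_mktuple.
(* Dividing by the coefficient of least valuation makes all coefficients integral at [F 0%N], hence
   by [hA] at [F i]. There the i-th term has valuation 0 and the others are positive, so the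
   relation cannot hold. *)
have [i ci imin] := @arg_minP _ _ _ i0 (fun i => c i != 0) (fun i => F 0%N ((c i)%:A : L)) ci0.
have cA (a : k) : a != 0 -> a%:A != 0 :> L by move=> a0; rewrite scaler_eq0 negb_or a0 oner_neq0.
have sum0 : \sum_j (c j / c i)%:A * e j = 0.
  have E j : (c j / c i)%:A * e j = (c i)^-1 *: (c j *: e j).
    by rewrite mulr_algl scalerA mulrC.
  by rewrite (eq_bigr _ (fun j _ => E j)) -scaler_sumr c0 scaler0.
have [ei vei eij] := he i.
have e1 : (c i / c i)%:A * e i = e i by rewrite divff// scale1r mul1r.
have /negP : \sum_j (c j / c i)%:A * e j != 0; last by rewrite sum0 eqxx.
apply: (@sum_min_neq0 _ (F i) _ _ i); rewrite e1// vei add0r => j ji.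
have [->|cj] := eqVneq (c j) 0; first by rewrite mul0r scale0r mul0r vge0.
have [ej0 _ eji] := he j; have e1j : vge (F i) 1 (e j) by rewrite vgeE// -gtz0_ge1 eji// eq_sym.
apply: vgeM0 => //; apply: (hA (F 0%N)) => //.
have -> : (c j / c i)%:A = (c j)%:A * (c i)%:A^-1 :> L.
  by apply: (canRL (mulfK (cA _ ci))); rewrite mulr_algl scalerA divfK.
rewrite vgeE ?mulf_neq0 ?invr_neq0 ?cA// placeM ?invr_neq0 ?cA// placeV subr_ge0.
exact: imin.
Qed.

(** If all nonzero coefficients were units at v, the terms would have the distinct valuations i * v
    x and could not cancel. This moves the finiteness question from L to k. *)
Lemma place_coef_neq0 v (x : L) (c : 'I_(\dim {:L}).+1 -> k) :
  x != 0 -> \sum_i c i *: x ^+ i = 0 -> (exists i, c i != 0) -> v x != 0 ->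
  exists2 i, c i != 0 & v ((c i)%:A : L) != 0.
Proof.
move=> x0 sc [i0 ci0] vx; apply: contrapT => h.
have vc i : c i != 0 -> v ((c i)%:A : L) = 0.
  by move=> ci; apply: contrapT => /eqP vci; apply: h; exists i.
have cA (a : k) : a != 0 -> a%:A != 0 :> L by move=> a0; rewrite scaler_eq0 negb_or a0 oner_neq0.
have [i ci imin] := @arg_minP _ _ _ i0 (fun i => c i != 0) (fun i => i%:Z * v x) ci0.
have vt j : c j != 0 -> v (c j *: x ^+ j) = j%:Z * v x.
  by move=> cj; rewrite -mulr_algl placeM ?expf_neq0 ?cA// vc// placeX// add0r.
have t0 j : c j != 0 -> c j *: x ^+ j != 0.
  by move=> cj; rewrite scaler_eq0 negb_or cj expf_neq0.
have /negP : \sum_j c j *: x ^+ j != 0; last by rewrite sc eqxx.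
apply: (@sum_min_neq0 _ v _ _ i); first exact: t0.
move=> j ji; have [->|cj] := eqVneq (c j) 0; first by rewrite scale0r vge0.
rewrite vgeE ?t0// !vt//; have := imin j cj; rewrite le_eqVlt => /predU1P[|]; last lia.
by move=> /(mulIf vx) [] /esym/val_inj e; rewrite e eqxx in ji.
Qed.

Section Residues.
Variables (R : comNzRingType) (phi : {rmorphism R -> k}).

Let phiA x y : (phi (x * y))%:A = (phi x)%:A * (phi y)%:A :> L.
Proof. by rewrite rmorphM mulr_algl scalerA. Qed.

(* Such a place v is determined over k by the residues mod m of its prime,
   as every element of k is a quotient of coprime elements of R. *)
Lemma finite_places_pos (T : finType) (rep : T -> R) (m : R) :
  (forall r, exists t q, r = rep t + m * q) ->
  (forall c : k, exists a b u s, c * phi b = phi a /\ u * a + s * b = 1) ->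
  finite_set [set v : place L | (forall r, vge v 0 ((phi r)%:A : L)) /\ vge v 1 ((phi m)%:A : L)].
Proof.
move=> hT hc; set V := [set v | _].
pose P v r := vge v 1 ((phi r)%:A : L).
(* The residues mod m lying in the prime of v. Only finitely many values are possible, so it
   suffices that each fiber is finite. *)
pose g v : {set T} := [set t | P v (rep t)]%SET.
have fib (G : {set T}) : finite_set [set v | V v /\ g v = G].
  apply: finite_places_above => v w c [[vR vm] gv] [[wR wm] gw] vc.
  have Prep u r t q : V u -> r = rep t + m * q -> P u r = P u (rep t).
    move=> [uR um] ->; have h : P u (m * q).
      by rewrite /P phiA mulrC; apply: vgeM0.
    apply/idP/idP => [h'|h']; rewrite /P.
      have -> : (phi (rep t))%:A = (phi (rep t + m * q))%:A - (phi (m * q))%:A :> L.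
        by rewrite rmorphD scalerDl addrK.
      exact: vgeB.
    by rewrite rmorphD scalerDl; apply: vgeD.
  have Pvw r : P v r = P w r.
    have [t [q e]] := hT r; rewrite (Prep v r t q)// (Prep w r t q)//.
    by move/setP: (etrans gv (esym gw)) => /(_ t); rewrite !inE.
  (* As a and b are coprime, c = a / b is integral at v exactly when b is outside the prime of v, a
     condition that [Pvw] transfers to w. *)
  have [a [b [u [w' [cb uw]]]]] := hc c.
  have cab : c%:A * (phi b)%:A = (phi a)%:A :> L by rewrite mulr_algl scalerA cb.
  have nb : ~~ P w b.
    rewrite -Pvw; apply/negP => vb.
    have va : P v a by rewrite /P -cab; apply: vgeM0.
    have : vge v 1 ((phi 1)%:A : L).
      by rewrite -uw rmorphD scalerDl !phiA; apply: vgeD; apply: vgeM0.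
    by rewrite rmorph1 scale1r vgeE ?oner_neq0// place1.
  have [b0 wb] := vgePn nb; have wb0 : w ((phi b)%:A : L) = 0.
    by have := wR b; rewrite vgeE//; lia.
  by have := wR a; rewrite -cab mulrC vgeMl// wb0 subr0.
have : finite_set (\bigcup_(G in [set: {set T}]) [set v | V v /\ g v = G]).
  by apply: bigcup_finite => [|G0 _]; [exact: finite_finset|exact: fib].
by apply: sub_finite_set => v Vv; exists (g v).
Qed.

(** For c = a / b in k, a place with v c nonzero has v (a b) > 0, so [finite_places_pos] applies
    with m = a b. A general x reduces to the coefficients of an algebraic relation. *)
Lemma finite_places_ring (x : L) :
  (forall m, phi m != 0 ->
     exists (T : finType) (rep : T -> R), forall r, exists t q, r = rep t + m * q) ->
  (forall c : k, exists a b u s, [/\ phi b != 0, c * phi b = phi a & u * a + s * b = 1]) ->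
  x != 0 ->
  finite_set [set v : place L | (forall r, vge v 0 ((phi r)%:A : L)) /\ v x != 0].
Proof.
move=> hR hc x0; set n := \dim {:L}.
have fc (c : k) : c != 0 -> finite_set [set v : place L |
    (forall r, vge v 0 ((phi r)%:A : L)) /\ v (c%:A : L) != 0].
  move=> c0; have [a [b [u [w [b0 cb uw]]]]] := hc c.
  have a0 : phi a != 0 by rewrite -cb mulf_neq0.
  have [|T [rep hrep]] := hR (a * b); first by rewrite rmorphM mulf_neq0.
  apply: sub_finite_set (finite_places_pos hrep _); last first.
    by move=> c'; have [a' [b' [u' [w'' [_ h1 h2]]]]] := hc c'; exists a', b', u', w''.
  move=> v [vR vc]; split=> //.
  have A0 (d : k) : d != 0 -> d%:A != 0 :> L by move=> d0; rewrite scaler_eq0 negb_or d0 oner_neq0.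
  have cab : c%:A * (phi b)%:A = (phi a)%:A :> L by rewrite mulr_algl scalerA cb.
  have vab : v (c%:A : L) + v ((phi b)%:A : L) = v ((phi a)%:A : L).
    by rewrite -placeM ?A0// cab.
  have := vR a; have := vR b; rewrite phiA !vgeE ?mulf_neq0 ?A0// placeM ?A0//; lia.
have [c [c0 cn0]] : exists c : 'I_n.+1 -> k, \sum_i c i *: x ^+ i = 0 /\ exists i, c i != 0.
  have : ~~ free [tuple x ^+ i | i < n.+1].
    apply/negP => /eqP f; have := dimvS (subvf <<[tuple x ^+ i | i < n.+1]>>).
    by rewrite f size_tuple ltnn.
  move=> /freeP h; apply: contrapT => h'; apply: h => c c0 i.
  apply: contrapT => /eqP ci; apply: h'; exists c; split; last by exists i.
  by rewrite -[RHS]c0; apply: eq_bigr => j _; rewrite -tnth_nth tnth_mktuple.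
have : finite_set (\bigcup_(i in [set i | c i != 0])
   [set v : place L | (forall r, vge v 0 ((phi r)%:A : L)) /\ v ((c i)%:A : L) != 0]).
  by apply: bigcup_finite => // i /fc.
apply: sub_finite_set => v [vR vx].
by have [i ci vi] := place_coef_neq0 x0 c0 cn0 vx; exists i.
Qed.

End Residues.

End FiniteExtension.

Lemma finite_places_rat (L : fieldExtType rat) (x : L) : x != 0 ->
  finite_set [set v : place L | v x != 0].
Proof.
move=> x0; pose phi : {rmorphism int -> rat} := intr.
apply: sub_finite_set (finite_places_ring (phi := phi) _ _ x0).
- move=> v vx; split=> // r.
  have hn (m : nat) : vge v 0 ((phi m%:Z)%:A : L).
    elim: m => [|m IH]; first by rewrite rmorph0 scale0r vge0.
    by rewrite intS rmorphD rmorph1 scalerDl scale1r; apply: vgeD; rewrite ?vge1.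
  by case: r => m //; rewrite NegzE rmorphN scaleNr vgeN.
- move=> m m0; have {}m0 : m != 0 by apply: contraNneq m0 => ->; rewrite rmorph0.
  exists 'I_`|m|, (fun i : 'I_`|m| => (i : nat)%:Z) => r.
  have lt : (`|(r %% m)%Z| < `|m|)%N.
    by have := modz_ge0 r m0; have := ltz_mod r m0; lia.
  exists (Ordinal lt), (r %/ m)%Z; rewrite {1}(divz_eq r m) /=.
  by have := modz_ge0 r m0; lia.
- move=> c; have [u [s e]] := Bezoutz (numq c) (denq c).
  exists (numq c), (denq c), u, s; split.
  + by rewrite intr_eq0 denq_neq0.
  + by rewrite /phi /= -{1}(divq_num_den c) divfK// intr_eq0 denq_neq0.
  + by rewrite e /gcdz; have /eqP -> := coprime_num_den c.
Qed.

Lemma frac_exists (R : idomainType) (c : {fraction R}) :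
  exists a b : R, b != 0 /\ c * tofrac b = tofrac a.
Proof.
elim/quotW: c => r; exists \n_r, \d_r; split; first exact: denom_ratioP.
change (FracField.mul (\pi_({fraction R})%qT r) (tofrac \d_r) = tofrac \n_r).
rewrite !piE; apply/eqmodP; rewrite /= FracField.equivfE /FracField.mulf.
rewrite !numden_Ratio ?oner_neq0 ?mulf_neq0 ?denom_ratioP ?oner_neq0//.
by rewrite !mulr1 mulrC.
Qed.

(** * Places of a function field *)

Section FunctionField.
Variables (F : finFieldType) (L : fieldExtType {fraction {poly F}}).
Let phi : {rmorphism {poly F} -> {fraction {poly F}}} := @tofrac _.
Local Notation e p := ((phi p)%:A : L).
Implicit Type v : place L.

Let eM p q : e (p * q) = e p * e q.
Proof. by rewrite rmorphM mulr_algl scalerA. Qed.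

Let eD p q : e (p + q) = e p + e q.
Proof. by rewrite rmorphD scalerDl. Qed.

Let e_eq0 p : (e p == 0) = (p == 0).
Proof. by rewrite scaler_eq0 oner_eq0 orbF tofrac_eq0. Qed.

(** c^q = c for q = #|F|, so q * v = v. *)
Lemma place_const v (c : F) : v (e c%:P) = 0.
Proof.
have [->|c0] := eqVneq c 0; first by rewrite rmorph0 scale0r place0.
have y0 : e c%:P != 0 by rewrite e_eq0 polyC_eq0.
have eX n : e (c%:P ^+ n) = e c%:P ^+ n.
  by elim: n => [|n IH]; rewrite ?expr0 ?rmorph1 ?scale1r// !exprS eM IH.
have := placeX v #|F| y0; rewrite -eX -polyC_exp expf_card.
have := finNzRing_gt1 F; move: (v _) (#|F|) => a q; nia.
Qed.

Lemma vge_const v (c : F) : vge v 0 (e c%:P).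
Proof. exact/vge_val/place_const. Qed.

(** At a pole of X the leading term dominates. All these places therefore lie over the place at
    infinity of F(X), the one not seen by the ring F[X]. *)
Lemma place_pole v (p : {poly F}) : v (e 'X) < 0 -> p != 0 ->
  v (e p) = (size p).-1%:Z * v (e 'X).
Proof.
move=> vX; have X0 : e 'X != 0 by rewrite e_eq0 polyX_eq0.
elim/poly_ind: p => [|p c IH]; first by rewrite eqxx.
rewrite size_MXaddC eD eM; have [->|p0] := eqVneq p 0.
  rewrite mul0r add0r polyC_eq0 => c0.
  by rewrite (negPf c0) andbF /= size_poly0 rmorph0 scale0r mul0r add0r place_const mul0r.
rewrite /= => _; have ep0 : e p != 0 by rewrite e_eq0.
have h : v (e p * e 'X) = (size p)%:Z * v (e 'X).
  have := size_poly_gt0 p; rewrite p0 placeM// IH//; case: (size p) => // n _.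
  by rewrite /= intS mulrDl mul1r addrC.
have t0 : e p * e 'X != 0 by rewrite mulf_neq0.
have neg : v (e p * e 'X) < 0.
  by rewrite h; have := size_poly_gt0 p; rewrite p0; move: (v _) vX => a; nia.
by have [_ ->] := place_eq t0 neg (vge_const v c).
Qed.

Lemma poly_fraction (c : {fraction {poly F}}) : exists a b u s : {poly F},
  [/\ phi b != 0, c * phi b = phi a & u * a + s * b = 1].
Proof.
have [a [b [b0 cb]]] := frac_exists c; pose d := gcdp a b.
have d0 : d != 0 by rewrite gcdp_eq0 negb_and b0 orbT.
have /Bezout_eq1_coprimepP[[u s] /= us] : coprimep (a %/ d) (b %/ d).
  by rewrite coprimep_div_gcd// b0 orbT.
have ad : a %/ d * d = a by rewrite divpK// dvdp_gcdl.
have bd : b %/ d * d = b by rewrite divpK// dvdp_gcdr.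
exists (a %/ d), (b %/ d), u, s; split=> //.
  by rewrite tofrac_eq0; apply: contraNneq b0 => h; rewrite -bd h mul0r.
have dF : phi d != 0 by rewrite tofrac_eq0.
by apply: (mulIf dF); rewrite -mulrA -!rmorphM ad bd.
Qed.

Lemma finite_places_fraction (x : L) : x != 0 -> finite_set [set v : place L | v x != 0].
Proof.
move=> x0.
have fin : finite_set [set v : place L | v (e 'X) < 0].
  apply: finite_places_above => v w c /= vX wX.
  have [a [b [u [s [b0 cb _]]]]] := poly_fraction c.
  have [->|c0] := eqVneq c 0; first by rewrite scale0r !vge0.
  have a0 : phi a != 0 by rewrite -cb; exact: (mulf_neq0 c0 b0).
  have cA : c%:A * e b = e a by rewrite mulr_algl scalerA cb.
  rewrite !tofrac_eq0 in a0 b0.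
  have cA0 : (c%:A : L) != 0 by rewrite scaler_eq0 negb_or c0 oner_neq0.
  have val (z : place L) : z (e 'X) < 0 ->
      z (c%:A : L) = ((size a).-1%:Z - (size b).-1%:Z) * z (e 'X).
    move=> zX; have := placeM z cA0 (_ : e b != 0); rewrite e_eq0 => /(_ b0).
    by rewrite cA (place_pole zX a0) (place_pole zX b0) mulrBl => ->; rewrite addrK.
  rewrite !vgeE// (val v vX) (val w wX); move: (v _) (w _) vX wX => i j; nia.
have hp : forall m, phi m != 0 -> exists (T : finType) (rep : T -> {poly F}),
    forall r, exists t q, r = rep t + m * q.
  move=> m; rewrite tofrac_eq0 => m0; exists 'rV[F]_(size m), rVpoly => r.
  exists (poly_rV (r %% m)), (r %/ m).
  by rewrite poly_rV_K ?(ltnW (ltn_modpN0 _ m0))// addrC mulrC -divp_eq.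
have fin2 := finite_places_ring hp poly_fraction x0.
apply: (@sub_finite_set _ _ ([set v : place L | v (e 'X) < 0] `|`
   [set v | (forall r, vge v 0 (e r)) /\ v x != 0])); last by rewrite finite_setU.
move=> v vx; have [vX|vX] := ltP (v (e 'X)) 0; [by left|right; split=> //].
elim/poly_ind => [|p c IH]; first by rewrite rmorph0 scale0r vge0.
rewrite eD eM; apply: vgeD (vge_const _ _); apply: vgeM0 => //.
by rewrite vgeE// e_eq0 polyX_eq0.
Qed.

End FunctionField.

Lemma finite_places_iso (K L : fieldType) (f : {rmorphism K -> L}) (x : K) :
  bijective f -> finite_set [set w : place L | w (f x) != 0] ->
  finite_set [set v : place K | v x != 0].
Proof.
move=> [g fK gK] fin.
have gM : {morph g : a b / a * b} by move=> a b; apply: (can_inj fK); rewrite rmorphM !gK.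
have gD : {morph g : a b / a + b} by move=> a b; apply: (can_inj fK); rewrite rmorphD !gK.
have g0 : g 0 = 0 by rewrite -(rmorph0 f) fK.
have gn a : a != 0 -> g a != 0.
  by move=> a0; apply: contraNneq a0 => h; rewrite -(gK a) h rmorph0.
have /choice[T hT] : forall v : place K, exists w : place L, forall a, w a = v (g a).
  move=> v.
  have h0 : v (g 0) = 0 by rewrite g0 place0.
  have hM a b : a != 0 -> b != 0 -> v (g (a * b)) = v (g a) + v (g b).
    by move=> a0 b0; rewrite gM placeM// gn.
  have hD a b : a != 0 -> b != 0 -> a + b != 0 -> Num.min (v (g a)) (v (g b)) <= v (g (a + b)).
    by move=> a0 b0 ab; rewrite gD; apply: placeD; rewrite ?gn// -gD gn.
  have hU : exists2 a, a != 0 & v (g a) = 1.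
    by have [a a0 va] := place_uniformizer v; exists (f a); rewrite ?fmorph_eq0// fK.
  by exists (Place h0 hM hD hU).
have Tinj : injective T.
  move=> v w vw; apply: place_ext => a; rewrite -(fK a) -!hT vw//.
have := finite_preimage (f := T) (B := [set w : place L | w (f x) != 0]).
move=> /(_ (in2W Tinj) fin); apply: sub_finite_set => v /=.
by rewrite hT fK.
Qed.

Lemma finite_places_global (K : fieldType) (x : K) : global_field K -> x != 0 ->
  finite_set [set v : place K | v x != 0].
Proof.
move=> [[L [f bf]]|[F [L [f bf]]]] x0; apply: (finite_places_iso bf).
  by apply: finite_places_rat; rewrite fmorph_eq0.
by apply: finite_places_fraction; rewrite fmorph_eq0.
Qed.

(** * From local to global *)

Section Families.
Variables (K : fieldType) (S : set (place K)).
Local Notation X := (Acurve S).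
Local Notation vp p := (cplace (Kp p)).

Lemma family_update (T : X -> Type) (f : forall p, T p) p (y : T p) :
  exists g : forall q, T q, g p = y /\ forall q, q <> p -> g q = f q.
Proof.
pose g q := if pselect (p = q) is left e then eq_rect p T y q e else f q.
exists g; split=> [|q qp]; rewrite /g; case: pselect => // e.
  by rewrite (Prop_irrelevance e erefl).
by case: qp.
Qed.

Lemma finite_coef (x : K) : global_field K -> x != 0 ->
  finite_set [set p : X | (val p : place K) x != 0].
Proof.
move=> gK x0; have fin := finite_places_global gK x0.
have := finite_preimage (f := val : X -> place K) (in2W val_inj) fin.
by apply: sub_finite_set.
Qed.

Lemma vge_cembed (p : X) n (x : K) : vge (vp p) n (cembed (Kp p) x) = vge (val p) n x.
Proof. by rewrite /vge fmorph_eq0 cplaceE. Qed.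

Section Agreement.
Variables (V : vectType K) (W : forall p : X, vectType (Kp p)).
Variable loc : forall p : X, V -> W p.
Hypothesis locD : forall p x y, loc p (x + y) = loc p x + loc p y.
Hypothesis locZ : forall p c x, loc p (c *: x) = cembed (Kp p) c *: loc p x.
Hypothesis gK : global_field K.

Let loc_sum p n (F : 'I_n -> V) : loc p (\sum_i F i) = \sum_i loc p (F i).
Proof.
apply: (big_morph _ (locD p)).
by have := locZ p 0 0; rewrite scaler0 rmorph0 scale0r.
Qed.

(** The coordinates of [b1] in [b2] are finitely many elements of K, and the nonzero ones are units
    at almost all places. *)
Lemma finite_vspan_nonsub (b1 b2 : seq V) : basis_of fullv b2 ->
  finite_set [set p | ~ (vspan (vp p) (map (loc p) b1) `<=` vspan (vp p) (map (loc p) b2))].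
Proof.
move=> bb2; pose c (i : 'I_(size b1)) j := coord (in_tuple b2) j b1`_i.
pose bad i j := [set p : X | c i j != 0 /\ (val p : place K) (c i j) != 0].
have fbad i j : finite_set (bad i j).
  have [e|ne] := eqVneq (c i j) 0.
    by rewrite (_ : bad i j = set0)//; apply/seteqP; split=> // p [] /=; rewrite e eqxx.
  by apply: sub_finite_set (finite_coef gK ne) => p [].
have : finite_set (\bigcup_(ij in [set: 'I_(size b1) * 'I_(size b2)]) bad ij.1 ij.2).
  by apply: bigcup_finite => [|ij _]; [exact: finite_finset|exact: fbad].
apply: sub_finite_set => p /= h; apply: contrapT => nb; apply: h.
apply: vspan_sub; first exact: vspan_submod.
move=> _ /mapP[x /(nthP 0)[i ib <-] ->].
have -> : b1`_i = \sum_j c (Ordinal ib) j *: b2`_j.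
  by apply: coord_span; rewrite (span_basis bb2) memvf.
rewrite loc_sum; apply: vsubmod_sum => [|j _]; first exact: vspan_submod.
rewrite locZ; apply: vsubmodZ; first exact: vspan_submod; last first.
  by apply/mem_vspan/map_f; rewrite mem_nth.
rewrite vge_cembed; have [->|cn] := eqVneq (c (Ordinal ib) j) 0; first exact: vge0.
have [v0|vn] := eqVneq ((val p : place K) (c (Ordinal ib) j)) 0; first exact: vge_val.
by case: nb; exists (Ordinal ib, j).
Qed.

Lemma X_lattice_agree (M1 M2 : forall p, set (W p)) :
  X_lattice loc M1 -> X_lattice loc M2 -> finite_set [set p | M1 p <> M2 p].
Proof.
move=> [_ [b1 bb1 f1]] [_ [b2 bb2 f2]].
have := conj (conj f1 f2) (conj (finite_vspan_nonsub b1 bb2) (finite_vspan_nonsub b2 bb1)).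
rewrite -!finite_setU; apply: sub_finite_set => p /= M12.
have [e1|] := pselect (M1 p = Ospan (map (loc p) b1)); last by left; left.
have [e2|] := pselect (M2 p = Ospan (map (loc p) b2)); last by left; right.
have [s1|] := pselect (vspan (vp p) (map (loc p) b1) `<=` vspan (vp p) (map (loc p) b2));
  last by right; left.
have [s2|] := pselect (vspan (vp p) (map (loc p) b2) `<=` vspan (vp p) (map (loc p) b1));
  last by right; right.
by case: M12; rewrite e1 e2; apply/seteqP.
Qed.

Lemma X_lattice_patch (M M' : forall p, set (W p)) :
  X_lattice loc M -> (forall p, lattice (vp p) (M' p)) ->
  finite_set [set p | M' p <> M p] -> X_lattice loc M'.
Proof.
move=> [_ [b bb fb]] lM' fM; split=> //; exists b => //.
have := conj fM fb; rewrite -finite_setU; apply: sub_finite_set => p /= h.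
have [e|] := pselect (M' p = M p); last by left.
by right; rewrite -e.
Qed.

End Agreement.

Section Orders.
Variable A : falgType K.
Hypothesis gK : global_field K.

Lemma X_order_local (D : A_family S A) p : X_order D -> lorder (vp p) (D p).
Proof. by move=> [[lD _] hD]; split; [exact: lD|exact: hD]. Qed.

Lemma X_order_patch (D D' : A_family S A) : X_order D ->
  (forall p, lorder (vp p) (D' p)) -> finite_set [set p | D' p <> D p] -> X_order D'.
Proof.
move=> [lD _] lD' fD; split; last by move=> p; case: (lD' p).
by apply: X_lattice_patch lD _ fD => p; case: (lD' p).
Qed.

Lemma X_order_agree (D D' : A_family S A) : X_order D -> X_order D' ->
  finite_set [set p | D p <> D' p].
Proof.
move=> [lD _] [lD' _]; apply: X_lattice_agree lD lD' => // [p x y|p c x].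
- exact: base_changeD.
- exact: base_changeZ.
Qed.

(** Enlarging D at the single place p leaves it an order family, so global maximality applies to the
    enlarged family. *)
Lemma maximal_order_local (D : A_family S A) p :
  maximal_order D -> lmaximal (vp p) (D p).
Proof.
move=> [oD mD]; split=> [|N oN DN]; first exact: X_order_local.
have [D' [D'p D'q]] := @family_update (fun q => set (Ap A q)) D p N.
rewrite -D'p; apply: mD => [|q].
  apply: (X_order_patch oD) => [q|].
    have [->|qp] := pselect (q = p); first by rewrite D'p.
    by rewrite D'q//; exact: X_order_local.
  by apply: sub_finite_set (finite_set1 p) => q /= h; apply: contrapT => /D'q.
have [->|qp] := pselect (q = p); first by rewrite D'p.
by rewrite D'q.
Qed.

Lemma maximal_order_patch (D D' : A_family S A) : maximal_order D ->
  (forall p, lmaximal (vp p) (D' p)) -> finite_set [set p | D' p <> D p] -> maximal_order D'.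
Proof.
move=> [oD _] mD' fD; split; first by apply: X_order_patch oD _ fD => p; case: (mD' p).
by move=> N oN D'N p; apply: (mD' p).2 => //; exact: X_order_local.
Qed.

End Orders.

Section Ideals.

Lemma lattice_ppow (p : X) (k : nat) :
  lattice (vp p) ([set z | vge (vp p) k z] : set (Kp p)^o).
Proof.
have p0 := ppow_neq0 (vp p) k.
exists [:: ppow (vp p) k : (Kp p)^o].
  apply/eqP; rewrite eqEdim subvf span_seq1 dim_vline p0 dimvf.
  by [].
apply/seteqP; split=> [z /ppow_dvd[y hy ->]|_ [c hc ->]] /=.
  by exists (fun=> y) => //; rewrite big_ord1 /= mulrC.
by rewrite big_ord1 /=; apply: vgeM0 => //; exact: vge_ppow.
Qed.

Lemma Op_X_lattice : @X_lattice K S K^o (fun p => (Kp p)^o) (fun p => cembed (Kp p)) Op.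
Proof.
split=> [p|]; first exact: (lattice_ppow p 0).
exists [:: 1 : K^o].
  by rewrite /basis_of seq1_free oner_neq0 andbT eqEdim subvf span_seq1 dim_vline oner_neq0 dimvf.
rewrite (_ : [set p | _] = set0)//; apply/seteqP; split=> // p /=; apply.
apply/seteqP; split=> [z hz|_ [c hc ->]] /=.
  by exists (fun=> z) => //; rewrite big_ord1 /= rmorph1; exact: (esym (mulr1 z)).
by rewrite big_ord1 /= rmorph1; apply: (vgeM0 (hc ord0)); exact: vge1.
Qed.

Lemma integral_ideal_finite (I : K_family S) : global_field K -> integral_ideal I ->
  finite_set [set p | I p <> Op p].
Proof.
move=> gK [lI _]; apply: X_lattice_agree lI Op_X_lattice => // [p x y|p c x].
- exact: rmorphD.
- exact: rmorphM.
Qed.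

Lemma integral_ideal_local (I : K_family S) p : integral_ideal I ->
  exists k : nat, I p = [set z | vge (vp p) k z].
Proof.
move=> [[/(_ p) lI _] /(_ p) IO].
have sI := lattice_submod lI.
have [x0 Ix0 x00] : exists2 x, I p x & x != 0.
  have [c c0 Ic] := lattice_absorb lI (1 : (Kp p)^o).
  by exists (c *: (1 : (Kp p)^o)) => //; rewrite mulf_neq0 ?oner_neq0.
have [||m [[x [Ix xn vx]] hm]] :=
    @int_min (fun n => exists x, [/\ I p x, x != 0 & vp p x = n]) 0.
- by exists (vp p x0), x0.
- move=> n [x [Ix xn <-]]; have := IO _ Ix.
  by rewrite /Op /valuation_ring /= vgeE.
have m0 : 0 <= m.
  by have := IO _ Ix; rewrite /Op /valuation_ring /= vgeE// vx.
exists `|m|%N; have -> : `|m|%N = m :> int by lia.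
apply/seteqP; split=> z /=.
  move=> Iz; have [->|z0] := eqVneq z 0; first exact: vge0.
  by rewrite vgeE//; apply: hm; exists z.
move=> hz; have -> : z = (x^-1 * z) *: (x : (Kp p)^o).
  by rewrite [RHS]mulrC mulVKf.
apply: (vsubmodZ sI) => //; rewrite vgeMl ?invr_neq0// placeV vx opprK add0r//.
Qed.

Lemma OX_plus_ppow (A : falgType K) (I : K_family S) (D : A_family S A) p (k : nat) :
  vsubmod (vp p) (D p) -> I p = [set z | vge (vp p) k z] ->
  OX_plus I D p = [set z | exists c y, [/\ vge (vp p) 0 c, D p y & z = c%:A + ppow (vp p) k *: y]].
Proof.
move=> sD Ik; apply/seteqP; split=> [_ [c [_ [hc [n [a [d [ha hd ->]]]] ->]]]|].
  have pk := ppow_neq0 (vp p) k.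
  exists c, (\sum_i ((ppow (vp p) k)^-1 * a i) *: d i); split=> //.
    apply: (vsubmod_sum sD) => i _; apply: (vsubmodZ sD) => //.
    by rewrite vgeMl ?invr_neq0// placeV place_ppow opprK add0r; have := ha i; rewrite Ik.
  congr (_ + _); rewrite scaler_sumr; apply: eq_bigr => i _.
  by rewrite scalerA mulVKf.
move=> _ [c [y [hc Dy ->]]]; exists c, (ppow (vp p) k *: y); split=> //.
exists 1%N, (fun=> ppow (vp p) k), (fun=> y); split=> // [i|]; last by rewrite big_ord1.
by rewrite Ik /=; exact: vge_ppow.
Qed.

Lemma OX_plus_Op (A : falgType K) (I : K_family S) (D : A_family S A) p :
  vsubmod (vp p) (D p) -> D p 1 -> I p = Op p -> OX_plus I D p = D p.
Proof.
move=> sD D1 IO; apply/seteqP; split=> [_ [c [_ [hc [n [a [d [ha hd ->]]]] ->]]]|z Dz].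
  apply: (vsubmodD sD); first exact: (vsubmodZ sD).
  apply: (vsubmod_sum sD) => i _; apply: (vsubmodZ sD) => //.
  by have := ha i; rewrite IO.
exists 0, z; split; [exact: vge0| |by rewrite scale0r add0r].
exists 1%N, (fun=> 1), (fun=> z); split=> // [i|]; last by rewrite big_ord1 scale1r.
by rewrite IO; exact: vge1.
Qed.

End Ideals.

End Families.

(** * The two global implications *)

Section Main.
Variables (K : fieldType) (A : falgType K) (S : set (place K)).
Local Notation vp p := (cplace (Kp p)).

(** An element of valuation 1 at p is neither 0 nor 1, as additivity of the trace requires. *)
Lemma Ap_trace_form (p : Acurve S) : quaternion_algebra A ->
  exists t : {scalar Ap A p}, trace_form t.
Proof.
move=> qA; have r0 := ppow_neq0 (val p) 1.
have r1 : ppow (val p) 1 != 1.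
  by apply/eqP => /(congr1 (val p : place K)); rewrite place_ppow place1.
have [t ht] := trace_form_exists qA r0 r1.
exact: trace_form_ext ht.
Qed.

Lemma Ap_dim (p : Acurve S) : quaternion_algebra A -> \dim {:Ap A p} = 4%N.
Proof. by case=> dA _ _; rewrite dimvf /dim /= mul1n. Qed.

Lemma Ap_frame (p : Acurve S) : quaternion_algebra A -> ~ division_algebra (Ap A p) ->
  exists th : {linear Ap A p -> 'M[Kp p]_2}, frame th.
Proof.
by move=> qA nd; have [t ht] := Ap_trace_form p qA; exact: split_frame ht (Ap_dim p qA) nd.
Qed.

Lemma division_maximal_unique (p : Acurve S) (M N : set (Ap A p)) : quaternion_algebra A ->
  division_algebra (Ap A p) -> lmaximal (vp p) M -> lmaximal (vp p) N -> M = N.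
Proof.
move=> qA dA mM mN; have [t ht] := Ap_trace_form p qA.
have c := @ccomplete _ _ (Kp p).
by rewrite (division_maximal c ht dA mM) (division_maximal c ht dA mN).
Qed.

Lemma setI_vsubmod (p : Acurve S) (M N : set (Ap A p)) :
  lmaximal (vp p) M -> lmaximal (vp p) N -> vsubmod (vp p) (M `&` N).
Proof.
move=> [[lM _] _] [[lN _] _]; have sM := lattice_submod lM; have sN := lattice_submod lN.
split; first by split; [exact: sM.1|exact: sN.1].
by move=> c x y hc [Mx Nx] [My Ny]; split; [exact: sM.2|exact: sN.2].
Qed.

Lemma thick_Eichler_three (D D0 : A_family S A) (I : K_family S) :
  global_field K -> quaternion_algebra A -> Eichler_order D0 -> integral_ideal I ->
  (forall p, division_algebra (Ap A p) -> I p = Op p) ->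
  (forall p, D p = OX_plus I D0 p) ->
  exists M1 M2 M3 : A_family S A,
    [/\ maximal_order M1, maximal_order M2, maximal_order M3
      & forall p, D p = M1 p `&` M2 p `&` M3 p].
Proof.
move=> gK qA [M1 [M2 [mM1 mM2 D0E]]] iI Idiv DE.
have lM1 p := maximal_order_local p mM1; have lM2 p := maximal_order_local p mM2.
(* Where I_p = O_p the triple is fixed to [M1], [M2], [M1]. The chosen families then differ from
   global maximal orders at finitely many places only. *)
have loc p : exists N : set (Ap A p) * set (Ap A p) * set (Ap A p),
    [/\ lmaximal (vp p) N.1.1, lmaximal (vp p) N.1.2, lmaximal (vp p) N.2,
        D p = N.1.1 `&` N.1.2 `&` N.2 & I p = Op p -> N = (M1 p, M2 p, M1 p)].
  have sD : vsubmod (vp p) (D0 p) by rewrite D0E; exact: setI_vsubmod.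
  have [IO|nIO] := pselect (I p = Op p).
    exists (M1 p, M2 p, M1 p); split; [exact: lM1|exact: lM2|exact: lM1| |by []].
    rewrite /= DE OX_plus_Op// D0E.
      by rewrite setIAC setIid.
    by split; [case: (lM1 p) => -[_ []]|case: (lM2 p) => -[_ []]].
  (* I_p <> O_p rules out a division algebra, so the tree is available. *)
  have [th fth] := Ap_frame qA (fun d => nIO (Idiv p d)).
  have [k Ik] := integral_ideal_local p iI.
  have [N1 [N2 [N3 [h1 h2 h3 h]]]] := thick_path_intersection k fth (lM1 p) (lM2 p).
  exists (N1, N2, N3); split=> //=; rewrite DE (OX_plus_ppow sD Ik).
  apply/seteqP; split=> z /=; rewrite D0E.
    by case/h => *.
  by move=> [[z1 z2] z3]; apply/h.
pose N p := projT1 (cid (loc p)).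
have hN p : [/\ lmaximal (vp p) (N p).1.1, lmaximal (vp p) (N p).1.2, lmaximal (vp p) (N p).2,
    D p = (N p).1.1 `&` (N p).1.2 `&` (N p).2 & I p = Op p -> N p = (M1 p, M2 p, M1 p)].
  by rewrite /N; case: cid.
have fin := integral_ideal_finite gK iI.
have patch (M : A_family S A) (f : forall p, set (Ap A p)) : maximal_order M ->
    (forall p, lmaximal (vp p) (f p)) -> (forall p, I p = Op p -> f p = M p) -> maximal_order f.
  move=> mM lf fE; apply: maximal_order_patch mM lf _.
  by apply: sub_finite_set fin => p /= h IO; apply/h/fE.
exists (fun p => (N p).1.1), (fun p => (N p).1.2), (fun p => (N p).2); split.
- by apply: patch mM1 _ _ => p; have [h1 h2 h3 h4 h5] := hN p => // /h5->.
- by apply: patch mM2 _ _ => p; have [h1 h2 h3 h4 h5] := hN p => // /h5->.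
- by apply: patch mM1 _ _ => p; have [h1 h2 h3 h4 h5] := hN p => // /h5->.
- by move=> p; have [] := hN p.
Qed.

Lemma intersection_thick_Eichler (D : A_family S A) n (M : 'I_n.+1 -> A_family S A) :
  global_field K -> quaternion_algebra A -> (forall i, maximal_order (M i)) ->
  (forall p, D p = \bigcap_(i in [set: 'I_n.+1]) M i p) ->
  exists (D0 : A_family S A) (I : K_family S),
    [/\ Eichler_order D0, integral_ideal I,
        forall p, division_algebra (Ap A p) -> I p = Op p
      & forall p, D p = OX_plus I D0 p].
Proof.
move=> gK qA mM DE.
have lM i p := maximal_order_local p (mM i).
(* Almost all places are good, and so is every division place, its maximal order being unique.
   Exponent 0 is imposed at good places, so that I_p = O_p there. *)
pose good p := forall i, M i p = M ord0 p.
have loc p : exists N : set (Ap A p) * set (Ap A p) * nat,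
    [/\ lmaximal (vp p) N.1.1, lmaximal (vp p) N.1.2,
        D p = [set z | exists c y, [/\ vge (vp p) 0 c, (N.1.1 `&` N.1.2) y
                     & z = c%:A + ppow (vp p) N.2 *: y]]
      & good p -> N = (M ord0 p, M ord0 p, 0%N)].
  have [gp|ngp] := pselect (good p).
    exists (M ord0 p, M ord0 p, 0%N); split; [exact: lM|exact: lM| |by []]; rewrite /=.
    have [[lM0 [M01 _]] _] := lM ord0 p; have sM := lattice_submod lM0.
    rewrite DE; apply/seteqP; split=> [z /(_ ord0 I) Mz|_ [c [y [hc [My _] ->]]] i _].
      (* [ppow] at 0 is a unit that need not be 1 and has to be divided out. *)
      have p0 := ppow_neq0 (vp p) 0.
      have Mz' : M ord0 p ((ppow (vp p) 0%N)^-1 *: z).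
        by apply: (vsubmodZ sM) => //; apply: vge_val; rewrite placeV place_ppow oppr0.
      exists 0, ((ppow (vp p) 0%N)^-1 *: z); split=> //; first exact: vge0.
      by rewrite scale0r add0r scalerA mulfV// scale1r.
    rewrite gp; apply: (vsubmodD sM); apply: (vsubmodZ sM) => //; exact: vge_ppow.
  have nd : ~ division_algebra (Ap A p).
    by move=> d; apply: ngp => i; exact: division_maximal_unique qA d _ _.
  have [th fth] := Ap_frame qA nd.
  have [N1 [N2 [k [h1 h2 h]]]] := intersection_thick_path fth (fun i => lM i p).
  exists (N1, N2, k); split=> //=; rewrite DE.
  apply/seteqP; split=> z /=; first by move=> Mz; apply/h => i; exact: Mz.
  by move/h => Mz i _; exact: Mz.
pose N p := projT1 (cid (loc p)).
have hN p : [/\ lmaximal (vp p) (N p).1.1, lmaximal (vp p) (N p).1.2,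
        D p = [set z | exists c y, [/\ vge (vp p) 0 c, ((N p).1.1 `&` (N p).1.2) y
                     & z = c%:A + ppow (vp p) (N p).2 *: y]]
      & good p -> N p = (M ord0 p, M ord0 p, 0%N)].
  by rewrite /N; case: cid.
have fin : finite_set [set p | ~ good p].
  have : finite_set (\bigcup_(i in [set: 'I_n.+1]) [set p | M i p <> M ord0 p]).
    apply: bigcup_finite => [|i _]; first exact: finite_finset.
    by apply: X_order_agree; [exact: gK|case: (mM i)|case: (mM ord0)].
  by apply: sub_finite_set => p /= /existsNP[i Mi]; exists i.
have patch (f : forall p, set (Ap A p)) : (forall p, lmaximal (vp p) (f p)) ->
    (forall p, good p -> f p = M ord0 p) -> maximal_order f.
  move=> lf fE; apply: maximal_order_patch (mM ord0) lf _.
  by apply: sub_finite_set fin => p /= h g; apply/h/fE.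
exists (fun p => (N p).1.1 `&` (N p).1.2), (fun p => [set z | vge (vp p) (N p).2 z]); split.
- exists (fun p => (N p).1.1), (fun p => (N p).1.2); split=> //.
    by apply: patch => p; have [h1 h2 h3 h4] := hN p => // /h4->.
  by apply: patch => p; have [h1 h2 h3 h4] := hN p => // /h4->.
- split.
    apply: X_lattice_patch (Op_X_lattice S) _ _ => [p|]; first exact: lattice_ppow.
    apply: sub_finite_set fin => p /= h g; apply: h.
    by have [_ _ _ /(_ g) ->] := hN p.
  by move=> p z /= hz; apply: vgeW hz.
- move=> p d; have g : good p by move=> i; exact: division_maximal_unique qA d _ _.
  by have [_ _ _ /(_ g) ->] := hN p.
- move=> p; have [h1 h2 -> h4] := hN p.
  by rewrite (@OX_plus_ppow _ _ _ _ _ _ (N p).2)//; exact: setI_vsubmod.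
Qed.

Lemma three_finite_intersection (D M1 M2 M3 : A_family S A) :
  maximal_order M1 -> maximal_order M2 -> maximal_order M3 ->
  (forall p, D p = M1 p `&` M2 p `&` M3 p) ->
  exists (n : nat) (M : 'I_n.+1 -> A_family S A), (forall i, maximal_order (M i)) /\
    forall p, D p = \bigcap_(i in [set: 'I_n.+1]) M i p.
Proof.
move=> m1 m2 m3 DE.
pose M (i : 'I_3) := if val i is k.+1 then if k is _.+1 then M3 else M2 else M1.
exists 2%N, M; split=> [|p]; first by case=> -[|[|[]]].
rewrite DE; apply/seteqP; split=> [z [[z1 z2] z3] [[|[|[]]]]//|z h].
by split; [split|]; [exact: (h 0%R I)|exact: (h 1%R I)|exact: (h ord_max I)].
Qed.

End Main.

Theorem theorem1p2 (K : fieldType) (A : falgType K) (S : set (place K))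
    (D : A_family S A) :
  global_field K -> quaternion_algebra A -> finite_set S -> X_order D ->
  [<-> (exists (D0 : A_family S A) (I : K_family S),
          [/\ Eichler_order D0, integral_ideal I,
              forall p, division_algebra (Ap A p) -> I p = Op p
            & forall p, D p = OX_plus I D0 p]);
       (exists (n : nat) (M : 'I_n.+1 -> A_family S A),
          (forall i, maximal_order (M i)) /\
          forall p, D p = \bigcap_(i in [set: 'I_n.+1]) M i p);
       (exists M1 M2 M3 : A_family S A,
          [/\ maximal_order M1, maximal_order M2, maximal_order M3
            & forall p, D p = M1 p `&` M2 p `&` M3 p])].
Proof.
move=> gK qA _ _.
tfae.
- move=> [D0 [I [eD0 iI Idiv DE]]].
  have [M1 [M2 [M3 [m1 m2 m3 ME]]]] := thick_Eichler_three gK qA eD0 iI Idiv DE.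
  exact: three_finite_intersection m1 m2 m3 ME.
- move=> [n [M [mM ME]]].
  have [D0 [I [eD0 iI Idiv DE]]] := intersection_thick_Eichler gK qA mM ME.
  exact: thick_Eichler_three gK qA eD0 iI Idiv DE.
- move=> [M1 [M2 [M3 [m1 m2 m3 ME]]]].
  have [n [M [mM DE]]] := three_finite_intersection m1 m2 m3 ME.
  exact: intersection_thick_Eichler gK qA mM DE.
Qed.
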